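(* Let $\Gamma$ be a torsion-free countable amenable group with property ID. Let $\lambda\in(0,\infty)$. Then there is an expansive topologically free minimal action $\alpha$ of $\Gamma$ on the Cantor set $X$ with topological entropy $\lambda$ such that for every nonempty open set $U\subseteq X$ the free product $\mathbf{Z}_2*\mathbf{Z}_2*\mathbf{Z}_2$ embeds into the rigid stabilizer $\mathsf{A}(\alpha)_U$.
   Context: Acting groups are discrete and act by homeomorphisms. $\mathbf{Z}_2$ is the cyclic group of order $2$. An action is topologically free if the set of points with trivial stabilizer is dense, and minimal if every orbit is dense. An action of $\Gamma$ on a compact metrizable space $X$ with compatible metric $d$ is expansive if there is an $\varepsilon>0$ such that for all distinct $x,y\in X$ there is an $s\in\Gamma$ with $d(sx,sy)\geq\varepsilon$. For a group $G$ of transformations of a space $X$ and $U\subseteq X$, the rigid stabilizer $G_U$ is the group of all elements of $G$ which fix every point in the complement of $U$. Alternating group: for an action $\Gamma\stackrel{\alpha}{\curvearrowright}X$, the topological full group $[[\alpha]]$ is the group of all homeomorphisms $T:X\to X$ for which there exist a clopen partition $\{P_1,\dots,P_n\}$ of $X$ and $s_1,\dots,s_n\in\Gamma$ with $Tx=s_ix$ for every $i$ and $x\in P_i$. The alternating group $\mathsf{A}(\alpha)$ is the subgroup of $[[\alpha]]$ generated by the images $\varphi(\mathsf{A}_3)$ of the alternating group $\mathsf{A}_3$ on $\{1,2,3\}$, where $\varphi$ ranges over all group homomorphisms $\mathsf{S}_3\to[[\alpha]]$ for which there are pairwise disjoint clopen sets $A_1,A_2,A_3\subseteq X$ such that for every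 $\sigma\in\mathsf{S}_3$ the homeomorphism $\varphi(\sigma)$ is the identity off $A_1\sqcup A_2\sqcup A_3$ and, for each $i$, acts on $A_i$ as some element of $\Gamma$ with image $A_{\sigma(i)}$. Topological entropy: for an action $\alpha$ of a countable amenable group $\Gamma$ on a compact metrizable space $X$ with compatible metric $d$, a finite set $F\subseteq\Gamma$, and $\varepsilon>0$, let $\mathrm{sep}_d(\alpha,F,\varepsilon)$ be the maximum cardinality of a set $A\subseteq X$ such that for all distinct $x,y\in A$ there is $s\in F$ with $d(sx,sy)>\varepsilon$. Then $h_{\mathrm{top}}(\alpha)=\sup_{\varepsilon>0}\limsup_{n\to\infty}\frac{1}{|F_n|}\log\mathrm{sep}_d(\alpha,F_n,\varepsilon)$ for any (left) F{\o}lner sequence $(F_n)$ for $\Gamma$ (independent of choices). Tilings: a tiling of a countable group $\Gamma$ is a finite collection $\{(S_i,C_i)\}_{i\in I}$ of pairs where the $S_i$ are nonempty finite subsets of $\Gamma$ (shapes) and the $C_i$ are subsets of $\Gamma$ (center sets) such that $\Gamma=\bigsqcup_{i\in I}\bigsqcup_{c\in C_i}S_ic$; the sets $S_ic$ are called tiles. A sequence $(\mathscr{T}_n)$ of tilings is tightly nested if for every $n>1$ and $(S,C)\in\mathscr{T}_n$ the shape $S$ can be expressed as a partition $\bigsqcup_{j\in J}S_jg_j$, where the $S_j$ are shapes of $\mathscr{T}_{n-1}$ and $g_j\in\Gamma$, such that for every $c\in C$ and $j\in J$ the element $g_jc$ is a tiling center (in $\mathscr{T}_{n-1}$) for the shape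 $S_j$. It is a sequence of F{\o}lner tilings if for every finite $F\subseteq\Gamma$ and $\delta>0$ there is an $N$ such that for every $n\geq N$ each shape $S$ of $\mathscr{T}_n$ satisfies $|S\cap\bigcap_{t\in F}t^{-1}S|\geq(1-\delta)|S|$. The entropy of a tiling $\{(S_i,C_i)\}_{i\in I}$ is the topological entropy of the restriction of the right shift action $\Gamma\curvearrowright Y^\Gamma$, $(sx)_t=x_{ts}$, to $\overline{\Gamma x}$, where $Y=\{S_i:i\in I\}\cup\{0\}$ and $x\in Y^\Gamma$ is given by $x_t=S_i$ if $t\in C_i$ and $x_t=0$ otherwise. A set $C\subseteq\Gamma$ is syndetic if $FC=\Gamma$ for some finite $F\subseteq\Gamma$. Property ID: a countable group $\Gamma$ has property ID if there exist an infinite cyclic subgroup $H\subseteq\Gamma$ of infinite index and a tightly nested sequence $(\mathscr{T}_n)$ of F{\o}lner tilings with syndetic center sets and entropies converging to zero such that (i) for every finite set $F\subseteq\Gamma$ there is an $n\in\mathbf{N}$ such that $F$ is contained in some tile of $\mathscr{T}_n$; (ii) for every $\delta>0$ there is an $n_0\in\mathbf{N}$ such that for all $n\geq n_0$ one has $|H\cap T|\leq\delta|T|$ for every tile $T$ of $\mathscr{T}_n$; (iii) for every $n\in\mathbf{N}$ there are a shape $S$ of $\mathscr{T}_n$ and a subgroup $H_0$ of $H$ such that the sets $Sc$ for $c\in H_0$ are tiles of $\mathscr{T}_n$ whose union contains $H$. *)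

(* Defs.v *)
From HB Require Import structures.
From mathcomp Require Import all_boot all_order all_algebra.
From mathcomp Require Import fingroup perm alt.
From mathcomp Require Import finmap.
From mathcomp Require Import all_classical all_reals all_analysis.

Set Implicit Arguments.
Unset Strict Implicit.
Unset Printing Implicit Defensive.

Import Order.TTheory GRing.Theory Num.Theory.
Import numFieldNormedType.Exports.

Local Open Scope classical_set_scope.
Local Open Scope ring_scope.

Section Groups.
Variable G : groupType.
Local Open Scope group_scope.
Implicit Types (A H K : set G) (F : {fset G}) (s t g c : G).

Definition is_subgroup H := group_closed (mem H).

Definition generated A : set G :=
  \bigcap_(H in [set H | is_subgroup H /\ A `<=` H]) H.

Definition torsion_free :=
  forall g (n : nat), (0 < n)%N -> g ^+ n = 1 -> g = 1.

Definition infinite_cyclic H :=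
  (exists h, H = generated [set h]) /\ infinite_set H.

Definition left_coset g H : set G := [set g * h | h in H].

Definition infinite_index H := infinite_set (range (left_coset^~ H)).

Definition syndetic A :=
  exists F, forall g, exists f, exists2 c, f \in F & A c /\ g = f * c.

Definition ltranslate s F : {fset G} := [fset s * t | t in F]%fset.
Definition rtranslate F c : {fset G} := [fset t * c | t in F]%fset.

End Groups.

Arguments torsion_free G : clear implicits.

(** Amenability: existence of a left-invariant finitely additive probability
    measure defined on all subsets. *)
Definition amenable (R : realType) (G : groupType) :=
  exists mu : set G -> R,
    [/\ forall A, 0 <= mu A,
        mu setT = 1,
        forall A B, A `&` B = set0 -> mu (A `|` B) = mu A + mu B &
        forall s A, mu (left_coset s A) = mu A].

Definition symdiff (T : choiceType) (A B : {fset T}) : {fset T} :=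
  ((A `\` B) `|` (B `\` A))%fset.

Definition left_Folner (R : realType) (G : groupType) (F : nat -> {fset G}) :=
  (forall n, F n != fset0) /\
  (forall s : G,
     (fun n => #|` symdiff (ltranslate s (F n)) (F n)|%:R / #|` F n|%:R : R)
       @ \oo --> (0 : R)).

Record homeo (X : topologicalType) := Homeo {
  homeo_fun :> X -> X;
  homeo_inv : X -> X;
  homeoK : cancel homeo_fun homeo_inv;
  homeoVK : cancel homeo_inv homeo_fun;
  homeo_cont : continuous homeo_fun;
  homeo_inv_cont : continuous homeo_inv }.

HB.instance Definition _ (X : topologicalType) := gen_eqMixin (homeo X).
HB.instance Definition _ (X : topologicalType) := gen_choiceMixin (homeo X).

Section HomeoGroup.
Variable X : topologicalType.
Implicit Types f g : homeo X.

Lemma homeo_ext f g : (forall x, f x = g x) -> f = g.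
Proof.
case: f g => [f f' fK fVK cf cf'] [g g' gK gVK cg cg'] /= fg.
have {}fg : f = g by apply/funext.
subst g; have fg' : f' = g'.
  by apply/funext => x; rewrite -[x in LHS]gVK fK.
by subst g'; congr Homeo; exact: Prop_irrelevance.
Qed.

Lemma cont_id : continuous (@id X).
Proof. by move=> x; exact: cvg_id. Qed.

Lemma cont_comp (f g : X -> X) :
  continuous f -> continuous g -> continuous (f \o g).
Proof. by move=> cf cg x; apply: continuous_comp; [exact: cg|exact: cf]. Qed.

Definition homeo1 : homeo X :=
  @Homeo X id id (fun=> erefl) (fun=> erefl) cont_id cont_id.

Definition homeoV f : homeo X :=
  Homeo (@homeoVK X f) (@homeoK X f)
    (@homeo_inv_cont X f) (@homeo_cont X f).

Definition homeoM f g : homeo X :=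
  Homeo (can_comp (@homeoK X f) (@homeoK X g))
    (can_comp (@homeoVK X g) (@homeoVK X f))
    (cont_comp (@homeo_cont X f) (@homeo_cont X g))
    (cont_comp (@homeo_inv_cont X g) (@homeo_inv_cont X f)).

Fact homeoMA : associative homeoM.
Proof. by move=> f g h; apply: homeo_ext. Qed.
Fact homeo1M : left_id homeo1 homeoM.
Proof. by move=> f; apply: homeo_ext. Qed.
Fact homeoM1 : right_id homeo1 homeoM.
Proof. by move=> f; apply: homeo_ext. Qed.
Fact homeoMV : left_inverse homeo1 homeoV homeoM.
Proof. by move=> f; apply: homeo_ext => x /=; rewrite homeoK. Qed.
Fact homeoVM : right_inverse homeo1 homeoV homeoM.
Proof. by move=> f; apply: homeo_ext => x /=; rewrite homeoVK. Qed.

HB.instance Definition _ := isGroup.Build (homeo X)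
  homeoMA homeo1M homeoM1 homeoMV homeoVM.

Lemma homeoME f g x : (f * g)%g x = f (g x).
Proof. by []. Qed.

End HomeoGroup.

Section Actions.
Variables (R : realType) (G : groupType) (X : topologicalType).
Implicit Types (alpha : G -> X -> X) (K U : set X) (d : X -> X -> R).

Definition continuous_action alpha :=
  [/\ forall x, alpha 1%g x = x,
      forall s t x, alpha (s * t)%g x = alpha s (alpha t x) &
      forall s, continuous (alpha s)].

Definition action_orbit alpha x : set X := [set alpha s x | s in setT].

Definition topologically_free alpha :=
  dense [set x | forall s, alpha s x = x -> s = 1%g].

Definition minimal alpha := forall x, dense (action_orbit alpha x).

(** [d], restricted to the points of [K], is a metric on [K] inducing the
    subspace topology of [K]. *)
Definition compatible_metric K d :=
  [/\ forall x y, K x -> K y -> 0 <= d x y /\ (d x y = 0 <-> x = y),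
      forall x y, K x -> K y -> d x y = d y x,
      forall x y z, K x -> K y -> K z -> d x z <= d x y + d y z &
      forall x, K x -> forall A : set X,
        within K (nbhs x) A <->
        exists2 e : R, 0 < e & forall y, K y -> d x y < e -> A y].

(** On a compact space expansivity does not depend on the metric. *)
Definition expansive alpha :=
  forall d, compatible_metric setT d ->
  exists2 e : R, 0 < e &
    forall x y, x <> y -> exists s, e <= d (alpha s x) (alpha s y).

Definition separated_sets alpha K d (F : {fset G}) (e : R) : set {fset X} :=
  [set A | (forall x, x \in A -> K x) /\
    forall x y, x \in A -> y \in A -> x <> y ->
      exists2 s, s \in F & e < d (alpha s x) (alpha s y)].

Definition sep alpha K d F e : \bar R :=
  ereal_sup [set (#|` A|%:R)%:E | A in separated_sets alpha K d F e].

Definition entropy_along alpha K d (F : nat -> {fset G}) : \bar R :=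
  ereal_sup [set limn_esup (fun n =>
      ((#|` F n|%:R^-1)%:E * lne (sep alpha K d (F n) e))%E)
    | e in [set e : R | 0 < e]].

(** [h] is the topological entropy of the restriction of [alpha] to the compact
    metrizable invariant set [K]; the quantifiers over [d] and [F] express that
    the value does not depend on the choice of the metric and of the Folner
    sequence. *)
Definition topological_entropy alpha K (h : \bar R) :=
  forall d (F : nat -> {fset G}),
    compatible_metric K d -> left_Folner R F -> entropy_along alpha K d F = h.

Definition full_group alpha : set (homeo X) :=
  [set T | exists (n : nat) (P : 'I_n -> set X) (s : 'I_n -> G),
    [/\ forall i, clopen (P i),
        trivIset setT P,
        \bigcup_i P i = setT &
        forall i x, P i x -> T x = alpha (s i) x]].

(** Permutations in MathComp compose from left to right, [(s * t) i = t (s i)],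
    hence the order of the factors in the morphism condition. *)
Definition S3_morphism alpha (phi : 'S_3 -> homeo X) :=
  (forall s, full_group alpha (phi s)) /\
  (forall s t, phi (t * s)%g = (phi s * phi t)%g).

Definition S3_tower alpha (phi : 'S_3 -> homeo X) :=
  exists A : 'I_3 -> set X,
    [/\ forall i, clopen (A i),
        trivIset setT A,
        forall s x, ~ (\bigcup_i A i) x -> phi s x = x &
        forall (s : 'S_3) i, exists g : G,
          (forall x, A i x -> phi s x = alpha g x) /\
          alpha g @` A i = A (s i)].

Definition alternating_group alpha : set (homeo X) :=
  generated [set g | exists phi : 'S_3 -> homeo X,
    [/\ S3_morphism alpha phi, S3_tower alpha phi &
        exists2 s, (s \in 'Alt_('I_3))%g & g = phi s]].

Definition rigid_stabilizer (H : set (homeo X)) U : set (homeo X) :=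
  [set g | H g /\ forall x, ~ U x -> g x = x].

End Actions.

Definition embeds_into (L G : groupType) (H : set G) :=
  exists phi : L -> G,
    [/\ {morph phi : x y / (x * y)%g}, injective phi & forall x, H (phi x)].

(** The free product of three copies of the group of order two. Each factor has a single nontrivial element, so a reduced word is a sequence
    of indices of factors in which consecutive letters differ. *)

Definition reduced (w : seq 'I_3) := sorted (fun i j => i != j) w.

Record Z2Z2Z2 := FreeWord { word :> seq 'I_3; _ : reduced word }.
HB.instance Definition _ := [isSub for word].
HB.instance Definition _ := [Choice of Z2Z2Z2 by <:].

Section FreeProduct.
Implicit Types (i j : 'I_3) (w : seq 'I_3) (x y z : Z2Z2Z2).

Definition push i w := if w is j :: w' then if i == j then w' else i :: w
                       else [:: i].

Lemma push_reduced i w : reduced w -> reduced (push i w).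
Proof.
rewrite /reduced; case: w => [|j w] //= jw.
by case: eqVneq => [_|ij] /=; [exact: path_sorted jw | rewrite ij].
Qed.

Lemma pushK i w : reduced w -> push i (push i w) = w.
Proof.
rewrite /reduced; case: w => [_|j w] /=; first by rewrite eqxx.
case: (eqVneq i j) => [->|ij _] /=; last by rewrite eqxx.
by case: w => [//|k w] /= /andP[/negPf ->].
Qed.

Definition push_word w1 w2 := foldr push w2 w1.

Lemma push_word_reduced w1 w2 : reduced w2 -> reduced (push_word w1 w2).
Proof. by move=> r2; elim: w1 => //= i w1; exact: push_reduced. Qed.

Lemma push_word_push i w1 w2 : reduced w2 ->
  push_word (push i w1) w2 = push i (push_word w1 w2).
Proof.
move=> r2; case: w1 => [|j w1] //=; case: eqVneq => [->|//].
by rewrite pushK //; exact: push_word_reduced.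
Qed.

Lemma push_word_nil w : reduced w -> push_word w [::] = w.
Proof.
rewrite /reduced; elim: w => //= i w IHw iw.
rewrite IHw ?(path_sorted iw) //.
by case: w iw {IHw} => //= j w /andP[/negPf ->].
Qed.

Lemma rev_reduced w : reduced w -> reduced (rev w).
Proof.
by rewrite /reduced rev_sorted; apply: sub_sorted => i j; rewrite eq_sym.
Qed.

Lemma push_wordKl w1 w2 : reduced w2 ->
  push_word (rev w1) (push_word w1 w2) = w2.
Proof.
move=> r2; elim: w1 => [|i w1 IH] //=.
rewrite rev_cons -cats1 /push_word foldr_cat /= pushK //.
exact: push_word_reduced.
Qed.

Definition fp_one : Z2Z2Z2 := @FreeWord [::] isT.
Definition fp_mul x y : Z2Z2Z2 := FreeWord (push_word_reduced x (valP y)).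
Definition fp_inv x : Z2Z2Z2 := FreeWord (rev_reduced (valP x)).

Fact fp_mulA : associative fp_mul.
Proof.
move=> x y z; apply: val_inj => /=.
elim: (x : seq _) => //= i w ->.
by rewrite push_word_push //; exact: valP.
Qed.
Fact fp_mul1 : left_id fp_one fp_mul.
Proof. by move=> x; apply: val_inj. Qed.
Fact fp_mulr1 : right_id fp_one fp_mul.
Proof. by move=> x; apply: val_inj; rewrite /= push_word_nil //; exact: valP. Qed.
Fact fp_mulV : left_inverse fp_one fp_inv fp_mul.
Proof.
move=> x; apply: val_inj => /=.
by rewrite -[X in push_word _ X]push_word_nil ?push_wordKl //; exact: valP.
Qed.
Fact fp_mulVr : right_inverse fp_one fp_inv fp_mul.
Proof.
move=> x; have {1}-> : x = fp_inv (fp_inv x) by apply: val_inj; rewrite /= revK.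
exact: fp_mulV.
Qed.

HB.instance Definition _ := isGroup.Build Z2Z2Z2
  fp_mulA fp_mul1 fp_mulr1 fp_mulV fp_mulVr.

Definition letter i : Z2Z2Z2 := @FreeWord [:: i] isT.

Lemma Z2Z2Z2_ind (P : Z2Z2Z2 -> Prop) :
  P 1%g -> (forall i x, P x -> P (letter i * x)%g) -> forall x, P x.
Proof.
move=> P1 PM [w rw]; elim: w rw => [|i w IHw] rw.
  by rewrite (_ : FreeWord rw = 1%g) //; apply: val_inj.
have rw' : reduced w := path_sorted rw.
suff -> : FreeWord rw = (letter i * FreeWord rw')%g by exact: PM.
apply: val_inj; change (i :: w = push i w).
by case: w rw {IHw rw'} => [//|j w] /= /andP[/negPf ->].
Qed.

(** The universal property of the free product: homomorphisms from the i-th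
    factor to [H] correspond to elements [a i] with [a i * a i = 1]. *)
Lemma Z2Z2Z2_universal (H : groupType) (a : 'I_3 -> H) :
  (forall i, a i * a i = 1)%g ->
  exists! phi : Z2Z2Z2 -> H,
    {morph phi : x y / (x * y)%g} /\ forall i, phi (letter i) = a i.
Proof.
move=> aa; pose ev w := foldr (fun i h => (a i * h)%g) 1%g w.
have ev_push i w : ev (push i w) = (a i * ev w)%g.
  case: w => [|j w] //=; case: eqVneq => [<-|//].
  by rewrite mulgA aa mul1g.
exists (fun x => ev x); split; first split.
- move=> x y; change (ev (push_word x y) = ev x * ev y)%g.
  elim: (x : seq _) => [|i w IH] /=; first by rewrite mul1g.
  by rewrite ev_push IH mulgA.
- by move=> i /=; rewrite mulg1.
move=> phi [phiM phiL]; apply/funext => x.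
have phi1 : phi 1%g = 1%g.
  by apply: (@mulgI _ (phi 1%g)); rewrite -phiM !mulg1.
elim/Z2Z2Z2_ind: x => [|i x IH]; first by rewrite phi1.
by rewrite phiM phiL -IH; exact: ev_push.
Qed.

End FreeProduct.

Section Tilings.
Variables (R : realType) (G : groupType).

Record tiling := Tiling {
  tindex : finType;
  tshape : tindex -> {fset G};
  tcenter : tindex -> set G;
  shape_neq0 : forall i, tshape i != fset0;
  tiling_partition : forall g : G, exists! p : tindex * G,
    tcenter p.1 p.2 /\ g \in rtranslate (tshape p.1) p.2 }.

Implicit Types (T : tiling) (S : {fset G}).

Definition is_tile T S :=
  exists (i : tindex T) (c : G), tcenter i c /\ S = rtranslate (tshape i) c.

Definition is_shape T S := exists i : tindex T, tshape i = S.

Definition center_of T S (c : G) :=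
  exists2 i : tindex T, tshape i = S & tcenter i c.

Definition syndetic_centers T := forall i : tindex T, syndetic (tcenter i).

Definition tightly_nested (T : nat -> tiling) :=
  forall (n : nat) (i : tindex (T n.+1)),
  exists (m : nat) (S : 'I_m -> {fset G}) (g : 'I_m -> G),
    [/\ forall j, is_shape (T n) (S j),
        forall s, s \in tshape i <->
          exists j, s \in rtranslate (S j) (g j),
        forall j k s, s \in rtranslate (S j) (g j) ->
          s \in rtranslate (S k) (g k) -> j = k &
        forall c j, tcenter i c -> center_of (T n) (S j) (g j * c)%g].

Definition Folner_tilings (T : nat -> tiling) :=
  forall (F : {fset G}) (delta : R), 0 < delta ->
  exists N : nat, forall n, (N <= n)%N -> forall i : tindex (T n),
    (1 - delta) * #|` tshape i|%:R <=
    #|` [fset s in tshape i | all (fun t => (t * s)%g \in tshape i) F]%fset|%:R.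

Definition alphabet T : {fset option {fset G}} :=
  (None |` [fset Some (tshape i) | i in tindex T])%fset.

Definition shift_space T : Type :=
  prod_topology (fun _ : G => discrete_topology (alphabet T)).
HB.instance Definition _ T := Topological.on (shift_space T).

Definition right_shift T (s : G) (x : shift_space T) : shift_space T :=
  fun t => x (t * s)%g.

(** The point coding [T]; there is at most one, and there is one as soon as no
    element of [G] is a center for two different shapes. *)
Definition tiling_code T (x : shift_space T) :=
  (forall t (i : tindex T), tcenter i t -> fsval (x t) = Some (tshape i)) /\
  (forall t, (forall i : tindex T, ~ tcenter i t) -> fsval (x t) = None).

Definition tiling_entropy T (h : \bar R) :=
  exists2 x : shift_space T, tiling_code x &
    topological_entropy (@right_shift T) (closure (action_orbit (@right_shift T) x)) h.

Definition property_ID :=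
  exists (H : set G) (T : nat -> tiling),
    [/\ is_subgroup H, infinite_cyclic H & infinite_index H] /\
    [/\ tightly_nested T,
        Folner_tilings T,
        forall n, syndetic_centers (T n) &
        exists2 h : nat -> \bar R,
          forall n, tiling_entropy (T n) (h n) & h @ \oo --> 0%E] /\
    [/\ forall F : {fset G}, exists n,
          exists2 S, is_tile (T n) S & (F `<=` S)%fset,
        forall delta : R, 0 < delta ->
          exists n0 : nat, forall n, (n0 <= n)%N -> forall S,
            is_tile (T n) S ->
            #|` [fset s in S | s \in H]%fset|%:R <= delta * #|` S|%:R &
        forall n, exists (S : {fset G}) (H0 : set G),
          [/\ is_shape (T n) S,
              is_subgroup H0 /\ H0 `<=` H,
              forall c, H0 c -> is_tile (T n) (rtranslate S c) &
              forall g, H g -> exists2 c, H0 c & g \in rtranslate S c]].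

End Tilings.

Arguments property_ID R G : clear implicits.

(* Main.v *)
Require Import Defs.
From HB Require Import structures.
From mathcomp Require Import all_boot all_order all_algebra.
From mathcomp Require Import fingroup perm alt.
From mathcomp Require Import finmap.
From mathcomp Require Import all_classical all_reals all_analysis.
From mathcomp Require Import lra zify.

Set Implicit Arguments.
Unset Strict Implicit.
Unset Printing Implicit Defensive.

(** The action is a minimal subshift of [A ^ Gamma], built in stages. At each
    stage a configuration is fixed off a set of free positions, where it is
    arbitrary. By property ID, [Gamma] is the increasing union of tiles [D k],
    and the tiles of each level are unions of tiles of the previous one. Nothing
    forces two tiles of the same shape to be subdivided alike, so every translate
    of the prototype [D k] that is a tile is made to carry, at the levels below,
    a copy of the structure of [D k] itself. A stage passes from a level [l] to a
    much higher level [n]: in each copy of [D n] every pattern allowed on [D l] is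
    written once, which makes the subshift minimal, and further positions are
    frozen one by one in each tile until the entropy has just not fallen below
    [lambda]. Entropy is the infimum over all finite windows of the normalized
    logarithm of the number of patterns; Shearer's inequality identifies it with
    the limit along every Folner sequence, and it changes little under changes of
    small density.

    Condition (ii) makes the cells meeting the cyclic subgroup [H] negligible, so
    they can be kept free forever. By torsion-freeness and (iii) the tiles of
    level [n] along [H] include copies [D n * r ^ j] for a fixed [r], and these
    carry arbitrary sequences of letters. Letters are pairs of colors;
    the involution attached to a color crosses the edges of this line that have
    that color, and a reduced word is realized along some line. Multiplying
    each involution by a conjugate with disjoint support puts it in the
    alternating group. *)

(** The value [lambda] is reached exactly for two reasons. Being an infimum over windows, entropy is
    monotone along the decreasing sets of configurations, and stage by stage it exceeds [lambda] by
    a vanishing error. It might still drop in the limit. It does not, because each pattern on [D i]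
    allowed at stage [i] can be moved into a larger prototype around the identity; this prototype
    meets [H], so no later stage freezes anything in it. The cells kept free along [H] thus serve
    the entropy as well as the free product.

    A stage can always be followed by another because two strict inequalities are carried along. The
    configurations have entropy above [lambda], which leaves room for writing patterns; the base
    configuration alone, with everything frozen, has entropy below it, so freezing all but a
    negligible set must cross [lambda]. The crossing is slow, since freezing one position in each
    large cell is a change of small density.

    A letter records the colors of the edges entering and leaving its position, so three involutions
    call for nine letters and each involution reads a bounded window. *)

Import Order.TTheory GRing.Theory Num.Theory.

Local Open Scope ring_scope.

(** * Shearer's inequality *)

Section Shearer.
Variable R : realType.

(** Hoelder's inequality with [#|B|] equal exponents. After dividing each [y j] by its bound [Y j],
    the inequality of arithmetic and geometric means bounds [x v] by [M] times a mean of the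
    quotients, and these means sum to at most 1. *)
Lemma holder_sum (V J : finType) (B : {set J}) (x : V -> R) (y : J -> V -> R)
    (Y : J -> R) (C : R) :
  (0 < #|B|)%N -> 0 <= C -> (forall v, 0 <= x v) -> (forall j v, 0 <= y j v) ->
  (forall j, j \in B -> \sum_v y j v <= Y j) ->
  (forall v, x v ^+ #|B| <= C * \prod_(j in B) y j v) ->
  (\sum_v x v) ^+ #|B| <= C * \prod_(j in B) Y j.
Proof.
move=> k0 C0 x0 y0 yY xy.
have Y0 j : j \in B -> 0 <= Y j.
  by move=> jB; apply: le_trans (yY j jB); apply: sumr_ge0.
(* A vanishing [Y j] forces every [x v] to vanish; otherwise all the [Y j] can be divided by. *)
have [/existsP[j /andP[jB /eqP Yj0]]|/existsPn nz] :=
    boolP [exists j, (j \in B) && (Y j == 0)].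
  have yj0 v : y j v = 0.
    apply/eqP; rewrite eq_le y0 andbT -Yj0.
    apply: le_trans (yY j jB); rewrite (bigD1 v) //= lerDl; exact: sumr_ge0.
  have xv0 v : x v = 0.
    have := xy v; rewrite (bigD1 j) //= yj0 mul0r mulr0 => xk.
    have : x v ^+ #|B| == 0 by rewrite eq_le xk exprn_ge0.
    by rewrite expf_eq0 => /andP[_ /eqP].
  rewrite big1 ?expr0n => [|v _]; last exact: xv0.
  by rewrite gtn_eqF // mulr_ge0 ?prodr_ge0.
have Yp j : j \in B -> 0 < Y j.
  by move=> jB; rewrite lt_def Y0 // andbT; have := nz j; rewrite jB.
set X := C * _.
have X0 : 0 <= X by rewrite mulr_ge0 ?prodr_ge0.
pose M := X `^ (#|B|%:R^-1).
have MX : M ^+ #|B| = X.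
  rewrite -powR_mulrn ?powR_ge0 // -powRrM mulVf ?powRr1 //.
  by rewrite pnatr_eq0 -lt0n.
have M0 : 0 <= M by exact: powR_ge0.
have xv v : x v <= M * ((\sum_(j in B) y j v / Y j) / #|B|%:R).
  rewrite -(@ler_pXn2r _ #|B|) ?nnegrE //; last first.
    rewrite mulr_ge0 ?divr_ge0 ?ler0n ?sumr_ge0 // => j jB.
    by rewrite divr_ge0 ?Y0.
  rewrite exprMn MX.
  have agm : \prod_(j in B) (y j v / Y j) <=
      ((\sum_(j in B) y j v / Y j) / #|B|%:R) ^+ #|B|.
    by apply: leif_AGM => j jB; rewrite divr_ge0 ?Y0.
  apply: le_trans (ler_wpM2l X0 agm); apply: le_trans (xy v) _.
  rewrite /X -mulrA -big_split /= ler_wpM2l //.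
  rewrite le_eqVlt; apply/orP; left; apply/eqP/eq_bigr => j jB.
  by rewrite mulrCA divff ?mulr1 // gt_eqF ?Yp.
rewrite -MX lerXn2r ?nnegrE ?sumr_ge0 //.
apply: le_trans (ler_sum _ (fun v _ => xv v)) _.
rewrite -mulr_sumr -{2}[M]mulr1 ler_wpM2l // -mulr_suml exchange_big /=.
rewrite ler_pdivrMr ?ltr0n // mul1r -sumr_const.
apply: ler_sum => j jB; rewrite -mulr_suml ler_pdivrMr ?Yp // mul1r; exact: yY.
Qed.

Variables (I J A : finType) (a0 : A).
Implicit Types (P : {set {ffun I -> A}}) (D : {set I}).

(** The filler [a0] off [D] gives the traces on different sets one common type. *)
Definition mask D (w : {ffun I -> A}) := [ffun i => if i \in D then w i else a0].

Lemma maskI D D' w : mask D (mask D' w) = mask (D :&: D') w.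
Proof. by apply/ffunP => i; rewrite !ffunE inE; case: ifP. Qed.

(* Induction on the support: fibring the patterns over their value at one
   coordinate reduces the step to Hoelder's inequality. *)
Lemma shearer_supp (B : J -> {set I}) (k : nat) D P : (0 < k)%N ->
  (forall i, i \in D -> #|[set j | i \in B j]| = k) ->
  (forall w, w \in P -> mask D w = w) ->
  (#|P|%:R ^+ k <= \prod_j #|[set mask (B j) w | w in P]|%:R :> R).
Proof.
move=> k0; move: {2}#|D| (erefl #|D|) => n; elim: n D P => [|n IH] D P.
  move/eqP; rewrite cards_eq0 => /eqP-> _ supp.
  have P1 : P \subset [set [ffun=> a0]].
    by apply/fintype.subsetP => w /supp <-; rewrite inE; apply/eqP/ffunP => i; rewrite !ffunE inE.
  have [->|[w wP]] := set_0Vmem P.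
    rewrite cards0 expr0n gtn_eqF //; exact: prodr_ge0.
  have P1' : #|P| = 1%N.
    apply/eqP; rewrite eqn_leq (leq_trans (subset_leq_card P1)) ?cards1 //=.
    by rewrite card_gt0; apply/set0Pn; exists w.
  rewrite P1' expr1n.
  apply: le_trans (_ : \prod_(j : J) 1 <= _); first by rewrite big1.
  apply: ler_prod => j _; rewrite ler01 /= ler1n card_gt0; apply/set0Pn.
  by exists (mask (B j) w); apply/imsetP; exists w.
move=> Dn cov supp.
have /card_gt0P[i iD] : (0 < #|D|)%N by rewrite Dn.
pose D' := D :\ i.
pose Pv v := [set w in P | w i == v].
pose P' v := [set mask D' w | w in Pv v].
have Pv_inj v : {in Pv v &, injective (mask D')}.
  move=> w w'; rewrite !inE => /andP[wP /eqP wi] /andP[wP' /eqP wi'] e.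
  apply/ffunP => l; have [->|li] := eqVneq l i; first by rewrite wi wi'.
  rewrite -(supp _ wP) -(supp _ wP') !ffunE; case: ifP => // lD.
  by move/ffunP: e => /(_ l); rewrite !ffunE !inE li lD.
have cP : #|P| = (\sum_v #|P' v|)%N.
  rewrite -sum1_card (partition_big (fun w : {ffun I -> A} => w i) predT) //=.
  apply: eq_bigr => v _; rewrite (card_in_imset (@Pv_inj v)) -sum1_card.
  by apply: eq_bigl => w; rewrite !inE.
have D'n : #|D'| = n by move: Dn; rewrite (cardsD1 i) iD => -[].
pose Bi := [set j | i \in B j].
have kE : k = #|Bi| by rewrite cov.
rewrite cP natr_sum kE (bigID (mem Bi)) /= mulrC.
apply: (@holder_sum A J Bi _ (fun j v => #|[set mask (B j) w | w in P' v]|%:R)).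
- by rewrite -kE.
- exact: prodr_ge0.
- by [].
- by [].
(* A trace on a set containing [i] remembers the value at [i], so distinct fibres contribute
   disjoint parts of the trace of [P]. For the sets missing [i], treated next, each fibre is merely
   bounded by the trace of [P]; these factors form the constant [C]. *)
- move=> j; rewrite inE => ij; rewrite -natr_sum ler_nat.
  set Q := [set mask (B j) w | w in P].
  rewrite -(sum1_card (mem Q)).
  rewrite (partition_big (fun w : {ffun I -> A} => w i) predT) //=.
  apply: leq_sum => v _.
  have -> : [set mask (B j) w | w in P' v] =
     [set mask D' u | u in [set u in Q | u i == v]].
    apply/setP => u; apply/imsetP/imsetP => -[w].
      move=> /imsetP[w']; rewrite inE => /andP[w'P /eqP w'i] -> ->.
      exists (mask (B j) w'); last by rewrite !maskI finset.setIC.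
      rewrite inE imset_f //= ffunE ij w'i eqxx //.
    rewrite inE => /andP[/imsetP[w' w'P ->]]; rewrite ffunE ij => /eqP w'i ->.
    exists (mask D' w'); last by rewrite !maskI finset.setIC.
    by apply: imset_f; rewrite inE w'P w'i /=.
  apply: leq_trans (leq_imset_card _ _) _.
  rewrite -sum1_card leq_eqVlt; apply/orP; left; apply/eqP.
  by apply: eq_bigl => u; rewrite !inE.
- move=> v; rewrite -kE; apply: le_trans (IH D' (P' v) D'n _ _) _.
  + by move=> l; rewrite inE => /andP[_ lD]; exact: cov.
  + by move=> w /imsetP[w' _ ->]; rewrite maskI finset.setIid.
  rewrite (bigID (mem Bi)) /= mulrC; apply: ler_wpM2r; first exact: prodr_ge0.
  apply: ler_prod => j; rewrite inE => ij; rewrite ler0n /= ler_nat.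
  apply: subset_leq_card; apply/fintype.subsetP => u /imsetP[w /imsetP[w' w'P ->] ->].
  apply/imsetP; exists w'; first by move: w'P; rewrite inE => /andP[].
  move: w'P; rewrite inE => /andP[w'P _].
  rewrite maskI; apply/ffunP => l; rewrite !ffunE !inE.
  case lB : (l \in B j) => //=.
  have -> /= : l != i by apply: contraNneq ij => <-.
  by case: ifP => // lD; rewrite -(supp _ w'P) ffunE lD.
Qed.

Lemma shearer (B : J -> {set I}) (k : nat) P : (0 < k)%N ->
  (forall i, #|[set j | i \in B j]| = k) ->
  (#|P|%:R ^+ k <= \prod_j #|[set mask (B j) w | w in P]|%:R :> R).
Proof.
move=> k0 cov; apply: (@shearer_supp B k [set: I]) => // w _.
by apply/ffunP => i; rewrite ffunE inE.
Qed.

End Shearer.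

(** * Patterns and entropy *)

(** Counting through a relation allows a pattern to be compared with others via any configuration
    that exhibits it. *)
Lemma leq_card_rel (T U : finType) (P : {set T}) (Q : {set U}) (r : T -> U -> Prop) :
  (forall p, p \in P -> exists2 q, q \in Q & r p q) ->
  (forall p p' q, p \in P -> p' \in P -> r p q -> r p' q -> p = p') ->
  (#|P| <= #|Q|)%N.
Proof.
move=> PQ inj.
have [->|[p0 p0P]] := set_0Vmem P; first by rewrite cards0.
have [q0 _ _] := PQ _ p0P.
have /choice[f fP] p : exists q, p \in P -> q \in Q /\ r p q.
  have [pP|nP] := boolP (p \in P); last by exists q0.
  by have [q] := PQ p pP; exists q.
rewrite -(card_in_imset (f := f) (D := mem P)) => [|p p' pP p'P fpp].
  apply: subset_leq_card; apply/fintype.subsetP => q /imsetP[p pP ->].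
  by have [] := fP p pP.
by apply: (inj _ _ (f p)) => //; [case: (fP _ pP) | rewrite fpp; case: (fP _ p'P)].
Qed.

Definition mulfs (G : groupType) (F S : {fset G}) : {fset G} :=
  [fset (f * s)%g | f in F, s in S]%fset.

Lemma mulfsP (G : groupType) (F S : {fset G}) x :
  reflect (exists f s, [/\ f \in F, s \in S & x = (f * s)%g]) (x \in mulfs F S).
Proof.
apply: (iffP (imfset2P _ _ _ _ _)) => [[f fF [s sS ->]]|[f [s [fF sS ->]]]].
  by exists f, s.
by exists f => //; exists s.
Qed.

Definition invfs (G : groupType) (F : {fset G}) : {fset G} := [fset (f^-1)%g | f in F]%fset.

Lemma invfsP (G : groupType) (F : {fset G}) x : (x \in invfs F) = (x^-1%g \in F).
Proof.
apply/imfsetP/idP => [[f fF ->]|xF]; first by rewrite invgK.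
by exists (x^-1)%g => //; rewrite invgK.
Qed.

Lemma rtranslateP (G : groupType) (F : {fset G}) (c x : G) :
  (x \in rtranslate F c) = ((x * c^-1)%g \in F).
Proof.
apply/imfsetP/idP => [[f fF ->]|xF]; first by rewrite mulgK.
by exists (x * c^-1)%g => //; rewrite mulgKV.
Qed.

Lemma card_rtranslate (G : groupType) (F : {fset G}) (c : G) :
  #|` rtranslate F c| = #|` F|.
Proof. by rewrite card_imfset //=; exact: mulIg. Qed.

Section Patterns.
Variables (R : realType) (G : groupType) (A : finType) (a0 : A).
Implicit Types (F K S : {fset G}) (Y W : set (G -> A)) (y w : G -> A).

Definition shift (g : G) y : G -> A := fun t => y (t * g)%g.

Definition orbits Y : set (G -> A) :=
  [set w | exists2 y, Y y & exists g, w = shift g y]%classic.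

Definition pats F W : {set {ffun F -> A}} :=
  [set v : {ffun F -> A} | `[< exists2 w, W w & forall t : F, v t = w (val t) >]].

(** Counting over all translates makes the number invariant under right translation of the window,
    as the covering by translates in [npat_shearer] requires. *)
Definition npat Y F := #|pats F (orbits Y)|.

Lemma patsP F W (v : {ffun F -> A}) : reflect (exists2 w, W w & forall t : F, v t = w (val t)) (v \in pats F W).
Proof. by rewrite inE; exact: asboolP. Qed.

Lemma mem_pats F W w : W w -> [ffun t : F => w (val t)] \in pats F W.
Proof. by move=> Ww; apply/patsP; exists w => // t; rewrite ffunE. Qed.

Definition eqon F w w' := forall t, t \in F -> w t = w' t.

Lemma leq_pats F F' W W' (r : (G -> A) -> (G -> A) -> Prop) :
  (forall w, W w -> exists2 w', W' w' & r w w') ->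
  (forall w1 w2 w1' w2', W w1 -> W w2 -> r w1 w1' -> r w2 w2' -> eqon F' w1' w2' -> eqon F w1 w2) ->
  (#|pats F W| <= #|pats F' W'|)%N.
Proof.
move=> WW' inj.
apply: (@leq_card_rel _ _ _ _ (fun (v : {ffun F -> A}) (v' : {ffun F' -> A}) => exists w w', [/\ W w, r w w',
    forall t : F, v t = w (val t) & forall t : F', v' t = w' (val t)])).
  move=> v /patsP[w Ww vw]; have [w' W'w' rww'] := WW' w Ww.
  exists [ffun t : F' => w' (val t)]; first exact: mem_pats.
  by exists w, w'; split => // t; rewrite ffunE.
move=> v1 v2 v' _ _ [w1 [w1' [Ww1 r1 e1 e1']]] [w2 [w2' [Ww2 r2 e2 e2']]].
apply/ffunP => t; rewrite e1 e2.
apply: (inj _ _ _ _ Ww1 Ww2 r1 r2) (valP t) => s sF'.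
by have := e1' [` sF']%fset; rewrite e2' /= => ->.
Qed.

Lemma orbits_shift Y g w : orbits Y w -> orbits Y (shift g w).
Proof.
move=> [y Yy [h ->]]; exists y => //; exists (g * h)%g.
by apply/funext => t; rewrite /shift mulgA.
Qed.

Lemma leq_npat_sub Y F F' : (F `<=` F')%fset -> (npat Y F <= npat Y F')%N.
Proof.
move=> /fsubsetP sub; apply: (leq_pats (r := eq)) => [w Yw|]; first by exists w.
by move=> w1 w2 _ _ _ _ <- <- e t tF; apply: e; exact: sub.
Qed.

Lemma leq_npat Y Y' F : (Y `<=` Y')%classic -> (npat Y F <= npat Y' F)%N.
Proof.
move=> sub; apply: (leq_pats (r := eq)) => [w [y /sub Yy e]|].
  by exists w => //; exists y.
by move=> w1 w2 _ _ _ _ <- <-.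
Qed.

Lemma npat_gt0 Y F : (Y !=set0)%classic -> (0 < npat Y F)%N.
Proof.
move=> [y Yy]; rewrite /npat card_gt0; apply/set0Pn.
exists [ffun t : F => y (val t)]; apply: mem_pats; exists y => //; exists 1%g.
by apply/funext => t; rewrite /shift mulg1.
Qed.

(** The sets [S :&: F g] with [g] in [F^-1 S] cover each [s] in [S] exactly [#|F|] times, once for
    every [g = f^-1 s], and none of them carries more patterns than [F]. *)
Lemma npat_shearer Y F S : (Y !=set0)%classic -> F != fset0 ->
  (npat Y S)%:R ^+ #|` F| <= (npat Y F)%:R ^+ #|` mulfs (invfs F) S| :> R.
Proof.
move=> Y0 F0; pose Q := mulfs (invfs F) S.
pose B (g : Q) : {set S} := [set s : S | (val s * (val g)^-1)%g \in F].
apply: le_trans (@shearer R S Q A a0 B #|` F| (pats S (orbits Y)) _ _) _.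
- by rewrite cardfs_gt0.
- move=> s; rewrite cardfE.
  have memQ (f : F) : ((val f)^-1 * val s)%g \in Q.
    apply/mulfsP; exists ((val f)^-1)%g, (val s).
    by split; [rewrite invfsP invgK; exact: fsvalP | exact: fsvalP |].
  rewrite -(card_codom (f := fun f : F => [` memQ f]%fset : Q)); last first.
    by move=> f f' /(congr1 val) /= /mulIg /invg_inj /val_inj.
  apply: eq_card => g; rewrite !inE; apply/idP/codomP => [sg|[f ->]].
    exists [` sg]%fset; apply: val_inj; rewrite /= invMg invgK mulgKV //.
  by rewrite /= invMg invgK mulgA mulgV mul1g; exact: fsvalP.
- rewrite [leRHS](_ : _ = \prod_(g : Q) (npat Y F)%:R); last first.
    by rewrite prodr_const cardfE; congr (_ ^+ _); apply: eq_card.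
  apply: ler_prod => g _; rewrite ler0n /= ler_nat.
  apply: (@leq_card_rel _ _ _ _ (fun (u : {ffun S -> A}) (v : {ffun F -> A}) => exists w, [/\
      u = mask a0 (B g) [ffun s : S => w (val s)] &
      forall t : F, v t = shift (val g) w (val t)])).
    move=> _ /imsetP[u /patsP[w Yw uw] ->].
    exists [ffun t : F => shift (val g) w (val t)].
      by apply: mem_pats; exact: orbits_shift.
    exists w; split=> [|t]; last by rewrite ffunE.
    by apply/ffunP => s; rewrite !ffunE uw.
  move=> _ _ v _ _ [w [-> e]] [w' [-> e']]; apply/ffunP => s; rewrite !ffunE.
  case: ifP; rewrite ?inE // => sF; have := e [` sF]%fset; rewrite e' /shift /=.
  by rewrite mulgKV => ->.
Qed.

Definition Finv K (delta : R) F := forall t, t \in K ->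
  #|` [fset s in F | (t * s)%g \notin F]%fset|%:R <= delta * #|` F|%:R.

Definition entropy Y : R :=
  inf [set ln (npat Y F)%:R / #|` F|%:R | F in [set F | F != fset0]]%classic.

Lemma entropy_has_inf Y : (Y !=set0)%classic ->
  has_inf [set (ln (npat Y F)%:R / #|` F|%:R : R) | F in [set F | F != fset0]]%classic.
Proof.
move=> Y0; split.
  exists (ln (npat Y [fset 1%g]%fset)%:R / #|` [fset (1%g : G)]%fset|%:R).
  exists [fset 1%g]%fset => //=; by apply/fset0Pn; exists 1%g; rewrite inE.
exists 0 => _ [F F0 <-]; rewrite divr_ge0 // ln_ge0 // ler1n; exact: npat_gt0.
Qed.

Lemma entropy_le Y F : (Y !=set0)%classic -> F != fset0 ->
  entropy Y * #|` F|%:R <= ln (npat Y F)%:R.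
Proof.
move=> Y0 F0; rewrite -ler_pdivlMr ?ltr0n ?cardfs_gt0 //.
by apply: ge_inf; [have [] := entropy_has_inf Y0 | exists F].
Qed.

Lemma card_bigfcup_le (I : Type) (r : seq I) (U : I -> {fset G}) :
  (#|` (\bigcup_(i <- r) U i)%fset| <= \sum_(i <- r) #|` U i|)%N.
Proof.
elim: r => [|i r IH]; first by rewrite !big_nil cardfs0.
rewrite !big_cons; apply: leq_trans (_ : #|` U i| + #|` (\bigcup_(j <- r) U j)%fset| <= _)%N.
  by rewrite -cardfsUI leq_addr.
by rewrite leq_add2l.
Qed.

Lemma card_filterC S (p : pred G) :
  (#|` [fset s in S | p s]%fset| + #|` [fset s in S | ~~ p s]%fset| = #|` S|)%N.
Proof.
rewrite -(cardfsID [fset s in S | p s]%fset S); congr (_ + _)%N;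
    apply: (congr1 (fun T : {fset G} => #|` T|)).
  by apply/fsetP => x; rewrite !inE /=; case: (x \in S).
by apply/fsetP => x; rewrite !inE /=; case: (x \in S); rewrite /= ?andbT ?andbF.
Qed.

Lemma card_imfset_inj (f : G -> G) S : injective f -> #|` [fset f x | x in S]%fset| = #|` S|.
Proof. by move=> /card_imfset ->. Qed.

(** The sets [f^-1 S] and [S] have the same size, hence so do their two differences. *)
Lemma card_translateD (f : G) S :
  #|` ([fset (f^-1 * s)%g | s in S] `\` S)%fset| = #|` [fset s in S | (f * s)%g \notin S]%fset|.
Proof.
have -> : #|` ([fset (f^-1 * s)%g | s in S] `\` S)%fset| =
    #|` [fset s in S | ~~ ((f^-1 * s)%g \in S)]%fset|.
  rewrite -[LHS](card_imfset_inj _ (mulgI f)).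
  apply: (congr1 (fun T : {fset G} => #|` T|)).
  apply/fsetP => x; rewrite !inE /=; apply/imfsetP/andP => /= [[y]|[xS fxS]].
    by rewrite in_fsetD => /andP[yS /imfsetP[s /= sS ey]] ->; rewrite mulKg {1}ey mulVKg.
  exists (f^-1 * x)%g; rewrite ?mulVKg // in_fsetD fxS; apply/imfsetP.
  by exists x.
have := card_filterC S (fun s => (f^-1 * s)%g \in S).
rewrite -(card_filterC S (fun s => (f * s)%g \in S)).
suff -> : #|` [fset s in S | (f^-1 * s)%g \in S]%fset| =
          #|` [fset s in S | (f * s)%g \in S]%fset| by move/addnI.
rewrite -[LHS](card_imfset_inj _ (mulgI (f^-1)%g)); apply: (congr1 (fun T : {fset G} => #|` T|)).
apply/fsetP => x; rewrite !inE; apply/imfsetP/andP => /= [[s]|[xS fxS]].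
  by rewrite !inE /= => /andP[sS fsS ->]; rewrite mulVKg sS fsS.
by exists (f * x)%g; rewrite ?mulKg // !inE /= fxS mulKg xS.
Qed.

Lemma card_mulfs_inv (delta : R) F S : Finv F delta S ->
  #|` mulfs (invfs F) S|%:R <= (1 + #|` F|%:R * delta) * #|` S|%:R :> R.
Proof.
move=> inv.
pose U f := ([fset (f^-1 * s)%g | s in S] `\` S)%fset.
have sub : (mulfs (invfs F) S `<=` S `|` \bigcup_(f <- F) U f)%fset.
  apply/fsubsetP => x /mulfsP[f [s [fF sS ->]]]; rewrite invfsP in fF.
  rewrite in_fsetU; case: (boolP (_ \in S)) => //= xS.
  apply/bigfcupP; exists f^-1%g; first by rewrite fF.
  by rewrite inE xS; apply/imfsetP; exists s; rewrite //= invgK.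
have : #|` mulfs (invfs F) S|%:R <= #|` S|%:R + \sum_(f <- F) #|` U f|%:R :> R.
  rewrite -natr_sum -natrD ler_nat; apply: leq_trans (fsubset_leq_card sub) _.
  apply: leq_trans (_ : #|` S| + #|` (\bigcup_(f <- F) U f)%fset| <= _)%N.
    by rewrite -cardfsUI leq_addr.
  by rewrite leq_add2l card_bigfcup_le.
move/le_trans; apply; rewrite mulrDl mul1r lerD2l -mulrA.
apply: le_trans (_ : \sum_(f <- F) delta * #|` S|%:R <= _).
  by rewrite big_seq [leRHS]big_seq; apply: ler_sum => f fF; rewrite card_translateD; exact: inv.
by rewrite big_const_seq count_predT iter_addr_0 mulr_natl.
Qed.

(** A single window [F] that nearly attains the infimum controls every sufficiently invariant window
    [S], because Shearer's inequality compares them through [F^-1 S], which is hardly larger than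
    [S]. *)
Lemma entropy_inv Y (e : R) : (Y !=set0)%classic -> 0 < e ->
  exists F0 (delta : R), 0 < delta /\ forall F, Finv F0 delta F ->
    ln (npat Y F)%:R <= (entropy Y + e) * #|` F|%:R.
Proof.
move=> Y0 e0; have [_ [F F0 <-] lt] := inf_adherent e0 (entropy_has_inf Y0).
set n : R := #|` F|%:R in lt; have n0 : 0 < n by rewrite ltr0n cardfs_gt0.
set u := ln (npat Y F)%:R in lt; set h := entropy Y in lt *.
have u0 : 0 <= u by rewrite ln_ge0 // ler1n; exact: npat_gt0.
pose gap := h + e - u / n; have gap0 : 0 < gap by rewrite subr_gt0.
(* An invariance error [delta] costs [delta * u] per point, which has to stay below [gap]; the
   summand 1 covers the case [u = 0]. *)
exists F, (gap / (u + 1)); split; first by rewrite divr_gt0 // ltr_wpDl.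
move=> S inv; have cS := card_mulfs_inv inv.
have NS : 0 < (npat Y S)%:R :> R by rewrite ltr0n; exact: npat_gt0.
have NF : 0 < (npat Y F)%:R :> R by rewrite ltr0n; exact: npat_gt0.
have : n * ln (npat Y S)%:R <= #|` mulfs (invfs F) S|%:R * u.
  rewrite /n /u !mulr_natl -!lnXn // ler_ln ?posrE ?exprn_gt0 //.
  exact: npat_shearer.
move=> le1; rewrite -(ler_pM2l n0); apply: le_trans le1 _.
apply: le_trans (ler_wpM2r u0 cS) _.
rewrite -/n mulrAC [leRHS]mulrA ler_wpM2r //.
have -> : h + e = gap + u / n by rewrite /gap subrK.
rewrite [leRHS]mulrDr [n * (u / n)]mulrC divfK ?gt_eqF // addrC mulrDl mul1r lerD2r.
rewrite -mulrA ler_pM2l // -mulrA ger_pMr // mulrC ler_pdivrMr ?mul1r ?lerDl //.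
by rewrite ltr_wpDl.
Qed.

End Patterns.

(** * Entropy under changes of small density *)

Section Hamming.
Variables (R : realType) (G : groupType) (A : finType) (a0 : A).
Implicit Types (F K S : {fset G}) (Y W : set (G -> A)) (y w : G -> A).

(** A Chernoff bound: give each [v'] the weight [u] to the power of its distance from [v]. The total
    weight is a product over the coordinates, and every point of the ball weighs at least
    [u ^ d]. *)
Lemma card_ball (I : finType) (v : {ffun I -> A}) (u d : R) : 0 < u -> u <= 1 ->
  #|[set v' : {ffun I -> A} | #|[set t | v t != v' t]|%:R <= d]|%:R * expR (d * ln u)
    <= (1 + #|A|%:R * u) ^+ #|I|.
Proof.
move=> u0 u1; set P := [set v' | _].
have -> : (1 + #|A|%:R * u) ^+ #|I| = \prod_(i : I) (1 + #|A|%:R * u).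
  by rewrite prodr_const.
apply: (@le_trans _ _ (\prod_(i : I) \sum_(a : A) (if v i == a then 1 else u))); last first.
  apply: ler_prod => i _; rewrite sumr_ge0 /= => [|a _]; last first.
    by case: ifP => // _; exact: ltW.
  rewrite (bigD1 (v i)) //= eqxx lerD2l.
  apply: (@le_trans _ _ (\sum_(a : A) u)); last first.
    by rewrite sumr_const mulr_natl; apply: lexx.
  rewrite [leRHS](bigD1 (v i)) //=; apply: ler_wpDl; first exact: ltW.
  by apply: ler_sum => a; rewrite eq_sym => /negbTE ->.
rewrite bigA_distr_bigA /=.
apply: (@le_trans _ _ (\sum_(v' in P) \prod_i (if v i == v' i then 1 else u))); last first.
  rewrite [leRHS](bigID (mem P)) /= lerDl; apply: sumr_ge0 => v' _.
  by apply: prodr_ge0 => i _; case: ifP => // _; exact: ltW.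
rewrite mulr_natl -sumr_const; apply: ler_sum => v'; rewrite inE => dv.
rewrite (bigID (fun i => v i == v' i)) /= big1 ?mul1r => [|i ->//].
rewrite (eq_bigr (fun _ => u)) => [|i /negbTE ->//].
rewrite prodr_const -(@eq_card _ [set t | v t != v' t]); last by move=> i; rewrite !inE.
rewrite -[u in leRHS]lnK ?posrE // -expRM_natl ler_expR.
by apply: ler_wnM2r => //; rewrite -ln1 ler_ln ?posrE.
Qed.

Lemma card_cover (T : finType) (P Q : {set T}) (B : T -> {set T}) (b : R) :
  (forall p, p \in P -> exists2 q, q \in Q & p \in B q) ->
  (forall q, q \in Q -> #|B q|%:R <= b) -> #|P|%:R <= #|Q|%:R * b.
Proof.
move=> PQ Bb; apply: (@le_trans _ _ (\sum_(q in Q) #|B q|)%:R); last first.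
  by rewrite natr_sum mulr_natl -sumr_const; apply: ler_sum => q /Bb.
rewrite ler_nat -sum1_card.
apply: (@leq_trans (\sum_(p in P) \sum_(q in Q) (p \in B q))).
  apply: leq_sum => p /PQ[q qQ pB]; rewrite (bigD1 q) //= pB; exact: leq_addr.
rewrite exchange_big /=; apply: leq_sum => q _.
rewrite -sum1_card [leqRHS]big_mkcond [leqLHS]big_mkcond /=.
by apply: leq_sum => p _; case: (p \in P); case: (p \in B q).
Qed.

(** Closeness is one-sided and asked only on sufficiently invariant windows, which is all that a
    density estimate in cells can provide. *)
Definition near_configs (e : R) Y Y' := exists K (delta : R), 0 < delta /\
  forall F, Finv K delta F -> forall w, orbits Y w ->
  exists2 w', orbits Y' w' & #|` [fset t in F | w t != w' t]%fset|%:R <= e * #|` F|%:R.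

Definition invariant_sets := forall K (delta : R), 0 < delta ->
  exists2 F, F != fset0 & Finv K delta F.

Lemma FinvW K K' (delta delta' : R) F : (K `<=` K')%fset -> delta' <= delta ->
  Finv K' delta' F -> Finv K delta F.
Proof.
move=> /fsubsetP sub le inv t /sub /inv /le_trans; apply.
by rewrite ler_wpM2r.
Qed.

Lemma Finv_and K K' (d d' : R) : 0 < d -> 0 < d' ->
  exists K'' (d'' : R), 0 < d'' /\
    forall F, Finv K'' d'' F -> Finv K d F /\ Finv K' d' F.
Proof.
move=> d0 d'0; exists (K `|` K')%fset, (Num.min d d'); split.
  by rewrite lt_min d0.
move=> F inv; split; apply: FinvW inv; rewrite ?ge_min ?lexx ?orbT //.
  exact: fsubsetUl.
exact: fsubsetUr.
Qed.

(** The radius [e] depends on [eta] and the alphabet only, so it can be fixed before the sets to be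
    compared are built. *)
Lemma entropy_near (eta : R) : invariant_sets -> 0 < eta -> exists2 e : R, 0 < e &
  forall Y Y', (Y !=set0)%classic -> (Y' !=set0)%classic ->
    near_configs e Y Y' -> entropy R Y <= entropy R Y' + eta.
Proof.
move=> inv eta0; pose a : R := #|A|%:R.
have a_gt0 : 0 < a by rewrite ltr0n; apply/card_gt0P; exists a0.
(* One third of [eta] pays for the factor [1 + a * u], one third for the radius through
   [- e * ln u], and one third for [entropy_inv]. *)
pose u := Num.min (1 / 2) (eta / 3 / a).
have u0 : 0 < u by rewrite lt_min divr_gt0 ?divr_gt0.
have u1 : u < 1 by rewrite gt_min ltr_pdivrMr // mul1r ltr1n.
have lnu : ln u < 0 by apply: ln_lt0; rewrite u0.
pose e := eta / 3 / - ln u.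
have e0 : 0 < e by rewrite !divr_gt0 // oppr_gt0.
exists e => // Y Y' Y0 Y'0 [K [d [d0 nr]]].
have [K' [d' [d'0 hY']]] := entropy_inv a0 Y'0 (divr_gt0 eta0 (ltr0Sn R 2)).
have [K2 [d2 [d20 inv2]]] := Finv_and K K' d0 d'0.
have [F F0 /inv2[FK FK']] := inv K2 d2 d20.
have n0 : 0 < #|` F|%:R :> R by rewrite ltr0n cardfs_gt0.
rewrite -(ler_pM2r n0); apply: le_trans (entropy_le R Y0 F0) _.
pose b : R := (1 + a * u) ^+ #|` F| * expR (- (e * #|` F|%:R * ln u)).
have b0 : 0 < b by rewrite mulr_gt0 ?expR_gt0 // exprn_gt0 // addr_gt0 // mulr_gt0.
have : (npat Y F)%:R <= (npat Y' F)%:R * b.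
  rewrite /npat; apply: (@card_cover {ffun F -> A} _ _ (fun v : {ffun F -> A} => [set v' : {ffun F -> A} |
     #|[set t | v t != v' t]|%:R <= e * #|` F|%:R])); last first.
    move=> q _; rewrite /b expRN ler_pdivlMr ?expR_gt0 //.
    rewrite cardfE; exact: (card_ball q (e * _) u0 (ltW u1)).
  move=> p /patsP[w Yw pw]; have [w' Yw' dw] := nr F FK w Yw.
  exists [ffun t : F => w' (val t)]; first exact: mem_pats.
  rewrite inE; apply: le_trans dw; rewrite ler_nat cardE -(size_map val).
  apply: uniq_leq_size => [|x]; first by rewrite map_inj_uniq ?enum_uniq //; exact: val_inj.
  move=> /mapP[t]; rewrite mem_enum inE ffunE pw => ne ->.
  by rewrite !inE /= fsvalP eq_sym.
move=> le; have NY : 0 < (npat Y F)%:R :> R by rewrite ltr0n; exact: npat_gt0.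
have NY' : 0 < (npat Y' F)%:R :> R by rewrite ltr0n; exact: npat_gt0.
have {le}: ln (npat Y F)%:R <= ln ((npat Y' F)%:R * b).
  by rewrite ler_ln ?posrE // mulr_gt0.
move/le_trans; apply; rewrite lnM ?posrE // mulrDl.
apply: (@le_trans _ _ ((entropy R Y' + eta / 3) * #|` F|%:R + 2 * eta / 3 * #|` F|%:R)).
  apply: lerD; first exact: hY'.
  rewrite lnM ?posrE ?expR_gt0 ?exprn_gt0 ?addr_gt0 ?mulr_gt0 // expRK lnXn ?addr_gt0 ?mulr_gt0 //.
  have -> : 2 * eta / 3 = eta / 3 + eta / 3 by rewrite -mulrA mulr_natl mulr2n.
  rewrite mulrDl; apply: lerD; last first.
    by rewrite /e -mulrN mulrAC divfK // oppr_eq0 lt_eqF.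
  rewrite -[leLHS]mulr_natr; apply: ler_wpM2r; first exact: ltW.
  apply: le_trans (le_ln1Dx _) _; first by rewrite (lt_trans _ (mulr_gt0 a_gt0 u0)) ?ltrN10.
  by rewrite mulrC -ler_pdivlMr // ge_min lexx orbT.
by rewrite -!mulrDl ler_pM2r //; lra.
Qed.

End Hamming.

Local Open Scope classical_set_scope.
Local Open Scope ring_scope.

(** * Tiles and prototypes *)

Lemma torsion_free_order (G : groupType) (g : G) : torsion_free G -> g <> 1%g ->
  injective (fun n => g ^+ n)%g.
Proof.
move=> tf g1; have le m n : (m <= n)%N -> (g ^+ m = g ^+ n)%g -> m = n.
  move=> mn e; have : (g ^+ (n - m) = 1)%g.
    by apply: (@mulgI _ (g ^+ m)%g); rewrite -expgD subnKC // mulg1.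
  have [/eqP|nm] := posnP (n - m).
    by rewrite subn_eq0 => nm _; apply/eqP; rewrite eqn_leq mn.
  by move=> /tf -/(_ nm).
move=> m n e; have [mn|/ltnW nm] := leqP m n; first exact: le.
by apply/esym/le.
Qed.

(** If [F a = F], then [x * a ^ n] stays in the finite set [F], so [a] has finite order and is
    trivial. Hence a copy of a prototype determines the element translating it. *)
Lemma rtranslate_inj (G : groupType) (F : {fset G}) : torsion_free G -> F != fset0 ->
  injective (rtranslate F).
Proof.
move=> tf /fset0Pn[x xF] g g' e; pose a := (g * g'^-1)%g.
have aF : forall y, y \in F -> (y * a)%g \in F.
  by move=> y yF; rewrite /a mulgA -rtranslateP -e rtranslateP mulgK.
have [a1|a1] := eqVneq a 1%g; first by apply/eqP; rewrite -divg_eq1 -/a a1.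
have inj := torsion_free_order tf (fun e => negP a1 (introT eqP e)).
have mem n : (x * a ^+ n)%g \in F.
  by elim: n => [|n IH]; rewrite ?expg0 ?mulg1 // expgSr mulgA aF.
have injF : injective (fun i : 'I_(#|` F|.+1) => [` mem i]%fset : F).
  by move=> i j /(congr1 val) /= /mulgI /inj; exact: val_inj.
by have := leq_card _ injF; rewrite card_ord -cardfE ltnn.
Qed.

Section Subgroups.
Variables (G : groupType) (H : set G).
Hypothesis HG : is_subgroup H.

Lemma subgroup1 : H 1%g.
Proof. by case: HG => /set_mem. Qed.

Lemma subgroupV x : H x -> H (x^-1)%g.
Proof.
by move=> Hx; have := group_closedV HG; move=> /(_ x (mem_set Hx)) /set_mem.
Qed.

Lemma subgroupM x y : H x -> H y -> H (x * y)%g.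
Proof.
by move=> Hx Hy; have := group_closedM HG; move=> /(_ x y (mem_set Hx) (mem_set Hy)) /set_mem.
Qed.

End Subgroups.

Section Tower.
Variables (R : realType) (G : groupType).

(* [tl k t] is the tile of level [k] containing [t]; the tile of the identity is
   the prototype of level [k]. *)
Record tower (H : set G) (tl : nat -> G -> {fset G}) (H0 : nat -> set G) : Prop := Tower {
  tile_refl : forall k t, t \in tl k t;
  tile_eq : forall k t u, u \in tl k t -> tl k u = tl k t;
  tile_nested : forall k t, (tl k t `<=` tl k.+1 t)%fset;
  tile_exhaust : forall t, exists k, t \in tl k 1%g;
  tile_Folner : forall (K : {fset G}) (delta : R), 0 < delta ->
    exists n0, forall n, (n0 <= n)%N -> forall t, Finv K delta (tl n t);
  tile_bounded : forall k, exists Q : {fset G}, forall t u, u \in tl k t -> (u * t^-1)%g \in Q;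
  tile_recur : forall k t, exists2 g, g \in tl k.+1 t & tl k g = rtranslate (tl k 1%g) g;
  line_subgroup : is_subgroup H;
  line_cyclic : infinite_cyclic H;
  line_thin : forall delta : R, 0 < delta -> exists n0, forall n, (n0 <= n)%N ->
    #|` [fset h in tl n 1%g | h \in H]%fset|%:R <= delta * #|` tl n 1%g|%:R;
  line_sub : forall k c, H0 k c -> H c;
  line_step : forall k, is_subgroup (H0 k);
  line_tile : forall k c, H0 k c -> tl k c = rtranslate (tl k 1%g) c;
  line_cover : forall k h, H h -> exists2 c, H0 k c & h \in rtranslate (tl k 1%g) c }.

Section Tiling.
Variable T : tiling G.

Lemma tile_ex t : exists p : tindex T * G,
  tcenter p.1 p.2 /\ t \in rtranslate (tshape p.1) p.2.
Proof. by have [p [tp _]] := tiling_partition T t; exists p. Qed.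

Definition tile_at t : {fset G} :=
  let p := projT1 (cid (tile_ex t)) in rtranslate (tshape p.1) p.2.

Lemma tile_at_tile t : is_tile T (tile_at t).
Proof.
have [cp _] := projT2 (cid (tile_ex t)).
by exists (projT1 (cid (tile_ex t))).1, (projT1 (cid (tile_ex t))).2.
Qed.

Lemma tile_at_refl t : t \in tile_at t.
Proof. by have [_] := projT2 (cid (tile_ex t)). Qed.

Lemma tile_atP S t : is_tile T S -> t \in S -> tile_at t = S.
Proof.
move=> [i [c [ic ->]]] tS; have [p [_ uniq]] := tiling_partition T t.
have e1 := uniq (i, c) (conj ic tS); have e2 := uniq _ (projT2 (cid (tile_ex t))).
by rewrite /tile_at -e2 e1.
Qed.

Lemma tile_at_eq t u : u \in tile_at t -> tile_at u = tile_at t.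
Proof. by apply: tile_atP; exact: tile_at_tile. Qed.

End Tiling.

Lemma Finv_rtranslate (K F : {fset G}) (delta : R) g :
  Finv K delta F -> Finv K delta (rtranslate F g).
Proof.
move=> inv t /inv; rewrite card_rtranslate; apply: le_trans; rewrite ler_nat.
rewrite -[leqRHS](card_rtranslate _ g); apply: fsubset_leq_card; apply/fsubsetP => x.
by rewrite !inE /= !rtranslateP !inE /= mulgA.
Qed.

(** Passing to the subsequence [nu] makes a copy of each prototype occur in every tile of the next
    level. *)
Lemma tower_of_property_ID : property_ID R G ->
  exists H tl H0, tower H tl H0.
Proof.
move=> [H [T [[Hgrp Hcyc _] [[nest fol synd _] [exh thin line]]]]].
pose th n := tile_at (T n).
have nest1 n t : (th n t `<=` th n.+1 t)%fset.
  have [i [c [ic e]]] := tile_at_tile (T n.+1) t.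
  have [m [S [g [_ SP _ cen]]]] := nest n i.
  have tS : (t * c^-1)%g \in tshape i.
    by rewrite -rtranslateP -e; exact: tile_at_refl.
  have [j tj] := (SP _).1 tS.
  have [l lS lc] := cen c j ic.
  have tlc : is_tile (T n) (rtranslate (tshape l) (g j * c)%g) by exists l, (g j * c)%g.
  rewrite /th (tile_atP tlc); last first.
    by rewrite lS rtranslateP invMg mulgA; move: tj; rewrite rtranslateP.
  apply/fsubsetP => x; rewrite rtranslateP lS invMg mulgA => xS; rewrite e rtranslateP.
  by apply/SP; exists j; rewrite rtranslateP.
have nestm n m t : (n <= m)%N -> (th n t `<=` th m t)%fset.
  move=> /subnKC <-; elim: (m - n)%N => [|d IH]; first by rewrite addn0.
  by rewrite addnS; apply: fsubset_trans IH _.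
have inv K (d : R) : 0 < d -> exists n0, forall n, (n0 <= n)%N -> forall t, Finv K d (th n t).
  move=> d0; have [N NP] := fol K d d0; exists N => n Nn t.
  have [i [c [ic e]]] := tile_at_tile (T n) t; rewrite /th e.
  apply: Finv_rtranslate => k kK; have le := NP n Nn i.
  have := card_filterC (tshape i) (fun s => (k * s)%g \in tshape i) => /(congr1 (fun n => n%:R : R)).
  rewrite natrD => cC; move: le; rewrite -cC.
  set a := #|` _|; set b := #|` _|; set x := #|` _| => le.
  have : (x <= a)%N.
    apply: fsubset_leq_card; apply/fsubsetP => s; by rewrite !inE /= => /andP[sS /allP sK]; rewrite sS; exact: (sK _ kK).
  rewrite -(ler_nat R) => le'; move: le le'; rewrite -/b; nra.
(* Syndetic centers place a center of the right shape within bounded distance of any point; starting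
   from a point deep inside a large tile, the base point of the resulting copy still lies in that
   tile. *)
have recur n : exists n0, forall m, (n0 <= m)%N -> forall t,
    exists2 g, g \in th m t & th n g = rtranslate (th n 1%g) g.
  have [i [c0 [ic0 e0]]] := tile_at_tile (T n) 1%g.
  have [F FP] := synd n i.
  pose K := [fset (c0^-1 * f^-1)%g | f in F]%fset.
  have [N NP] := fol K (1 / 2) ltac:(lra).
  exists N => m Nm t; have [i' [c' [ic' e']]] := tile_at_tile (T m) t.
  have : [fset s in tshape i' | all (fun t => (t * s)%g \in tshape i') K]%fset != fset0.
    rewrite -cardfs_gt0 -(ltr0n R); apply: lt_le_trans (NP m Nm i').
    by rewrite mulr_gt0 ?ltr0n ?cardfs_gt0 ?shape_neq0 //; lra.
  move=> /fset0Pn[s]; rewrite !inE /= => /andP[sS /allP sK].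
  have [f [c fF [ic fc]]] := FP (s * c')%g.
  exists (c0^-1 * c)%g.
    rewrite /th e' rtranslateP.
    have -> : (c0^-1 * c * c'^-1 = (c0^-1 * f^-1) * s)%g.
      rewrite -!mulgA; congr (_ * _)%g; apply: (@mulgI _ f).
      by rewrite mulVKg !mulgA -fc mulgK.
    by apply: sK; apply/imfsetP; exists f.
  have -> : rtranslate (th n 1%g) (c0^-1 * c)%g = rtranslate (tshape i) c.
    apply/fsetP => x; rewrite rtranslateP /th e0 !rtranslateP.
    by rewrite invMg invgK !mulgA mulgK.
  apply: tile_atP; first by exists i, c.
  have := tile_at_refl (T n) 1%g; rewrite -/(th n 1%g) /th e0 !rtranslateP mul1g.
  by rewrite mulgK.
have [nu0 nu0P] := choice recur.
pose nu := fix nu k := if k is k'.+1 then maxn (nu0 (nu k')) (nu k').+1 else 0%N.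
have nuS k : (nu k < nu k.+1)%N by rewrite /= leq_max ltnSn orbT.
have nuk k : (k <= nu k)%N.
  by elim: k => // k IH; apply: leq_ltn_trans IH _.
have [S0 S0P] := choice line.
have [H0 H0P] := choice S0P.
exists H, (fun k => th (nu k)), (fun k => H0 (nu k)).
(* Condition (iii) speaks of a shape, the tower of the tile of the identity. They differ by a
   translation by [c0] in [H0 n], which the subgroup absorbs. *)
have D0 n : exists2 c0, H0 n c0 & th n 1%g = rtranslate (S0 n) c0.
  have [_ [H0g H0s] tileS cov] := H0P n.
  have [c0 Hc0 c0S] := cov 1%g (subgroup1 Hgrp).
  by exists c0 => //; apply: tile_atP => //; exact: tileS.
split.
- by move=> k t; exact: tile_at_refl.
- by move=> k t u; exact: tile_at_eq.
- by move=> k t; apply: nestm; exact: ltnW.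
- move=> t; have [n [S tS sub]] := exh [fset 1%g; t]%fset.
  exists n; apply: (fsubsetP (nestm n (nu n) 1%g (nuk n))).
  move/fsubsetP: sub => sub; rewrite /th (tile_atP tS); apply: sub; rewrite !inE eqxx ?orbT //.
- move=> K d d0; have [n0 n0P] := inv K d d0; exists n0 => n le t.
  by apply: n0P; exact: leq_trans le (nuk n).
- move=> k; pose U := (\bigcup_(i <- enum (tindex (T (nu k)))) tshape i)%fset.
  exists (mulfs U (invfs U)) => t u; rewrite /th.
  have [i [c [ic e]]] := tile_at_tile (T (nu k)) t.
  have := tile_at_refl (T (nu k)) t; rewrite e !rtranslateP => tS uS.
  apply/mulfsP; exists (u * c^-1)%g, ((t * c^-1)^-1)%g; split.
  + by apply/bigfcupP; exists i; rewrite ?mem_enum.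
  + by rewrite invfsP invgK; apply/bigfcupP; exists i; rewrite ?mem_enum.
  + by rewrite invMg invgK mulgA mulgKV.
- move=> k t; apply: nu0P; exact: leq_maxl.
- by [].
- by [].
- move=> d d0; have [n0 n0P] := thin d d0; exists n0 => n le.
  by apply: n0P; [exact: leq_trans le (nuk n) | exact: tile_at_tile].
- by move=> k c; have [_ [_ sub] _ _] := H0P (nu k); exact: sub.
- by move=> k; have [_ [? _] _ _] := H0P (nu k).
- move=> k c Hc; have [c0 Hc0 e] := D0 (nu k); have [_ [H0g _] tileS _] := H0P (nu k).
  have -> : rtranslate (th (nu k) 1%g) c = rtranslate (S0 (nu k)) (c0 * c)%g.
    by apply/fsetP => x; rewrite e !rtranslateP invMg mulgA.
  apply: tile_atP.
    by apply: tileS; exact: subgroupM.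
  have := tile_at_refl (T (nu k)) 1%g; rewrite -/(th _ _) e !rtranslateP mul1g.
  by rewrite invMg mulVKg.
- move=> k h Hh; have [c0 Hc0 e] := D0 (nu k); have [_ [H0g _] tileS cov] := H0P (nu k).
  have [c Hc hS] := cov h Hh; exists (c0^-1 * c)%g.
    by apply: subgroupM => //; exact: subgroupV.
  by rewrite e !rtranslateP invMg invgK mulgA mulgK -rtranslateP.
Qed.

End Tower.

(** * Substituting the prototypes *)

Section CyclicOrder.
Variables (G : groupType) (H : set G) (h : G).
Hypotheses (tf : torsion_free G) (Hh : H = Defs.generated [set h]) (Hinf : infinite_set H).

(** The order of the integers, carried over by the generator [h]: on [H] it is total and invariant
    under translation, and it supplies least elements of finite subsets. *)
Definition cyc_le (x y : G) := exists n : nat, y = (x * h ^+ n)%g.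

Lemma cyclic_elt x : H x -> exists n : nat, x = (h ^+ n)%g \/ x = (h ^- n)%g.
Proof.
pose P := [set x : G | exists n : nat, x = (h ^+ n)%g \/ x = (h ^- n)%g].
rewrite Hh => /(_ P); apply; split; last by move=> _ ->; exists 1%N; rewrite expg1; left.
have PV y : P y -> P (y^-1)%g.
  by move=> [n [->|->]]; exists n; [right | left; rewrite invgK].
have mn (m n : nat) : P (h ^+ m * h ^- n)%g.
  have [mn|/ltnW nm] := leqP m n.
    exists (n - m)%N; right; apply: (@mulIg _ (h ^+ n)%g); rewrite mulgKV.
    by rewrite -{2}(subnK mn) expgD mulKg.
  exists (m - n)%N; left; apply: (@mulIg _ (h ^+ n)%g).
  by rewrite mulgKV -expgD subnK.
split; first by apply/mem_set; exists 0%N; left; rewrite expg0.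
move=> x' y /set_mem Px /set_mem /PV Py; apply/mem_set.
case: Px Py => m [->|->] [n [->|->]].
- by exists (m + n)%N; left; rewrite expgD.
- exact: mn.
- have [p [e|e]] := mn n m; exists p; [left|right]; rewrite -e.
    by rewrite -!expVgn; apply: commuteX2; apply/commute_sym/commuteV.
  by rewrite -!expVgn; apply: commuteX2; apply/commute_sym/commuteV.
- by exists (m + n)%N; right; rewrite addnC expgD invMg.
Qed.

Lemma cyc_le_mulr x y z : H z -> cyc_le x y -> cyc_le (x * z)%g (y * z)%g.
Proof.
move=> /cyclic_elt[m ez] [n ->]; exists n; rewrite -!mulgA; congr (_ * _)%g.
case: ez => ->; rewrite -?expVgn; apply: commuteX2 => //; exact: commuteV.
Qed.

Lemma generator_neq1 : h <> 1%g.
Proof.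
move=> h1; apply: Hinf; apply: (@sub_finite_set _ _ [set 1%g]); last exact: finite_set1.
by move=> x /cyclic_elt[n [->|->]]; rewrite h1 expg1n ?invg1.
Qed.

Lemma cyc_le_anti x y : cyc_le x y -> cyc_le y x -> x = y.
Proof.
move=> [n ->] [m]; rewrite -mulgA -expgD -[LHS]mulg1 => /mulgI e.
have /esym/eqP := torsion_free_order tf generator_neq1 (etrans (expg0 h) e).
by rewrite addn_eq0 => /andP[/eqP -> _]; rewrite expg0 mulg1.
Qed.

Lemma cyc_le_trans x y z : cyc_le x y -> cyc_le y z -> cyc_le x z.
Proof. by move=> [n ->] [m ->]; exists (n + m)%N; rewrite expgD mulgA. Qed.

Lemma cyc_le_total x y : is_subgroup H -> H x -> H y -> cyc_le x y \/ cyc_le y x.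
Proof.
move=> HG Hx Hy; have [n [e|e]] := cyclic_elt (subgroupM HG (subgroupV HG Hx) Hy).
  by left; exists n; rewrite -e mulVKg.
by right; exists n; rewrite -[(h ^+ n)%g]invgK -e invMg invgK mulVKg.
Qed.

Lemma cyc_min (F : {fset G}) : is_subgroup H -> F != fset0 ->
  (forall x, x \in F -> H x) ->
  exists2 m, m \in F & forall x, x \in F -> cyc_le m x.
Proof.
move=> HG; elim/finSet_rect: F => F IH /fset0Pn[x xF] FH.
have le_refl y : cyc_le y y by exists 0%N; rewrite expg0 mulg1.
have [F0|F0] := eqVneq (F `\ x)%fset fset0.
  exists x => // y yF; suff -> : y = x by [].
  by apply/eqP/contraT => yx; move/fsetP: F0 => /(_ y); rewrite !inE yF yx.
have sub : (F `\ x `<` F)%fset by rewrite fproperD1.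
have [m mF mle] := IH _ sub F0 (fun y yF => FH y (fsubsetP (fproper_sub sub) y yF)).
have mF' := fsubsetP (fproper_sub sub) m mF.
have [le|le] := cyc_le_total HG (FH _ xF) (FH _ mF').
  exists x => // y yF; have [->//|yx] := eqVneq y x.
  by apply: cyc_le_trans le _; apply: mle; rewrite !inE yx.
exists m => // y yF; have [->//|yx] := eqVneq y x.
by apply: mle; rewrite !inE yx.
Qed.

End CyclicOrder.

Section Reduction.
Variables (R : realType) (G : groupType) (H : set G) (tl : nat -> G -> {fset G}).
Variable (H0 : nat -> set G).
Hypotheses (tf : torsion_free G) (tow : tower R H tl H0).

Let D k := tl k 1%g.

Lemma tile_mono n m t : (n <= m)%N -> (tl n t `<=` tl m t)%fset.
Proof.
move=> /subnKC <-; elim: (m - n)%N => [|d IH]; first by rewrite addn0.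
by rewrite addnS; apply: fsubset_trans IH (tile_nested tow _ _).
Qed.

Lemma D1 k : 1%g \in D k. Proof. exact: (tile_refl tow). Qed.

Lemma D_neq0 k : D k != fset0.
Proof. by apply/fset0Pn; exists 1%g; exact: D1. Qed.

Lemma D_tile k t : t \in D k -> tl k t = D k.
Proof. exact: (tile_eq tow). Qed.

(** In a tile that is a copy [D k g] this is the position of [t] in the prototype; in any other tile
    the default 1 leaves [t] in place. *)
Definition nrm k t := (t * (xget 1 [set g | tl k t = rtranslate (D k) g])^-1)%g.

Lemma nrm_copy k t g : tl k t = rtranslate (D k) g -> nrm k t = (t * g^-1)%g.
Proof.
move=> e; rewrite /nrm; case: xgetP => [g' _ /= e'|/(_ g)//].
by have /(rtranslate_inj tf (D_neq0 k)) -> := etrans (esym e) e'.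
Qed.

Lemma nrmP k t : (exists2 g, tl k t = rtranslate (D k) g & nrm k t \in D k) \/ nrm k t = t.
Proof.
have [[g e]|no] := pselect (exists g, tl k t = rtranslate (D k) g).
  by left; exists g => //; rewrite (nrm_copy e) -rtranslateP -e (tile_refl tow).
by right; rewrite /nrm; case: xgetP => [g _ e|_]; [case: no; exists g | rewrite invg1 mulg1].
Qed.

(** On each tile of level [k] the map [nrm k] is a single right translation onto a tile. *)
Lemma nrm_tile k v v' : v' \in tl k (nrm k v) ->
  ((v' * (nrm k v)^-1 * v)%g \in tl k v) /\ nrm k (v' * (nrm k v)^-1 * v)%g = v'.
Proof.
case: (nrmP k v) => [[g e vD]|ev]; last first.
  rewrite ev => v'v; rewrite mulgKV; split => //; rewrite /nrm (tile_eq tow v'v).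
  have -> : xget 1%g [set g | tl k v = rtranslate (D k) g] = 1%g.
    by apply: invg_inj; rewrite invg1; apply: (@mulgI _ v); rewrite mulg1.
  by rewrite invg1 mulg1.
rewrite (D_tile vD) => v'D; move: (nrm_copy e) => en; rewrite en invMg invgK.
have e1 : (v' * (g * v^-1) * v = v' * g)%g by rewrite mulgA mulgKV.
rewrite e1; have mem : (v' * g)%g \in tl k v by rewrite e rtranslateP mulgK.
by split => //; rewrite (@nrm_copy k _ g) ?mulgK // (tile_eq tow mem).
Qed.

Lemma nrm_D k t : t \in D k -> nrm k t = t.
Proof.
move=> /D_tile e; rewrite (@nrm_copy k t 1%g) ?invg1 ?mulg1 // e.
by apply/fsetP => x; rewrite rtranslateP invg1 mulg1.
Qed.

(* Partial composition of the infinite product [nrm k \o nrm k.+1 \o ...],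
   which is pointwise finite because [nrm n] fixes [D n]. *)
Fixpoint redn k n t := if n is n'.+1 then nrm k (redn k.+1 n' t) else t.

Lemma redn_D k n t : t \in D k -> redn k n t = t.
Proof.
elim: n k => //= n IH k tD; rewrite IH ?nrm_D //.
exact: (fsubsetP (tile_nested tow k 1%g)).
Qed.

Lemma redn_add k n m t : redn k (n + m) t = redn k n (redn (k + n) m t).
Proof. by elim: n k => [|n IH] k; rewrite ?addn0 //= IH addSnnS. Qed.

(** The value of the infinite composition; by [red_redn] it does not depend on the level chosen
    here. *)
Definition red k t := redn k (projT1 (cid (tile_exhaust tow t))) t.

Lemma red_redn k n t : t \in D (k + n) -> red k t = redn k n t.
Proof.
have le (a b : nat) : (a <= b)%N -> t \in D (k + a) -> redn k b t = redn k a t.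
  move=> ab tD; rewrite -(subnKC ab) redn_add; congr redn; exact: redn_D.
rewrite /red; case: (cid _) => l /= tl0 tn.
have tl' : t \in D (k + l) by apply: (fsubsetP (tile_mono _ _)) tl0; exact: leq_addl.
by have [ln|/ltnW nl] := leqP l n; [rewrite -(le _ _ ln) | rewrite (le _ _ nl)].
Qed.

Lemma in_some_D k t : exists n, t \in D (k + n).
Proof.
have [l tl0] := tile_exhaust tow t; exists l.
by apply: (fsubsetP (tile_mono _ _)) tl0; exact: leq_addl.
Qed.

Lemma red_step k t : red k t = nrm k (red k.+1 t).
Proof.
have [n tn] := in_some_D k.+1 t.
by rewrite (@red_redn k.+1 n) // (@red_redn k n.+1) // -addSnnS.
Qed.

Lemma red_D k t : t \in D k -> red k t = t.
Proof. by move=> tD; rewrite (@red_redn k 0) ?addn0. Qed.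

Lemma red_add k n t : red k t = redn k n (red (k + n) t).
Proof. by elim: n k => [|n IH] k; rewrite ?addn0 //= red_step IH addSnnS. Qed.

(** Like its factors, [red k] is locally a right translation onto a tile. The induction also shows
    that the pulled-back point stays in [D (k + n)], since only there does the same finite
    composition compute [red k]. *)
Lemma red_tile k t v : v \in tl k (red k t) -> red k (v * (red k t)^-1 * t)%g = v.
Proof.
have [n tn] := in_some_D k t; rewrite (red_redn tn).
suff: v \in tl k (redn k n t) -> (v * (redn k n t)^-1 * t)%g \in D (k + n) /\
    redn k n (v * (redn k n t)^-1 * t)%g = v.
  by move=> + vt => /(_ vt)[uD eu]; rewrite (red_redn uD).
elim: n k t v tn => [|n IH] k t v /=.
  by rewrite addn0 => tD; rewrite (D_tile tD) mulgKV.
rewrite -addSnnS => tD vt; set w := redn k.+1 n t in vt *.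
have [mem e] := nrm_tile vt.
have mem' : (v * (nrm k w)^-1 * w)%g \in tl k.+1 w.
  exact: (fsubsetP (tile_nested tow k w)).
have [] := IH k.+1 t _ tD mem'; rewrite -/w mulgK => -> ->.
by rewrite e.
Qed.

(* The tile of [t] after substitution: a translate of the tile containing the
   prototype position [red k t]. *)
Definition cell k t := rtranslate (tl k (red k t)) ((red k t)^-1 * t)%g.

Lemma mem_cell k t u : (u \in cell k t) = ((u * t^-1 * red k t)%g \in tl k (red k t)).
Proof. by rewrite rtranslateP invMg invgK mulgA. Qed.

Lemma cell_refl k t : t \in cell k t.
Proof. by rewrite mem_cell mulgV mul1g (tile_refl tow). Qed.

Lemma cell_red k t u : u \in cell k t -> red k u = (u * t^-1 * red k t)%g.
Proof. by rewrite mem_cell => /red_tile; rewrite mulgK mulgKV. Qed.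

Lemma cell_eq k t u : u \in cell k t -> cell k u = cell k t.
Proof.
move=> ut; have e := cell_red ut; rewrite /cell e.
move: (ut); rewrite mem_cell => /(tile_eq tow) ->; congr rtranslate.
by rewrite !invMg invgK !mulgA mulgKV.
Qed.

Lemma cell_sym k t u : (u \in cell k t) = (t \in cell k u).
Proof. by apply/idP/idP => /cell_eq e; rewrite e cell_refl. Qed.

Lemma cell_nested k t : (cell k t `<=` cell k.+1 t)%fset.
Proof.
apply/fsubsetP => u; rewrite !mem_cell red_step => /nrm_tile[mem _].
move: mem; rewrite mulgK => mem; exact: (fsubsetP (tile_nested tow _ _)).
Qed.

Lemma cell_mono n m t : (n <= m)%N -> (cell n t `<=` cell m t)%fset.
Proof.
move=> /subnKC <-; elim: (m - n)%N => [|d IH]; first by rewrite addn0.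
by rewrite addnS; apply: fsubset_trans IH (cell_nested _ _).
Qed.

Lemma card_cell k t : #|` cell k t| = #|` tl k (red k t)|.
Proof. exact: card_rtranslate. Qed.

Lemma cell_Folner (K : {fset G}) (delta : R) : 0 < delta ->
  exists n0, forall n, (n0 <= n)%N -> forall t, Finv K delta (cell n t).
Proof.
move=> d0; have [n0 n0P] := tile_Folner tow K d0.
by exists n0 => n le t; apply: Finv_rtranslate; exact: n0P.
Qed.

Lemma cell_bounded k : exists Q : {fset G}, forall t u, u \in cell k t -> (u * t^-1)%g \in Q.
Proof.
have [Q QP] := tile_bounded tow k; exists Q => t u; rewrite mem_cell => /QP.
by rewrite mulgK.
Qed.

(** The equation [red k g = 1] marks [g] as the base point of a copy of the prototype; copies are
    referred to by it from here on. *)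
Lemma cell_copy k g : red k g = 1%g -> cell k g = rtranslate (D k) g.
Proof. by move=> e; rewrite /cell e invg1 mul1g. Qed.

Lemma red_copy k g s : red k g = 1%g -> s \in D k -> red k (s * g)%g = s.
Proof.
move=> e sD; rewrite (@cell_red _ g) ?cell_copy ?rtranslateP ?mulgK //.
by rewrite e mulg1.
Qed.

Lemma copy_ex k t : red k t \in D k -> red k ((red k t)^-1 * t)%g = 1%g.
Proof.
move=> tD; have := @red_tile k t 1%g; rewrite mul1g; apply.
by rewrite (D_tile tD) D1.
Qed.

(** This is the gain of the substitution: at every lower level a copy of [D n] is subdivided as
    [D n] itself is, which the original tiles need not satisfy. *)
Lemma red_red k n t : (k <= n)%N -> red n t \in D n -> red k (red n t) = red k t.
Proof.
move=> /subnKC e tD; rewrite [RHS](red_add k (n - k)) e.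
by rewrite (@red_redn k (n - k)) // e.
Qed.

Lemma copy_recur k : exists K : {fset G}, forall t,
  exists2 g, red k g = 1%g & (g * t^-1)%g \in K.
Proof.
have [Q QP] := cell_bounded k.+1; exists Q => t.
have [g gt eg] := tile_recur tow k (red k.+1 t).
have gc : (g * (red k.+1 t)^-1 * t)%g \in cell k.+1 t.
  by rewrite mem_cell mulgK mulgKV.
exists (g * (red k.+1 t)^-1 * t)%g; last exact: QP.
by rewrite red_step red_tile // (nrm_copy eg) mulgV.
Qed.

Lemma nrm_line k h : H h -> H (nrm k h) /\ nrm k h \in D k.
Proof.
move=> Hh; have [c Hc hc] := line_cover tow k Hh; have HG := line_subgroup tow.
have e : tl k h = rtranslate (D k) c.
  by rewrite -(line_tile tow Hc); apply: (tile_eq tow); rewrite (line_tile tow Hc).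
rewrite (nrm_copy e) -rtranslateP; split => //.
by apply: subgroupM => //; apply: subgroupV => //; exact: (line_sub tow Hc).
Qed.

(* The tiles meeting [H] at levels [k] and [k+1] are [D k c] with [c] in [H0 k]
   and [D k.+1 c'] with [c'] in [H0 k.+1]; comparing least elements of
   [D k.+1 c' :&: H], computed at both levels, puts [c'] in [H0 k]. *)
Lemma line_dec k c : H0 k.+1 c -> H0 k c.
Proof.
move=> Hc; have HG := line_subgroup tow; have H0G := line_step tow k.
have [[h Hh] Hinf] := line_cyclic tow.
have Hc' := line_sub tow Hc.
pose B := [fset b in D k | b \in H]%fset.
have BH x : x \in B -> H x by rewrite !inE /= => /andP[_ /set_mem].
have memB x : x \in D k -> H x -> x \in B by move=> xD Hx; rewrite !inE /= xD mem_set.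
have [b bB bmin] := cyc_min Hh HG (introT (fset0Pn _) (ex_intro _ 1%g (memB _ (D1 k) (subgroup1 HG)))) BH.
have key c' : H0 k.+1 c' -> exists2 q, H0 k q &
    [/\ (b * q)%g \in rtranslate (D k.+1) c' & forall x, x \in rtranslate (D k.+1) c' -> H x -> cyc_le h (b * q)%g x].
  move=> H0c'; pose X := [fset x in rtranslate (D k.+1) c' | x \in H]%fset.
  have XH x : x \in X -> H x by rewrite !inE /= => /andP[_ /set_mem].
  have c'X : c' \in X.
    by rewrite !inE /= rtranslateP mulgV D1 /=; apply/mem_set; exact: (line_sub tow H0c').
  have [m mX mmin] := cyc_min Hh HG (introT (fset0Pn _) (ex_intro _ c' c'X)) XH.
  have [q Hq mq] := line_cover tow k (XH _ mX).
  have bqX : (b * q)%g \in X.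
    have Hq' := line_sub tow Hq.
    rewrite !inE /= mem_set ?andbT; last by apply: (subgroupM HG) => //; exact: BH.
    rewrite -(line_tile tow H0c').
    have mt : m \in tl k.+1 c' by rewrite (line_tile tow H0c'); move: mX; rewrite !inE /= => /andP[].
    rewrite -(tile_eq tow mt); apply: (fsubsetP (tile_nested tow k m)).
    rewrite -(line_tile tow Hq) in mq; rewrite (tile_eq tow mq) (line_tile tow Hq).
    by rewrite rtranslateP mulgK; move: bB; rewrite !inE /= => /andP[].
  have e : m = (b * q)%g.
    apply: (cyc_le_anti tf Hh Hinf); first exact: mmin.
    rewrite -[m](mulgKV q); apply: (cyc_le_mulr Hh (line_sub tow Hq)).
    apply: bmin; apply: memB; first by move: mq; rewrite rtranslateP.
    by apply: (subgroupM HG); [exact: XH | apply: (subgroupV HG); exact: (line_sub tow Hq)].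
  exists q => //; rewrite -e; split; first by move: mX; rewrite !inE /= => /andP[].
  by move=> x xc Hx; apply: mmin; rewrite !inE /= xc mem_set.
have [q Hq [bq qmin]] := key 1%g (subgroup1 (line_step tow k.+1)).
have [q' Hq' [bq' qmin']] := key c Hc.
have D1E x : (x \in rtranslate (D k.+1) 1%g) = (x \in D k.+1).
  by rewrite rtranslateP invg1 mulg1.
have Hb := BH _ bB; have Hq1 := line_sub tow Hq; have Hq1' := line_sub tow Hq'.
have e : (b * q * c = b * q')%g.
  apply: (cyc_le_anti tf Hh Hinf).
    rewrite -[(b * q')%g](mulgKV c); apply: (cyc_le_mulr Hh Hc').
    apply: qmin; first by rewrite D1E -rtranslateP.
    by apply: (subgroupM HG); [exact: subgroupM | exact: subgroupV].
  apply: qmin'; first by rewrite rtranslateP mulgK -D1E.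
  by do 2!apply: (subgroupM HG) => //.
have -> : c = (q^-1 * q')%g by apply: (@mulgI _ (b * q)%g); rewrite e mulgA mulgK.
by apply: (subgroupM H0G) => //; exact: (subgroupV H0G).
Qed.

(** Along [H] the higher factors translate by elements of [H0 k.+1], hence of [H0 k], and [nrm k]
    absorbs these. So the substitution does not disturb the copies that condition (iii) places on
    the line. *)
Lemma red_line k h : H h -> red k h = nrm k h.
Proof.
have HG := line_subgroup tow.
suff key n k' h' : H h' -> redn k' n.+1 h' = nrm k' h'.
  move=> Hh; have [n hn] := in_some_D k h; rewrite (@red_redn k n.+1) ?key //.
  by rewrite addnS; apply: (fsubsetP (tile_nested tow _ _)).
elim: n k' h' => [//|n IH] k' h' Hh; rewrite -[LHS]/(nrm k' (redn k'.+1 n.+1 h')) IH //.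
have [c' Hc' hc'] := line_cover tow k'.+1 Hh.
have [c Hc hc] := line_cover tow k' Hh.
have e' : tl k'.+1 h' = rtranslate (D k'.+1) c'.
  by rewrite -(line_tile tow Hc'); apply: (tile_eq tow); rewrite (line_tile tow Hc').
have e : tl k' h' = rtranslate (D k') c.
  by rewrite -(line_tile tow Hc); apply: (tile_eq tow); rewrite (line_tile tow Hc).
rewrite (nrm_copy e') (nrm_copy e).
have H0cc : H0 k' (c * c'^-1)%g.
  apply: (subgroupM (line_step tow k')) => //; apply: (subgroupV (line_step tow k')).
  exact: line_dec.
have e'' : tl k' (h' * c'^-1)%g = rtranslate (D k') (c * c'^-1)%g.
  rewrite -(line_tile tow H0cc); apply: (tile_eq tow); rewrite (line_tile tow H0cc).
  by move: hc; rewrite !rtranslateP invMg invgK !mulgA mulgKV.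
by rewrite (nrm_copy e'') invMg invgK !mulgA mulgKV.
Qed.

Lemma red_line_D k h : H h -> H (red k h) /\ red k h \in D k.
Proof. by move=> Hh; rewrite red_line //; exact: nrm_line. Qed.

Lemma red_line_step k c : H0 k c -> red k c = 1%g.
Proof.
move=> Hc; rewrite red_line ?(nrm_copy (line_tile tow Hc)) ?mulgV //.
exact: (line_sub tow Hc).
Qed.

End Reduction.

(** * Densities in cells *)

Section Density.
Variables (R : realType) (G : groupType) (H : set G) (tl : nat -> G -> {fset G}).
Variable (H0 : nat -> set G).
Hypotheses (tf : torsion_free G) (tow : tower R H tl H0).

Local Notation D k := (tl k 1%g).
Local Notation red := (red tow).
Local Notation cell := (cell tow).

Lemma infinite_group : infinite_set [set: G].
Proof.
have [_ Hinf] := line_cyclic tow; apply: contra_not Hinf.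
by apply: sub_finite_set.
Qed.

Lemma large_fset (M : nat) : exists K : {fset G}, (M <= #|` K|)%N.
Proof.
by have [K _ KM] := infinite_set_fset M infinite_group; exists K.
Qed.

Lemma Finv_core (K F : {fset G}) (delta : R) : Finv K delta F ->
  (1 - #|` K|%:R * delta) * #|` F|%:R <=
    #|` [fset s in F | all (fun t => (t * s)%g \in F) K]%fset|%:R.
Proof.
move=> inv; pose U t := [fset s in F | (t * s)%g \notin F]%fset.
have c := card_filterC F (fun s => all (fun t => (t * s)%g \in F) K).
have sub : ([fset s in F | ~~ all (fun t => (t * s)%g \in F) K] `<=` \bigcup_(t <- K) U t)%fset.
  apply/fsubsetP => s; rewrite !inE /= => /andP[sF /allPn[t tK tsF]].
  by apply/bigfcupP; exists t; rewrite ?tK // !inE /= sF.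
have le : #|` [fset s in F | ~~ all (fun t => (t * s)%g \in F) K]%fset|%:R <=
    #|` K|%:R * delta * #|` F|%:R.
  apply: (@le_trans _ _ (\sum_(t <- K) #|` U t|)%:R).
    rewrite ler_nat; apply: leq_trans (fsubset_leq_card sub) _.
    exact: card_bigfcup_le.
  rewrite natr_sum -mulrA; apply: le_trans (_ : \sum_(t <- K) delta * #|` F|%:R <= _).
    by rewrite big_seq [leRHS]big_seq; apply: ler_sum => t tK; exact: inv.
  by rewrite big_const_seq count_predT iter_addr_0 mulr_natl.
rewrite mulrBl mul1r lerBlDr -{1}c natrD lerD2l; exact: le.
Qed.

(** A cell that is invariant enough under [K] contains a translate of [K]. *)
Lemma cell_large (M : nat) : exists n0, forall n, (n0 <= n)%N -> forall t, (M <= #|` cell n t|)%N.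
Proof.
have [K KM] := large_fset M.
have [n0 n0P] := cell_Folner tow K (ltac:(by rewrite invr_gt0 ltr0Sn) : 0 < #|` K|.+1%:R^-1 :> R).
exists n0 => n le t; have := Finv_core (n0P n le t).
have lt1 : #|` K|%:R / #|` K|.+1%:R < 1 :> R.
  by rewrite ltr_pdivrMr ?ltr0Sn // mul1r ltr_nat.
have c0 : 0 < #|` cell n t|%:R :> R.
  by rewrite ltr0n cardfs_gt0; apply/fset0Pn; exists t; exact: cell_refl.
move=> /(lt_le_trans (mulr_gt0 _ c0)); rewrite subr_gt0 => /(_ lt1).
rewrite ltr0n cardfs_gt0 => /fset0Pn[s]; rewrite !inE /= => /andP[_ /allP sK].
apply: leq_trans KM _; rewrite -(card_rtranslate K s); apply: fsubset_leq_card; apply/fsubsetP => x.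
by rewrite rtranslateP => /sK; rewrite mulgKV.
Qed.

Lemma sum_cells n (S : pred G) (F : {fset G}) (d : R) :
  (forall t, t \in F -> (cell n t `<=` F)%fset) ->
  (forall t, #|` [fset s in cell n t | S s]%fset|%:R <= d * #|` cell n t|%:R) ->
  #|` [fset s in F | S s]%fset|%:R <= d * #|` F|%:R.
Proof.
move: {2}#|` F| (leqnn #|` F|) => m; elim: m F => [|m IH] F.
  rewrite leqn0 => /eqP/cardfs0_eq -> _ _.
  rewrite [X in #|` X|](_ : _ = fset0) ?cardfs0 ?mulr0 //.
  by apply/fsetP => x; rewrite !inE.
have [->|[t tF]] := fset_0Vmem F.
  move=> _ _ _; rewrite [X in #|` X|](_ : _ = fset0) ?cardfs0 ?mulr0 //.
  by apply/fsetP => x; rewrite !inE.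
move=> Fm sat dens; have sub := sat t tF.
pose F' := (F `\` cell n t)%fset.
have cF : #|` F| = (#|` cell n t| + #|` F'|)%N.
  by rewrite -(cardfsID (cell n t) F) (fsetIidPr sub).
have c0 : (0 < #|` cell n t|)%N.
  by rewrite cardfs_gt0; apply/fset0Pn; exists t; exact: cell_refl.
have F'm : (#|` F'| <= m)%N by rewrite -ltnS; apply: leq_trans Fm; rewrite cF -addn1 addnC leq_add2r.
have sat' u : u \in F' -> (cell n u `<=` F')%fset.
  rewrite inE => /andP[ut uF]; apply/fsubsetP => x xu.
  rewrite inE (fsubsetP (sat u uF)) // andbT; apply: contra ut => xt.
  by rewrite -(cell_eq tf xt) (cell_eq tf xu) cell_refl.
have := IH F' F'm sat' dens; have := dens t.
have -> : [fset s in F | S s]%fset = ([fset s in cell n t | S s] `|` [fset s in F' | S s])%fset.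
  apply/fsetP => x; rewrite !inE /= -andb_orl; congr (_ && _).
  by case: (boolP (x \in cell n t)) => //= xt; rewrite (fsubsetP sub).
move=> le1 le2; rewrite cF natrD mulrDr; apply: le_trans (lerD le1 le2).
by rewrite -natrD ler_nat -cardfsUI leq_addr.
Qed.

(** Cells contained in the translated window are averaged. All other points lie outside its core for
    [Q], a set containing the differences within a cell, and the choice of [delta] makes them at
    most a fraction [d]. The invariance required does not depend on [S]. *)
Lemma cell_density n (d : R) : 0 < d -> exists K (delta : R), 0 < delta /\
  forall (S : pred G) F, Finv K delta F ->
    (forall t, #|` [fset s in cell n t | S s]%fset|%:R <= d * #|` cell n t|%:R) ->
    forall g, #|` [fset t in F | S (t * g)%g]%fset|%:R <= (2 * d) * #|` F|%:R.
Proof.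
move=> d0; have [Q QP] := cell_bounded tow n.
pose delta := d / #|` Q|.+1%:R.
exists Q, delta; split; first by rewrite divr_gt0.
move=> S F inv dens g; pose Fg := rtranslate F g.
have invg : Finv Q delta Fg by exact: Finv_rtranslate.
have -> : #|` [fset t in F | S (t * g)%g]%fset| = #|` [fset t in Fg | S t]%fset|.
  rewrite -(card_rtranslate _ g); apply: (congr1 (fun T : {fset G} => #|` T|)).
  by apply/fsetP => x; rewrite rtranslateP !inE /= rtranslateP mulgKV.
rewrite -(card_rtranslate F g) -/Fg.
pose F' := [fset t in Fg | (cell n t `<=` Fg)%fset]%fset.
have dF' : #|` [fset s in F' | S s]%fset|%:R <= d * #|` Fg|%:R.
  apply: (@le_trans _ _ (d * #|` F'|%:R)).
    apply: (@sum_cells n) => // t; rewrite !inE /= => /andP[tF tc].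
    apply/fsubsetP => x xt; rewrite !inE /= (fsubsetP tc) //=.
    by rewrite (cell_eq tf xt).
  rewrite ler_pM2l // ler_nat; apply: fsubset_leq_card.
  by apply/fsubsetP => x; rewrite !inE /= => /andP[].
have core := Finv_core invg.
pose C := [fset s in Fg | all (fun t => (t * s)%g \in Fg) Q]%fset.
have CF' : (C `<=` F')%fset.
  apply/fsubsetP => x; rewrite !inE /= => /andP[-> /allP xQ] /=.
  by apply/fsubsetP => u /QP /xQ; rewrite mulgKV.
have sub : ([fset t in Fg | S t] `<=` [fset s in F' | S s] `|` (Fg `\` C))%fset.
  apply/fsubsetP => x xFS; have /andP[xF xS] : (x \in Fg) && S x by move: xFS; rewrite !inE.
  apply/fsetUP; have [xC|xC] := boolP (x \in C); [left|right].
    by have := fsubsetP CF' x xC; rewrite !inE /= xS andbT.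
  by rewrite in_fsetD xC.
apply: (@le_trans _ _ (#|` [fset s in F' | S s]%fset|%:R + #|` (Fg `\` C)%fset|%:R)).
  rewrite -natrD ler_nat; apply: leq_trans (fsubset_leq_card sub) _.
  by rewrite -cardfsUI leq_addr.
have -> : 2 * d = d + d by rewrite mulr_natl mulr2n.
rewrite mulrDl; apply: lerD => //.
have Csub : (C `<=` Fg)%fset by apply/fsubsetP => x; rewrite !inE /= => /andP[].
rewrite cardfsDS // natrB ?fsubset_leq_card // lerBlDr.
apply: le_trans (_ : d * #|` Fg|%:R + (1 - #|` Q|%:R * delta) * #|` Fg|%:R <= _); last first.
  by rewrite lerD2l.
rewrite -mulrDl ler_peMl // addrCA lerDl subr_ge0 /delta mulrCA ger_pMr //.
by rewrite ler_pdivrMr ?ltr0Sn // mul1r ler_nat.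
Qed.

End Density.

Lemma leq_cardfs_inj (T : choiceType) (B C : {fset T}) (f : T -> T) :
  (forall x, x \in B -> f x \in C) ->
  (forall x y, x \in B -> y \in B -> f x = f y -> x = y) -> (#|` B| <= #|` C|)%N.
Proof.
move=> BC inj; rewrite -(size_map f); apply: uniq_leq_size.
  by rewrite map_inj_in_uniq ?fset_uniq.
by move=> y /mapP[x xB ->]; exact: BC.
Qed.

(** * Copies of a prototype away from the line *)

Section Designate.
Variables (R : realType) (G : groupType) (H : set G) (tl : nat -> G -> {fset G}).
Variable (H0 : nat -> set G).
Hypotheses (tf : torsion_free G) (tow : tower R H tl H0).

Local Notation D k := (tl k 1%g).
Local Notation red := (red tow).
Local Notation cell := (cell tow).

Lemma mem_D k t : (t \in D k) = (t \in cell k 1%g).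
Proof. by rewrite mem_cell (red_D tf tow (D1 tow k)) invg1 !mulg1. Qed.

Lemma cell_D k n t : (k <= n)%N -> t \in D n -> (cell k t `<=` D n)%fset.
Proof.
move=> kn tD; apply/fsubsetP => x /(fsubsetP (cell_mono tf tow t kn)).
by move: tD; rewrite !mem_D => /(cell_eq tf) ->.
Qed.

Lemma card_D_large (M : nat) : exists n0, forall n, (n0 <= n)%N -> (M <= #|` D n|)%N.
Proof.
have [n0 n0P] := cell_large tow M; exists n0 => n le.
have := n0P n le 1%g; rewrite card_cell (red_D tf tow (D1 tow n)).
exact.
Qed.

Lemma Finv_D K (delta : R) : 0 < delta -> exists n0, forall n, (n0 <= n)%N -> Finv K delta (D n).
Proof.
by move=> d0; have [n0 n0P] := tile_Folner tow K d0; exists n0 => n le; exact: n0P.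
Qed.

Lemma invariant_sets_tower : invariant_sets R G.
Proof.
move=> K d d0; have [n0 n0P] := Finv_D K d0.
by exists (D n0); [exact: (D_neq0 tow) | exact: n0P].
Qed.

Definition meets l v := `[< exists2 h, H h & h \in cell l v >].

Lemma meets_lineP l v : reflect (exists2 h, H h & h \in cell l v) (meets l v).
Proof. exact: asboolP. Qed.

Lemma meets_cell l u v : u \in cell l v -> meets l u = meets l v.
Proof. by move=> uv; rewrite /meets (cell_eq tf uv). Qed.

Lemma card_mulfs (F S : {fset G}) : (#|` mulfs F S| <= #|` F| * #|` S|)%N.
Proof.
have -> : mulfs F S = (\bigcup_(f <- F) [fset (f * s)%g | s in S])%fset.
  apply/fsetP => x; apply/mulfsP/bigfcupP => [[f [s [fF sS ->]]]|[f /andP[fF _] /imfsetP[s /= sS ->]]].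
    by exists f; rewrite ?fF //; apply/imfsetP; exists s.
  by exists f, s.
apply: leq_trans (card_bigfcup_le _ _) _.
rewrite -sum1_size big_distrl /=; apply: leq_sum => f _.
by rewrite mul1n card_imfset //=; exact: mulgI.
Qed.

(** Every cell of level [l] meeting [H] is a copy [D l c] with [c] in [H], so there are at most as
    many of them in [D n] as points of [H]. *)
Lemma card_meets l n : (l <= n)%N ->
  (#|` [fset v in D n | meets l v]%fset| <= #|` D l| * #|` [fset h in D n | h \in H]%fset|)%N.
Proof.
move=> ln; apply: leq_trans (card_mulfs _ _); apply: fsubset_leq_card.
apply/fsubsetP => v; rewrite !inE /= => /andP[vD /meets_lineP[h Hh hv]].
have [Hr rD] := red_line_D tf tow l Hh; pose c := ((red l h)^-1 * h)%g.
have rc : red l c = 1%g by exact: copy_ex.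
have hc : h \in cell l c by rewrite cell_copy // rtranslateP invMg invgK mulVKg.
have vc : v \in cell l c by rewrite -(cell_eq tf hc) (cell_eq tf hv) cell_refl.
apply/mulfsP; exists (v * c^-1)%g, c; rewrite mulgKV; split => //.
  by rewrite -rtranslateP -(cell_copy rc).
have Hc : H c.
  by have HG := line_subgroup tow; apply: subgroupM => //; exact: subgroupV.
rewrite !inE /= mem_set // andbT; apply: (fsubsetP (cell_D ln vD)).
by rewrite (cell_sym tf).
Qed.

(** By syndeticity at least [#|D n| / (2 k)] copies of [D l] have their base point in [D n]. Those
    meeting [H] are disjoint and so at most [#|D n| / (4 k)] in number, by thinness of the line.
    What remains exceeds [#|W|] once [D n] is large. *)
Lemma designate l (W : finType) : exists n0, forall n, (n0 <= n)%N ->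
  exists des : W -> G, [/\ injective des, forall w, des w \in D n,
    forall w, red l (des w) = 1%g & forall w, ~~ meets l (des w)].
Proof.
have [K KP] := copy_recur tf tow l.
pose k := #|` K|.+1.
have k0 : 0 < k%:R :> R by rewrite ltr0Sn.
have [n1 n1P] := Finv_D K (ltac:(by rewrite divr_gt0) : 0 < 1 / 2 / k%:R :> R).
have [n2 n2P] := line_thin tow (ltac:(by rewrite divr_gt0) : 0 < 1 / 4 / k%:R :> R).
have [n3 n3P] := card_D_large (#|W| * (4 * k)).
exists (maxn (maxn n1 n2) (maxn n3 l)) => n; rewrite !geq_max => /andP[/andP[le1 le2] /andP[le3 ln]].
pose C := [fset g in D n | red l g == 1%g]%fset.
pose CH := [fset g in C | meets l g]%fset.
pose C' := [fset g in C | ~~ meets l g]%fset.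
have cC : (#|` CH| + #|` C'| = #|` C|)%N by exact: card_filterC.
have hC : (#|` CH| <= #|` [fset h in D n | h \in H]%fset|)%N.
  have /choice[f fP] g : exists h, meets l g -> H h /\ h \in cell l g.
    by have [/meets_lineP[h Hh hg]|_] := boolP (meets l g); [exists h | exists 1%g].
  apply: (leq_cardfs_inj (f := f)) => [g|g g'].
    rewrite !inE /= => /andP[/andP[gD _] /fP[Hfg fg]].
    by rewrite mem_set // andbT; apply: (fsubsetP (cell_D ln gD)).
  rewrite !inE /= => /andP[/andP[gD /eqP rg] /fP[_ fg]].
  move=> /andP[/andP[g'D /eqP rg'] /fP[_ fg']] e.
  apply: (rtranslate_inj tf (D_neq0 tow l)).
  by rewrite -!(cell_copy (tow := tow)) // -(cell_eq tf fg) e (cell_eq tf fg').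
have core := Finv_core (n1P n le1).
have half : #|` D n|%:R / 2 <= k%:R * #|` C|%:R :> R.
  apply: (@le_trans _ _ ((1 - #|` K|%:R * (1 / 2 / k%:R)) * #|` D n|%:R)).
    rewrite mulrC; apply: ler_wpM2r => //.
    have : #|` K|%:R / k%:R <= 1 :> R by rewrite ler_pdivrMr // mul1r ler_nat.
    by rewrite mulrCA; lra.
  apply: le_trans core _; rewrite -natrM ler_nat.
  apply: leq_trans (_ : #|` mulfs (invfs K) C| <= _)%N; last first.
    apply: leq_trans (card_mulfs _ _) _; rewrite leq_mul2r; apply/orP; right.
    by apply: leq_trans (leq_imfset_card _ _ _) _.
  apply: fsubset_leq_card; apply/fsubsetP => t; rewrite !inE /= => /andP[tD /allP tK].
  have [g eg gt] := KP t; apply/mulfsP; exists ((g * t^-1)^-1)%g, g; split.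
  - by rewrite invfsP invgK.
  - by rewrite !inE /= eg eqxx andbT; have := tK _ gt; rewrite mulgKV.
  - by rewrite invMg invgK mulgKV.
have big : (#|W| <= #|` C'|)%N.
  have thin := n2P n le2; have large := n3P n le3.
  have hC' : #|` CH|%:R <= 1 / 4 / k%:R * #|` D n|%:R :> R.
    by apply: le_trans thin; rewrite ler_nat.
  have hCk : k%:R * #|` CH|%:R <= #|` D n|%:R / 4 :> R.
    apply: le_trans (ler_wpM2l (ltW k0) hC') _.
    by rewrite mulrA mulrCA divff ?gt_eqF // mulr1 mul1r mulrC.
  have hl : #|W|%:R * (4 * k%:R) <= #|` D n|%:R :> R.
    by rewrite -!natrM ler_nat.
  rewrite -(ler_nat R) -(ler_pM2l k0).
  move: half; rewrite -cC natrD mulrDr; move: hCk hl.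
  set x := k%:R * _; set y := #|` D n|%:R; set z := k%:R * _; lra.
pose des (w : W) := nth 1%g C' (enum_rank w).
have dC w : des w \in C'.
  by apply: mem_nth; apply: leq_trans (ltn_ord _) big.
exists des; split.
- move=> w w' /eqP; rewrite nth_uniq ?fset_uniq ?(leq_trans (ltn_ord _) big) // => /eqP.
  by move=> e; apply: enum_rank_inj; apply: val_inj.
- by move=> w; have := dC w; rewrite !inE /= => /andP[/andP[]].
- by move=> w; have := dC w; rewrite !inE /= => /andP[/andP[_ /eqP]].
- by move=> w; have := dC w; rewrite !inE /= => /andP[].
Qed.

End Designate.

(** * One stage of the construction *)

Section Stage.
Variables (R : realType) (G : groupType) (H : set G) (tl : nat -> G -> {fset G}).
Variable (H0 : nat -> set G).
Hypotheses (tf : torsion_free G) (tow : tower R H tl H0).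
Variables (A : finType) (a0 : A) (lambda : R).

Local Notation D k := (tl k 1%g).
Local Notation red := (red tow).
Local Notation cell := (cell tow).
Local Notation entropy := (entropy R).

(** Data depending on the position in the prototypes alone are repeated in every copy; moreover this
    property passes to higher levels. *)
Definition det (X : Type) k (phi : G -> X) := forall t u, red k t = red k u -> phi t = phi u.

Lemma det_mono (X : Type) k n (phi : G -> X) : (k <= n)%N -> det k phi -> det n phi.
Proof.
move=> /subnKC kn dk t u e; apply: dk.
by rewrite (red_add tf tow k (n - k) t) (red_add tf tow k (n - k) u) kn e.
Qed.

Definition configs (E : pred G) (b : G -> A) : set (G -> A) :=
  [set y | forall t, ~~ E t -> y t = b t].

Lemma configs_neq0 E b : configs E b !=set0.
Proof. by exists b. Qed.

Lemma sub_configs (E E' : pred G) b b' :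
  (forall t, E' t -> E t) -> (forall t, ~~ E t -> b' t = b t) ->
  configs E' b' `<=` configs E b.
Proof. by move=> EE bb y Yy t nE; rewrite -bb // Yy //; apply: contra nE => /EE. Qed.

(** Strictness on both sides is what the next stage spends: above, to write patterns; below, to be
    sure that freezing reaches [lambda]. *)
Record state (k : nat) (E : pred G) (b : G -> A) : Prop := State {
  state_detE : det k E;
  state_detb : det k b;
  state_gt : lambda < entropy (configs E b);
  state_base : entropy [set b] < lambda }.

Lemma state_mono k n E b : (k <= n)%N -> state k E b -> state n E b.
Proof.
by move=> kn [dE db gt bs]; split => //; exact: det_mono kn _.
Qed.

Lemma near_of_density n (d e : R) (S : pred G) (Y Y' : set (G -> A)) : 0 < d -> 2 * d <= e ->
  (forall t, #|` [fset s in cell n t | S s]%fset|%:R <= d * #|` cell n t|%:R) ->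
  (forall y, Y y -> exists2 y', Y' y' & forall t, y t != y' t -> S t) ->
  near_configs e Y Y'.
Proof.
move=> d0 de dens YY'; have [K [delta [dl0 KP]]] := cell_density tf tow n d0.
exists K, delta; split => // F inv _ [y Yy [g ->]].
have [y' Yy' yy'] := YY' y Yy; exists (shift g y').
  by exists y' => //; exists g.
apply: (@le_trans _ _ (2 * d * #|` F|%:R)); last exact: ler_wpM2r.
apply: le_trans (KP S F inv dens g); rewrite ler_nat; apply: fsubset_leq_card.
by apply/fsubsetP => t; rewrite !inE /= => /andP[-> /yy'].
Qed.

Lemma cell_in_D n (P : pred G) t : (forall u, P u -> red n u \in D n) ->
  #|` [fset s in cell n t | P s]%fset|%:R > 0 :> R -> red n t \in D n.
Proof.
move=> PD; rewrite ltr0n cardfs_gt0 => /fset0Pn[s]; rewrite !inE /= => /andP[st /PD].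
move=> sD; have ts : t \in cell n s by rewrite (cell_sym tf).
by rewrite (cell_red tf ts); move: ts; rewrite mem_cell (D_tile tow sD).
Qed.

(* A condition on the position inside the prototype has the same density in
   every copy and does not occur outside the copies. *)
Lemma density_copies n (d : R) (P : pred G) : 0 <= d ->
  #|` [fset v in D n | P v]%fset|%:R <= d * #|` D n|%:R ->
  forall t, #|` [fset s in cell n t | (red n s \in D n) && P (red n s)]%fset|%:R <=
    d * #|` cell n t|%:R.
Proof.
move=> d0 dens t; set X := [fset s in _ | _]%fset.
have [->|[s0 s0X]] := fset_0Vmem X; first by rewrite cardfs0 mulr_ge0.
have tD : red n t \in D n.
  apply: (cell_in_D (P := fun s => (red n s \in D n) && P (red n s))) => [u /andP[] //|].
  by rewrite ltr0n cardfs_gt0; apply/fset0Pn; exists s0.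
rewrite card_cell (D_tile tow tD); apply: le_trans dens; rewrite ler_nat.
apply: (leq_cardfs_inj (f := red n)) => [s|s s'].
  by rewrite !inE /= => /andP[_ /andP[-> ->]].
rewrite !inE /= => /andP[st _] /andP[s't _].
by rewrite (cell_red tf st) (cell_red tf s't) => /mulIg /mulIg.
Qed.

Lemma stage k l E b (eps : R) : (k <= l)%N -> state k E b -> 0 < eps ->
  exists n E' b', (l < n)%N /\ [/\ state n E' b',
    forall t, E' t -> E t,
    forall t, ~~ E t -> b' t = b t,
    entropy (configs E' b') <= lambda + eps &
    (forall t, meets tow l t -> E t -> E' t) /\
    forall p, configs E b p -> exists2 g, (forall s, s \in D l -> (s * g)%g \in D n) &
      forall y gam s, configs E' b' y -> red n gam = 1%g -> s \in D l ->
        y (s * g * gam)%g = p s].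
Proof.
move=> kl /(state_mono kl)[dE db hgt hbs] eps0.
have inv := invariant_sets_tower tow.
set h := entropy (configs E b) in hgt; set hb := entropy [set b] in hbs.
(* Writing the patterns may cost [eta] and must keep the entropy above [lambda]. The base loses
   [eta] to the writing and [eta] more to the positions kept free, and both together must stay below
   [lambda - hb]. *)
pose eta := Num.min (Num.min (h - lambda) (lambda - hb)) eps / 3.
have eta0 : 0 < eta by rewrite divr_gt0 // !lt_min !subr_gt0 hgt hbs.
have [eta1 eta2 eta3] : [/\ eta < h - lambda, 2 * eta < lambda - hb & eta <= eps].
  rewrite /eta; set m := Num.min _ eps.
  have m0 : 0 < m by rewrite !lt_min !subr_gt0 hgt hbs.
  have m1 : m <= h - lambda by rewrite !ge_min lexx.
  have m2 : m <= lambda - hb by rewrite !ge_min lexx orbT.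
  have m3 : m <= eps by rewrite !ge_min lexx orbT.
  by split; lra.
have [e e0 near] := entropy_near a0 inv eta0.
pose d := e / 2; have d0 : 0 < d by rewrite divr_gt0.
have de : 2 * d <= e by rewrite /d mulrCA divff ?mulr1.
pose W : finType := {ffun D l -> A}.
have [n1 n1P] := designate tf tow l W.
pose M := Num.bound ((#|W| * #|` D l|)%:R / d).
have [n2 n2P] := card_D_large tf tow M.
pose cl : R := #|` D l|%:R; have cl0 : 0 < cl by rewrite ltr0n cardfs_gt0 (D_neq0 tow).
have [n3 n3P] := line_thin tow (ltac:(by rewrite divr_gt0) : 0 < d / cl).
have [n4 n4P] := cell_large tow (Num.bound (d^-1)).
pose n := maxn (maxn n1 n2) (maxn (maxn n3 n4) l.+1).
have [le1 le2 le3 le4 ln] : [/\ n1 <= n, n2 <= n, n3 <= n, n4 <= n & l < n]%N.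
  by rewrite /n !leq_max !leqnn ?orbT.
have ln' := ltnW ln.
have [des [des_inj desD des1 desH]] := n1P n le1.
(* One designated copy of [D l] is reserved for every function on [D l], allowed or not. *)
pose kill v := [exists w : W, v \in cell l (des w)].
pose val_at v := if [pick w : W | v \in cell l (des w)] is Some w
  then (if insub (red l v) is Some s then w s else a0) else a0.
pose K t := (red n t \in D n) && kill (red n t).
pose E1 t := E t && ~~ K t.
(* Overwriting the free positions suffices: at the others an allowed pattern agrees with [b], and
   [b] repeats its values in every copy. *)
pose b1 t := if E t && K t then val_at (red n t) else b t.
have des_cell v w w' : v \in cell l (des w) -> v \in cell l (des w') -> w = w'.
  move=> vw vw'; apply: des_inj; apply: (rtranslate_inj tf (D_neq0 tow l)).
  by rewrite -!(cell_copy (tow := tow)) // -(cell_eq tf vw) (cell_eq tf vw').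
have dens_kill : forall t, #|` [fset s in cell n t | K s]%fset|%:R <= d * #|` cell n t|%:R.
  apply: density_copies; first exact: ltW.
  have sub : ([fset v in D n | kill v] `<=` \bigcup_(w <- enum W) cell l (des w))%fset.
    apply/fsubsetP => v; rewrite !inE /= => /andP[_ /existsP[w vw]].
    by apply/bigfcupP; exists w; rewrite ?mem_enum.
  apply: (@le_trans _ _ (#|W| * #|` D l|)%:R).
    rewrite ler_nat; apply: leq_trans (fsubset_leq_card sub) _.
    apply: leq_trans (card_bigfcup_le _ _) _.
    under eq_bigr => w _ do rewrite (cell_copy (des1 w)) card_rtranslate.
    by rewrite big_const_seq count_predT iter_addn_0 -cardE mulnC.
  rewrite -ler_pdivrMl // mulrC; apply: ltW.
  apply: lt_le_trans (_ : M%:R <= _); last by rewrite ler_nat; exact: n2P.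
  by apply: archi_boundP; rewrite divr_ge0 // ltW.
have det_red (X : Type) (phi : G -> X) : det n (fun t => phi (red n t)).
  by move=> t u ->.
have dEn := det_mono ln' dE; have dbn := det_mono ln' db.
have dE1 : det n E1 by move=> t u e'; rewrite /E1 /K (dEn _ _ e') e'.
have db1 : det n b1 by move=> t u e'; rewrite /b1 /K (dEn _ _ e') e' (dbn _ _ e').
(* An enumeration of each tile. A cell contains a given rank at most once, so freezing a single rank
   in all cells is a change of small density. *)
pose rank t := index (red n t) (tl n (red n t)).
pose prot t := (red n t \in D n) && meets tow l (red n t).
have dens_prot : forall t, #|` [fset s in cell n t | prot s]%fset|%:R <= d * #|` cell n t|%:R.
  apply: density_copies; first exact: ltW.
  apply: (@le_trans _ _ (#|` D l| * #|` [fset h in D n | h \in H]%fset|)%:R).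
    by rewrite ler_nat; exact: card_meets.
  rewrite natrM -/cl mulrC -ler_pdivlMr // mulrAC; exact: n3P.
have dens_rank kap : forall t, #|` [fset s in cell n t | rank s == kap]%fset|%:R <= d * #|` cell n t|%:R.
  move=> t; apply: (@le_trans _ _ 1).
    rewrite (_ : 1 = 1%N%:R) // ler_nat; set X := [fset s in _ | _]%fset.
    have [->|[s0 s0X]] := fset_0Vmem X; first by rewrite cardfs0.
    suff -> : X = [fset s0]%fset by rewrite cardfs1.
    apply/fsetP => s; rewrite in_fset1; apply/idP/eqP => [sX|-> //].
    move: sX s0X; rewrite !inE /= => /andP[st /eqP rs] /andP[s0t /eqP rs0].
    have tls u : u \in cell n t -> red n u \in tl n (red n t) /\ tl n (red n u) = tl n (red n t).
      move=> ut; have := ut; rewrite mem_cell -(cell_red tf ut) => mem.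
      by split => //; exact: (tile_eq tow).
    have [ms es] := tls s st; have [ms0 es0] := tls s0 s0t.
    have : red n s = red n s0.
      have i1 : index (red n s) (tl n (red n t)) = kap by rewrite -es.
      have i2 : index (red n s0) (tl n (red n t)) = kap by rewrite -es0.
      by rewrite -(nth_index 1%g ms) -(nth_index 1%g ms0) i1 i2.
    by rewrite (cell_red tf st) (cell_red tf s0t) => /mulIg /mulIg.
  rewrite mulrC -ler_pdivrMr // div1r; apply: ltW.
  apply: lt_le_trans (_ : (Num.bound d^-1)%:R <= _); last by rewrite ler_nat; exact: n4P.
  by apply: archi_boundP; rewrite invr_ge0 ltW.
have [Q QP] := cell_bounded tow n.
have rank_lt t : (rank t < #|` Q|)%N.
  have : (#|` tl n (red n t)| <= #|` Q|)%N.
    rewrite -(card_cell tow n t); apply: (leq_trans (n := #|` rtranslate (cell n t) t^-1%g|)).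
      by rewrite card_rtranslate.
    apply: fsubset_leq_card; apply/fsubsetP => x; rewrite rtranslateP invgK => /QP.
    by rewrite mulgK.
  by apply: leq_trans; rewrite index_mem; exact: (tile_refl tow).
(* Ranks below [kap] are frozen, except in the protected cells along the line; from [kap = #|Q|] on
   only those cells can be free. *)
pose Ek kap t := E1 t && (prot t || (kap <= rank t)%N).
have dEk kap : det n (Ek kap).
  by move=> t u e'; rewrite /Ek (dE1 _ _ e') /prot /rank e'.
pose hk kap := entropy (configs (Ek kap) b1).
have h0 : lambda < hk 0%N.
  have : h <= hk 0%N + eta; last by lra.
  apply: near; [exact: configs_neq0 | exact: configs_neq0 |].
  apply: (near_of_density d0 de dens_kill) => y Yy.
  exists (fun t => if K t then b1 t else y t) => [t|t].
    rewrite /Ek orbT andbT /E1 negb_and negbK; case: ifP => // Kt; rewrite orbF => nE.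
    by rewrite Yy // /b1 (negbTE nE).
  by case: ifP => //; rewrite eqxx.
have hb1 : entropy [set b1] <= hb + eta.
  apply: near; [by exists b1 | by exists b |].
  apply: (near_of_density d0 de dens_kill) => _ ->; exists b => // t.
  by rewrite /b1; case: (K t); rewrite ?andbF ?eqxx.
have hQ : hk #|` Q| <= lambda.
  have : hk #|` Q| <= entropy [set b1] + eta; last by lra.
  apply: near; [exact: configs_neq0 | by exists b1 |].
  apply: (near_of_density d0 de dens_prot) => y Yy; exists b1 => // t.
  apply: contraR => np; rewrite Yy ?eqxx // /Ek (negbTE np) /= negb_and -ltnNge rank_lt orbT //.
(* The first [kap] at which the entropy is at most [lambda]. The rank before it leaves the entropy
   above [lambda], and by no more than the effect of one rank. *)
have [kap kapP kmin] := ex_minnP (ex_intro (fun kap => hk kap <= lambda) _ hQ).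
have kap0 : (0 < kap)%N by rewrite lt0n; apply: contraTN kapP => /eqP ->; rewrite -ltNge.
pose kp := kap.-1; have kpS : kp.+1 = kap by rewrite /kp prednK.
have hkp : lambda < hk kp.
  by rewrite ltNge; apply/negP => /kmin; rewrite -kpS ltnn.
exists n, (Ek kp), b1; split => //; split.
- by split => //; lra.
- by move=> t /andP[/andP[]].
- by move=> t /negbTE nE; rewrite /b1 nE.
- have : hk kp <= hk kap + eta; last by rewrite -/(hk kp); move: kapP; lra.
  apply: near; [exact: configs_neq0 | exact: configs_neq0 |].
  apply: (near_of_density d0 de (dens_rank kp)) => y Yy.
  exists (fun t => if rank t == kp then b1 t else y t) => [t|t].
    case: ifP => // /negbT rt nE; apply: Yy; apply: contra nE => /andP[E1t /orP[pt|le]].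
      by rewrite /Ek E1t pt.
    by rewrite /Ek E1t -kpS ltn_neqAle eq_sym rt le orbT.
  by case: ifP => //; rewrite eqxx.
split.
  move=> t /meets_lineP[u Hu ut] Et.
  have [Hr rD] := red_line_D tf tow n Hu.
  have tu : t \in cell l u by rewrite (cell_sym tf).
  have tn : t \in cell n u by exact: (fsubsetP (cell_mono tf tow u ln')).
  have rt : red n t = (t * u^-1 * red n u)%g by exact: (cell_red tf).
  have rtu : red n t \in cell l (red n u).
    by rewrite mem_cell (red_red tf ln' rD) rt mulgK; rewrite mem_cell in tu.
  have rtD : red n t \in D n by apply: (fsubsetP (cell_D tf tow ln' rD)).
  have mt : meets tow l (red n t).
    by apply/meets_lineP; exists (red n u) => //; rewrite (cell_sym tf).
  rewrite /Ek /prot rtD mt /= andbT /E1 Et /K rtD /=.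
  apply/negP => /existsP[w /(meets_cell tf)]; rewrite mt => /esym.
  by apply/negP; exact: desH.
move=> p Yp; pose w : W := [ffun s : D l => p (fsval s)].
have sgD s : s \in D l -> (s * des w)%g \in cell l (des w).
  by move=> sD; rewrite (cell_copy (des1 w)) rtranslateP mulgK.
exists (des w) => [s sD|y gam s Yy gam1 sD].
  by apply: (fsubsetP (cell_D tf tow ln' (desD w))); exact: sgD.
have sgn : (s * des w)%g \in D n.
  by apply: (fsubsetP (cell_D tf tow ln' (desD w))); exact: sgD.
set t := (s * des w * gam)%g.
have rt : red n t = (s * des w)%g by exact: (red_copy tf).
have rls : red l (s * des w)%g = s by exact: (red_copy tf).
have rlt : red l t = red l s.
  by rewrite -(red_red tf ln') rt // rls (red_D tf tow sD).
have Kt : K t by rewrite /K rt sgn; apply/existsP; exists w; exact: sgD.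
have -> : y t = b1 t by apply: Yy; rewrite /Ek /E1 Kt andbF.
rewrite /b1 Kt andbT rt; case: ifP => [Et|/negbT nE].
  rewrite /val_at; case: pickP => [w' sw'|/(_ w)]; last by rewrite sgD.
  rewrite -(des_cell _ _ _ (sgD s sD) sw') rls insubT ffunE //.
by rewrite (db _ _ rlt) Yp // -(dE _ _ rlt).
Qed.

End Stage.

(** * The limit of the stages *)

Section Limit.
Variables (R : realType) (G : groupType) (H : set G) (tl : nat -> G -> {fset G}).
Variable (H0 : nat -> set G).
Hypotheses (tf : torsion_free G) (tow : tower R H tl H0).
Variables (A : finType) (a0 : A) (lambda : R).
Hypotheses (lambda0 : 0 < lambda) (lambdaA : lambda < ln #|A|%:R).

Local Notation D k := (tl k 1%g).
Local Notation red := (red tow).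
Local Notation cell := (cell tow).
Local Notation entropy := (entropy R).

Let allfree : G -> bool := fun=> true.
Let const0 : G -> A := fun=> a0.

Lemma entropy_full : lambda < entropy (configs allfree const0).
Proof.
apply: lt_le_trans lambdaA _.
apply: lb_le_inf; first by case: (entropy_has_inf R (configs_neq0 allfree const0)).
move=> _ [F F0 <-]; rewrite ler_pdivlMr ?ltr0n ?cardfs_gt0 // mulr_natr.
rewrite -lnXn ?ltr0n; last by apply/card_gt0P; exists a0.
rewrite -natrX; suff -> : npat (configs allfree const0) F = (#|A| ^ #|` F|)%N by [].
rewrite cardfE -card_ffun /npat; apply: eq_card => v; rewrite [RHS]inE; apply/patsP.
pose y t := if insub t is Some u then v u else a0.
exists y; last by move=> t; rewrite /y valK.
by exists y => //; exists 1%g; apply/funext => t; rewrite /shift mulg1.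
Qed.

Lemma entropy_const : entropy [set const0] < lambda.
Proof.
have F0 : [fset 1%g : G]%fset != fset0 by apply/fset0Pn; exists 1%g; rewrite inE.
have := entropy_le R (ex_intro (fun x => [set const0] x) _ erefl) F0.
rewrite cardfs1 mulr1 => le; apply: le_lt_trans le _.
suff -> : npat [set const0] [fset 1%g]%fset = 1%N by rewrite ln1.
apply/eqP; rewrite eqn_leq npat_gt0 ?andbT; last by exists const0.
rewrite /npat -(cards1 [ffun t : [fset (1%g : G)]%fset => a0]); apply: subset_leq_card.
apply/fintype.subsetP => v /patsP[w [y -> [g ->]] vw]; rewrite inE; apply/eqP.
by apply/ffunP => t; rewrite vw ffunE.
Qed.

Lemma in_some_tile (F : {fset G}) : exists k, (F `<=` D k)%fset.
Proof.
have /choice[k kP] := tile_exhaust tow; pose m := \max_(t <- F) k t.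
exists m; apply/fsubsetP => t tF; apply: (fsubsetP (tile_mono tow 1%g _)) (kP t).
by rewrite /m; exact: leq_bigmax_seq.
Qed.

(** There are finitely many patterns on [F]; one occurrence of each in a member of [Y] is collected
    in [W]. *)
Lemma pats_window (Y : set (G -> A)) (F : {fset G}) : exists W : {fset G},
  forall w, orbits Y w -> exists y g, [/\ Y y, eqon F w (shift g y) & forall t, t \in F -> (t * g)%g \in W].
Proof.
have /choice[f fP] (v : {ffun F -> A}) : exists p : (G -> A) * G, v \in pats F (orbits Y) ->
    Y p.1 /\ forall t : F, v t = shift p.2 p.1 (val t).
  have [/patsP[w [y Yy [g ->]] vw]|_] := boolP (v \in pats F (orbits Y)).
    by exists (y, g).
  by exists (fun=> a0, 1%g).
exists (\bigcup_(v <- enum {: {ffun F -> A}}) rtranslate F (f v).2)%fset => w Yw.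
pose v := [ffun t : F => w (val t)]; have vP : v \in pats F (orbits Y) by exact: mem_pats.
have [Yf vf] := fP v vP; exists (f v).1, (f v).2; split => // t tF.
  by have := vf [` tF]%fset; rewrite ffunE.
by apply/bigfcupP; exists v; rewrite ?mem_enum // rtranslateP mulgK.
Qed.

Definition stage_data : Type := (nat * ((G -> bool) * (G -> A)))%type.
Definition lvl (s : stage_data) := s.1.
Definition fre (s : stage_data) := s.2.1.
Definition bas (s : stage_data) := s.2.2.
Definition cfg (s : stage_data) := configs (fre s) (bas s).

Definition stage_step (i l : nat) (s s' : stage_data) := [/\ (lvl s <= l)%N, (l < lvl s')%N,
  (D i `<=` D l)%fset &
  forall w, orbits (cfg s) w -> exists y g,
    [/\ cfg s y, eqon (D i) w (shift g y) & forall t, t \in D i -> (t * g)%g \in D l]] /\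
  [/\ forall t, fre s' t -> fre s t,
      forall t, ~~ fre s t -> bas s' t = bas s t,
      entropy (cfg s') <= lambda + i.+1%:R^-1 &
      (forall t, meets tow l t -> fre s t -> fre s' t) /\
      forall p, cfg s p -> exists2 g, (forall s, s \in D l -> (s * g)%g \in D (lvl s')) &
      forall y gam t, cfg s' y -> red (lvl s') gam = 1%g -> t \in D l ->
        y (t * g * gam)%g = p t].

Lemma stages : exists (s : nat -> stage_data) (l : nat -> nat), s 0%N = (0%N, (allfree, const0)) /\
  (forall i, state tow lambda (lvl (s i)) (fre (s i)) (bas (s i))) /\
  forall i, stage_step i (l i) (s i) (s i.+1).
Proof.
pose st s := state tow lambda (lvl s) (fre s) (bas s).
have /choice[nx nxP] (p : nat * stage_data) : exists s', st p.2 ->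
    st s' /\ exists l, stage_step p.1 l p.2 s'.
  have [sts|no] := pselect (st p.2); last by exists p.2.
  have [W WP] := pats_window (cfg p.2) (D p.1).
  have [k kP] := in_some_tile (W `|` D p.1)%fset.
  have kl : (lvl p.2 <= maxn (lvl p.2) k)%N by exact: leq_maxl.
  have Dk : (D k `<=` D (maxn (lvl p.2) k))%fset by apply: (tile_mono tow); exact: leq_maxr.
  have e0 : 0 < p.1.+1%:R^-1 :> R by rewrite invr_gt0 ltr0Sn.
  have [n [E' [b' [ln [st' EE bb hh [pr rec]]]]]] := stage tf a0 kl sts e0.
  exists (n, (E', b')) => _; split => //; exists (maxn (lvl p.2) k); split; split => //.
  - by apply: fsubset_trans Dk; apply: fsubset_trans kP; exact: fsubsetUr.
  - move=> w /WP[y [g [Yy wy Wt]]]; exists y, g; split => // t tD.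
    by apply: (fsubsetP Dk); apply: (fsubsetP kP); rewrite in_fsetU Wt.
pose s := fix s i := if i is i'.+1 then nx (i', s i') else (0%N, (allfree, const0)) : stage_data.
have st_s i : st (s i).
  elim: i => [|i IH] /=; last by have [] := nxP (i, s i) IH.
  by split => //=; [exact: entropy_full | exact: entropy_const].
have /choice[l lP] i : exists l, stage_step i l (s i) (s i.+1).
  by have [] := nxP (i, s i) (st_s i).
by exists s, l.
Qed.

Lemma meets_mono l n t : (l <= n)%N -> meets tow l t -> meets tow n t.
Proof.
move=> ln /meets_lineP[h Hh ht]; apply/meets_lineP; exists h => //.
exact: (fsubsetP (cell_mono tf tow t ln)).
Qed.

Lemma meets_H l t : H t -> meets tow l t.
Proof. by move=> Ht; apply/meets_lineP; exists t => //; exact: cell_refl. Qed.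

Lemma line_neq1 n : exists2 r, H0 n r & r <> 1%g.
Proof.
apply: contrapT => no; have [_ Hinf] := line_cyclic tow; apply: Hinf.
apply: (@sub_finite_set _ _ [set` D n]); last exact: finite_fset.
move=> h Hh; have [c Hc] := line_cover tow n Hh.
have -> : c = 1%g by apply: contrapT => c1; apply: no; exists c.
by rewrite rtranslateP invg1 mulg1.
Qed.

(** The last three clauses provide minimality, an aperiodic point and the free product. In the last
    one, the blocks [B] at the powers of [r] carry arbitrary letters at their base points and
    contain a copy of [p] on [F]; asking the final equality for every letter [a] keeps that copy
    clear of the base point. *)
Theorem minimal_configs : exists Y : set (G -> A), [/\ Y !=set0,
  entropy Y = lambda,
  (forall p (F : {fset G}), Y p -> exists K : {fset G}, forall y t, Y y ->
    exists2 g, (g * t^-1)%g \in K & forall s, s \in F -> y (s * g)%g = p s),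
  (forall y y', Y y -> (forall t, ~ H t -> y' t = y t) -> Y y') &
  forall p (F : {fset G}), Y p -> exists (B : {fset G}) g r q, [/\ 1%g \in B, r <> 1%g,
    forall a : nat -> A, exists2 y, Y y & forall j s, s \in B ->
      y (s * r ^+ j)%g = if s == 1%g then a j else q s &
    forall s, s \in F -> (s * g)%g \in B /\
      forall a : A, (if (s * g)%g == 1%g then a else q (s * g)%g) = p s]].
Proof.
have [s [l [s0 [st sP]]]] := stages.
have fre_mono i j t : (i <= j)%N -> fre (s j) t -> fre (s i) t.
  move=> /subnKC <-; elim: (j - i)%N => [|d IH]; first by rewrite addn0.
  by rewrite addnS => /(let: conj _ (And4 h _ _ _) := sP (i + d)%N in h).
have bas_mono i j t : (i <= j)%N -> ~~ fre (s i) t -> bas (s j) t = bas (s i) t.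
  move=> /subnKC <- nE; elim: (j - i)%N => [|d IH]; first by rewrite addn0.
  have [_ [_ bb _ _]] := sP (i + d)%N; rewrite addnS bb //.
  by apply: contra nE; apply: fre_mono; exact: leq_addr.
have cfg_mono i j : (i <= j)%N -> cfg (s j) `<=` cfg (s i).
  move=> ij; apply: sub_configs => t; first exact: fre_mono.
  exact: bas_mono.
have lvl_l i : (lvl (s i) <= l i)%N by have [[]] := sP i.
have l_lvl i : (l i < lvl (s i.+1))%N by have [[]] := sP i.
have l_mono i j : (i <= j)%N -> (l i <= l j)%N.
  move=> /subnKC <-; elim: (j - i)%N => [|d IH]; first by rewrite addn0.
  apply: leq_trans IH _; rewrite addnS; apply: leq_trans (lvl_l _); exact: ltnW.
have prot i j t : (i <= j)%N -> meets tow (l i) t -> fre (s i) t -> fre (s j) t.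
  move=> /subnKC <- mt ft; elim: (j - i)%N => [|d IH]; first by rewrite addn0.
  have [_ [_ _ _ [pr _]]] := sP (i + d)%N; rewrite addnS; apply: pr => //.
  by apply: meets_mono mt; apply: l_mono; exact: leq_addr.
pose Y : set (G -> A) := [set y | forall i, cfg (s i) y].
have splice i y0 y : Y y0 ->
    (forall t, (meets tow (l i) t /\ (~~ fre (s i) t -> y t = bas (s i) t)) \/ y t = y0 t) -> Y y.
  move=> Yy0 yP; suff Yj j : (i <= j)%N -> cfg (s j) y.
    by move=> j; have [/Yj//|/ltnW/cfg_mono] := leqP i j; apply; exact: Yj.
  move=> ij t nE; have [[mt yt]|->] := yP t; last exact: Yy0.
  have nEi : ~~ fre (s i) t by apply: contra nE; exact: prot.
  by rewrite yt // (bas_mono _ _ _ ij nEi).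
have [y0 Yy0] : Y !=set0.
  pose y t := if pselect (exists i, ~~ fre (s i) t) is left ex
    then bas (s (projT1 (cid ex))) t else a0.
  exists y => i t nE; rewrite /y; case: pselect => [ex|]; last by case; exists i.
  case: (cid ex) => j /= nEj.
  by have [ij|/ltnW ji] := leqP i j; [rewrite (bas_mono i j) | rewrite (bas_mono j i)].
have HG := line_subgroup tow.
exists Y; split.
- by exists y0.
- have YY i : Y `<=` cfg (s i) by move=> y; apply.
  apply/eqP; rewrite eq_le; apply/andP; split.
    apply/ler_addgt0Pr => e e0.
    pose i := Num.bound (e^-1).
    have [_ [_ _ hi _]] := sP i.
    have le : entropy Y <= entropy (cfg (s i.+1)).
      apply: lb_le_inf; first by case: (entropy_has_inf R (configs_neq0 (fre (s i.+1)) (bas (s i.+1)))).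
      move=> _ [F F0 <-]; apply: le_trans (_ : ln (npat Y F)%:R / #|` F|%:R <= _).
        rewrite ler_pdivlMr ?ltr0n ?cardfs_gt0 //; apply: entropy_le => //; by exists y0.
      apply: ler_wpM2r; first by rewrite invr_ge0.
      rewrite ler_ln ?posrE ?ltr0n ?npat_gt0 ?ler_nat //; [exact: leq_npat|by exists y0|exact: configs_neq0].
    apply: le_trans le _; apply: le_trans hi _; rewrite lerD2l.
    rewrite -[leRHS]invrK lef_pV2 ?posrE ?invr_gt0 //.
    apply: ltW; apply: lt_trans (_ : i%:R < _); last by rewrite ltr_nat.
    by apply: archi_boundP; rewrite invr_ge0 ltW.
  (* For the lower bound, a pattern of stage [i] on a window inside [D i] is found in some
     configuration inside [D (l i)]. This cell contains the identity and so meets [H], and splicing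
     it into [y0] shows that [Y] has the pattern too. *)
  apply: lb_le_inf; first by case: (entropy_has_inf R (ex_intro Y y0 Yy0)).
  move=> _ [F F0 <-]; have [i Fi] := in_some_tile F.
  have hi := state_gt (st i); apply: le_trans (ltW hi) _.
  apply: le_trans (_ : ln (npat (cfg (s i)) F)%:R / #|` F|%:R <= _).
    rewrite ler_pdivlMr ?ltr0n ?cardfs_gt0 //; apply: entropy_le => //; exact: configs_neq0.
  apply: ler_wpM2r; first by rewrite invr_ge0.
  rewrite ler_ln ?posrE ?ltr0n ?npat_gt0 ?ler_nat //; [|exact: configs_neq0|by exists y0].
  have [[_ _ _ win] _] := sP i.
  apply: (leq_pats (r := fun w w' => eqon F w w')) => [w /win[y [g [Yy wy Dt]]]|]; last first.
    by move=> w1 w2 w1' w2' _ _ e1 e2 e t tF; rewrite e1 ?e ?e2.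
  pose y' t := if t \in D (l i) then y t else y0 t.
  exists (shift g y'); last first.
    by move=> t /(fsubsetP Fi) tD; rewrite wy // /shift /y' Dt.
  exists y'; last by exists g.
  apply: (splice i y0) => // t; rewrite /y'; case: ifP => tD; [left|by right].
  split; last exact: Yy.
  apply/meets_lineP; exists 1%g; first exact: (subgroup1 HG).
  by rewrite (cell_sym tf) -(mem_D tf).
- move=> p F Yp; have [i Fi] := in_some_tile F.
  have [[_ _ Dil _] [_ _ _ [_ rec]]] := sP i.
  have [g _ gP] := rec p (Yp i).
  have [K KP] := copy_recur tf tow (lvl (s i.+1)).
  exists [fset (g * k)%g | k in K]%fset => y t Yy; have [gam gam1 gamK] := KP t.
  exists (g * gam)%g; first by rewrite -mulgA; apply/imfsetP; exists (gam * t^-1)%g.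
  move=> u uF; rewrite mulgA; apply: gP => //.
  by apply: (fsubsetP Dil); exact: (fsubsetP Fi).
(* Stage 0 freezes nothing, so the values on [H] are unrestricted. *)
- move=> y y' Yy yy'; apply: (splice 0%N y) => // t.
  have [Ht|/yy'] := pselect (H t); [left|by right].
  by split; [exact: meets_H | rewrite s0].
move=> p F Yp; have [i Fi] := in_some_tile F.
have [[_ _ Dil _] [_ _ _ [_ rec]]] := sP i.
have [g gD gP] := rec p (Yp i).
set n := lvl (s i.+1) in gD gP.
have [r Hr r1] := line_neq1 n.
have rX j : H0 n (r ^+ j)%g.
  elim: j => [|j IH]; first by rewrite expg0; exact: (subgroup1 (line_step tow n)).
  by rewrite expgSr; exact: (subgroupM (line_step tow n)).
have cr j : cell n (r ^+ j)%g = rtranslate (D n) (r ^+ j)%g.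
  by apply: cell_copy; exact: (red_line_step tf).
have free1 j : fre (s j) 1%g.
  apply: (prot 0%N) => //; last by rewrite s0.
  by apply: meets_H; exact: (subgroup1 HG).
have line (a : nat -> A) : exists2 y, Y y & forall j u, u \in D n ->
      y (u * r ^+ j)%g = if u == 1%g then a j else y0 u.
  (* Every copy of [D n] at a power of [r] repeats [y0] on [D n], except that its base point, free
     just as the identity is, receives [a j]. The copies are disjoint because the powers of [r] are
     distinct. *)
  pose y t := if pselect (exists j, t \in cell n (r ^+ j)%g) is left ex
    then let j := projT1 (cid ex) in
      if t == (r ^+ j)%g then a j else y0 (t * (r ^+ j)^-1)%g else y0 t.
  have yP j u : u \in D n -> y (u * r ^+ j)%g = if u == 1%g then a j else y0 u.
    move=> uD; have mem : (u * r ^+ j)%g \in cell n (r ^+ j)%g by rewrite cr rtranslateP mulgK.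
    rewrite /y; case: pselect => [ex|]; last by case; exists j.
    case: (cid ex) => j' /= mem'; have -> : j' = j.
      apply: (torsion_free_order tf r1); apply: (rtranslate_inj tf (D_neq0 tow n)).
      by rewrite -!cr -(cell_eq tf mem) (cell_eq tf mem').
    rewrite mulgK; congr (if _ then _ else _).
    by rewrite -[X in _ == X]mul1g (inj_eq (@mulIg _ _)).
  exists y => //; apply: (splice i.+1 y0) => // t.
  rewrite {2}/y; case: pselect => [ex|]; last by right.
  left; move: (ex) => [j tj].
  have Hj : H (r ^+ j)%g by exact: (line_sub tow (rX j)).
  split.
    apply: (meets_mono (lvl_l i.+1)); apply/meets_lineP; exists (r ^+ j)%g => //.
    by rewrite (cell_sym tf).
  have uD : (t * (r ^+ j)^-1)%g \in D n by move: tj; rewrite cr rtranslateP.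
  have et : t = (t * (r ^+ j)^-1 * r ^+ j)%g by rewrite mulgKV.
  have rt : red n t = red n (t * (r ^+ j)^-1)%g.
    by rewrite (red_D tf tow uD) {1}et (red_copy tf) //; exact: (red_line_step tf).
  rewrite (state_detE (st i.+1) rt) (state_detb (st i.+1) rt) => nE.
  have u1 : (t * (r ^+ j)^-1)%g != 1%g by apply: contraNneq nE => ->; exact: free1.
  by have := yP j _ uD; rewrite -et (negbTE u1) => ->; exact: Yy0.
exists (D n), g, r, y0; split => //; first exact: (D1 tow).
move=> u uF; have uD : u \in D (l i) by apply: (fsubsetP Dil); exact: (fsubsetP Fi).
split; first exact: gD.
move=> a; have [y Yy yP] := line (fun=> a).
have := gP y 1%g u (Yy i.+1) _ uD; rewrite (red_D tf tow (D1 tow n)) => /(_ erefl) <-.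
by have := yP 0%N _ (gD u uD); rewrite expg0.
Qed.

End Limit.

(** * A point with trivial stabilizer *)

Section Aperiodic.
Variables (G : groupType) (H : set G) (A : finType) (Y : set (G -> A)).
Hypotheses (Gc : countable [set: G]) (Hinf : infinite_set H) (A2 : (1 < #|A|)%N).
Hypothesis (Ymod : forall y y', Y y -> (forall t, ~ H t -> y' t = y t) -> Y y').

(* Points [t k] of [H] are chosen outside the positions [t j], [t j s j] with
   [j < k]; the value at [t k] can then be changed to differ from the one at
   [t k s k] without affecting earlier choices. *)
Lemma aperiodic_point : Y !=set0 ->
  exists2 x, Y x & forall s, s <> 1%g -> exists t, x (t * s)%g <> x t.
Proof.
move=> [y0 Yy0].
have /choice[oth othP] (a : A) : exists b, b <> a.
  apply: contrapT => no; have : (#|A| <= 1)%N.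
    rewrite -(card1 a); apply: subset_leq_card; apply/fintype.subsetP => b _.
    by rewrite inE; apply/eqP; apply: contrapT => ba; apply: no; exists b.
  by rewrite leqNgt A2.
have /choice[pick pickP] (U : {fset G}) : exists h, H h /\ h \notin U.
  apply: contrapT => no; apply: Hinf; apply: (@sub_finite_set _ _ [set` U]); last exact: finite_fset.
  by move=> h Hh; apply: contrapT => /negP hU; apply: no; exists h.
have [f fi] := elimT (countable_injP _) Gc.
pose s k := xget 1%g [set g | f g = k].
have s_surj g : s (f g) = g.
  rewrite /s; case: xgetP => [g' _ /= e|/(_ g) no]; last by case: no.
  by apply: fi => //; rewrite inE.
pose U := fix U k := if k is k'.+1
  then (U k' `|` [fset pick (U k'); (pick (U k') * s k')%g])%fset else (fset0 : {fset G}).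
pose t k := pick (U k).
have Umono i j x : (i <= j)%N -> x \in U i -> x \in U j.
  move=> /subnKC <- xU; elim: (j - i)%N => [|d IH]; first by rewrite addn0.
  by rewrite addnS /= in_fsetU IH.
have tU j k : (j < k)%N -> t j \in U k.
  by move=> jk; apply: (Umono j.+1) => //=; rewrite in_fsetU !inE eqxx orbT.
have tsU j k : (j < k)%N -> (t j * s j)%g \in U k.
  by move=> jk; apply: (Umono j.+1) => //=; rewrite in_fsetU !inE eqxx !orbT.
have tnU j : t j \notin U j by have [] := pickP (U j).
pose xs := fix xs k := if k is k'.+1
  then (fun u => if u == t k' then oth (xs k' (t k' * s k')%g) else xs k' u) else y0.
have stable k m u : (k <= m)%N -> u \in U k -> xs m u = xs k u.
  move=> /subnKC <- uU; elim: (m - k)%N => [|d IH]; first by rewrite addn0.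
  rewrite addnS /=; case: eqP => // ut.
  by have := tnU (k + d)%N; rewrite -ut (Umono k) // leq_addr.
pose x u := if pselect (exists k, u = t k) is left ex then xs (projT1 (cid ex)).+1 u else y0 u.
have x0 u k : (forall j, (k <= j)%N -> u != t j) -> xs k u = x u.
  move=> uk; rewrite /x; case: pselect => [ex|no].
    case: (cid ex) => j /= uj.
    have jk : (j < k)%N by rewrite ltnNge; apply/negP => /uk; rewrite uj eqxx.
    have uU : u \in U j.+1 by rewrite uj; exact: tU.
    exact: (stable j.+1 k u jk uU).
  elim: k {uk} => //= k ->; case: eqP => // uk.
  by case: no; exists k.
exists x.
  apply: Ymod Yy0 _ => u nHu; rewrite /x; case: pselect => // -[k uk].
  by case: nHu; rewrite uk; have [] := pickP (U k).
move=> g g1; pose k := f g; exists (t k).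
have xt : x (t k) = xs k.+1 (t k).
  rewrite -(x0 _ k.+1) // => j kj; apply: contraNneq (tnU j) => <-; exact: tU.
have ne : (t k * s k)%g <> t k.
  by rewrite -[X in _ = X]mulg1 => /mulgI; rewrite s_surj.
have xts : x (t k * s k)%g = xs k.+1 (t k * s k)%g.
  rewrite -(x0 _ k.+1) // => j kj; apply: contraNneq (tnU j) => <-; exact: tsU.
rewrite -[g]s_surj -/k xt xts /= eqxx; case: eqP => // _.
by move=> e; apply: (othP (xs k (t k * s k)%g)).
Qed.

End Aperiodic.

(** * Coding by the Cantor set *)

Section CantorCoding.
Variables (R : realType) (A : pointedType).
Hypothesis Afin : finite_set [set: A].

Let P : pseudoPMetricType R := tree_of (fun _ : nat => A).

Lemma tree_compact : compact [set: P].
Proof.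
have Fn : finite_set [set: discrete_topology A] := Afin.
have := tychonoff (fun n : nat => finite_compact Fn).
by set B := (X in compact X -> _); have -> : B = [set: P] by rewrite eqEsubset.
Qed.

Lemma tree_zero_dimensional : zero_dimensional P.
Proof. by apply: zero_dimension_prod => ?; exact: discrete_zero_dimension. Qed.

(** Otherwise points outside [V] agreeing with [z] on longer and longer initial segments would
    converge to [z]. *)
Lemma tree_cylinder (V : set P) (z : P) : open V -> V z ->
  exists n, forall w : P, (forall i, (i < n)%N -> w i = z i) -> V w.
Proof.
move=> oV Vz; apply: contrapT => no.
have /choice[w wP] n : exists w : P, (forall i, (i < n)%N -> w i = z i) /\ ~ V w.
  apply: contrapT => no'; apply: no; exists n => w wz; apply: contrapT => nV.
  by apply: no'; exists w.
have cvg : w @ \oo --> (z : P).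
  apply/cvg_sup => i; apply/cvg_image.
    by rewrite eqEsubset; split => // a _; exists (fun=> a).
  move=> B nB; exists ((fun y : P => y i) @^-1` B); last first.
    by apply: image_preimage; rewrite eqEsubset; split => // a _; exists (fun=> a).
  by exists i.+1 => // n /= lt; have [wn _] := wP n; rewrite wn //; exact: nbhs_singleton nB.
have [N _ NP] : \forall n \near \oo, V (w n) by apply: cvg; exact: open_nbhs_nbhs.
by have [_] := wP N; apply; exact: NP (leqnn N).
Qed.

Lemma clopen_coord i (v : A) : clopen [set w : P | w i = v].
Proof.
have c : continuous (fun w : P => w i : discrete_topology A) by exact: proj_continuous.
have cv : clopen ([set v] : set (discrete_topology A)).
  by split; [exact: discrete_open | exact: discrete_closed].
exact: (preimage_clopen cv c).
Qed.

Lemma open_cylinder n (z : P) : open [set w : P | forall i, (i < n)%N -> w i = z i].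
Proof.
elim: n => [|n IH]; first by rewrite (_ : mkset _ = setT) ?eqEsubset //; exact: openT.
rewrite (_ : mkset _ = [set w : P | forall i, (i < n)%N -> w i = z i] `&` [set w | w n = z n]).
  by apply: openI => //; have [] := clopen_coord n (z n).
rewrite eqEsubset; split=> w /=.
  by move=> wz; split=> [i lt|]; apply: wz => //; exact: ltnW.
by move=> [wz wn] i; rewrite ltnS leq_eqVlt => /predU1P[->//|]; exact: wz.
Qed.

Variable (X : set (nat -> A)) (x0 : nat -> A).
Hypotheses (Xx0 : X x0)
  (Xclosed : forall z, (forall n, exists2 w, X w & forall i, (i < n)%N -> w i = z i) -> X z)
  (Xperfect : forall z n, X z -> exists w, [/\ X w, w <> z & forall i, (i < n)%N -> w i = z i]).

Let XP : set P := X.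
Let T : pseudoMetricType R := set_type XP.

Lemma closed_subshift : closed XP.
Proof.
move=> z zX; apply: Xclosed => n.
have [w [Xw wz]] := zX _ (open_nbhs_nbhs (conj (open_cylinder n z) (fun i _ => erefl))).
by exists w.
Qed.

Lemma val_continuous : continuous (set_val : T -> P).
Proof. exact: initial_continuous. Qed.

Lemma subshift_compact : compact [set: T].
Proof.
have cX : compact XP.
  by apply: (@subclosed_compact _ _ [set: P]) => //; [exact: closed_subshift | exact: tree_compact].
move=> F PF _; have [p [Xp cp]] := cX (set_val @ F) _ (filterS (fun x _ => set_valP x) (@filterT _ F _)).
exists (exist _ p (mem_set Xp)); split => // B C FB nC.
have [V [oV Vp VC]] : exists V : set P, [/\ open V, V p & set_val @^-1` V `<=` C].
  by case: nC => _ [[V oV <-] Vp] VC; exists V; split.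
have := cp (set_val @` B) V; case.
- have BB : B `<=` set_val @^-1` (set_val @` B) by move=> x Bx; exists x.
  exact: (filterS BB FB).
- by apply: open_nbhs_nbhs.
- by move=> _ [[x Bx <-] Vx]; exists x; split => //; exact: VC.
Qed.

Lemma subshift_zero_dimensional : zero_dimensional T.
Proof.
move=> x y xy; have nxy : set_val x != set_val y.
  by apply: contra xy => /eqP/val_inj/eqP.
have [U [cU Ux Uy]] := tree_zero_dimensional nxy.
by exists (set_val @^-1` U); split => //; exact: (preimage_clopen cU val_continuous).
Qed.

Lemma subshift_hausdorff : hausdorff_space T.
Proof.
rewrite open_hausdorff => x y /subshift_zero_dimensional[U [[oU cU] Ux Uy]].
exists (U, ~` U) => /=; first by rewrite !in_setE.
by split; [| exact: closed_openC | rewrite setICr].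
Qed.

Lemma subshift_perfect : perfect_set [set: T].
Proof.
apply/perfectTP => x [V oV Vx].
have Oxx : V (set_val x) by have := erefl : [set x] x; rewrite -Vx.
have [n nV] := tree_cylinder oV Oxx.
have [w [Xw wx wz]] := Xperfect n (set_valP x).
have : (set_val @^-1` V) (exist _ (w : P) (mem_set Xw) : T) by exact: nV.
by rewrite Vx => /(congr1 set_val) /= /wx.
Qed.

Lemma cantor_coding : exists pi : cantor_space -> nat -> A,
  [/\ injective pi, forall c, X (pi c), forall z, X z -> exists c, pi c = z,
    forall i v, clopen [set c | pi c i = v] &
    forall U c, open U -> U c ->
      exists n, forall c', (forall i, (i < n)%N -> pi c' i = pi c i) -> U c'].
Proof.
pose t0 : T := exist _ (x0 : P) (mem_set Xx0).
pose T' : pseudoPMetricType R := HB.pack (T : Type) (isPointed.Build T t0) (PseudoMetric.on T).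
have cl : cantor_like T'.
  by split; [exact: subshift_perfect | exact: subshift_compact | exact: subshift_hausdorff
            | exact: subshift_zero_dimensional].
have [f [fc fcl]] := homeomorphism_cantor_like cl.
pose f' : cantor_space -> T := f.
have fval : continuous (set_val \o f' : cantor_space -> P).
  by move=> c; apply: continuous_comp; [exact: fc | exact: val_continuous].
exists (fun c => set_val (f' c)); split.
- by move=> c c' /val_inj; apply: (@inj _ _ _ f); rewrite in_setT.
- by move=> c; exact: set_valP.
- move=> z Xz; have [c _ fz] := @surj _ _ _ _ f (exist _ (z : P) (mem_set Xz)) I.
  by exists c; rewrite /f' fz.
- by move=> i v; exact: (preimage_clopen (clopen_coord i v) fval).
move=> U c oU Uc.
have [V oV VU] : open (~` (f' @` ~` U)).
  by apply: closed_openC; apply: fcl; exact: open_closedC.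
have Ofc : V (set_val (f' c)).
  have : (~` (f' @` ~` U)) (f' c).
    by move=> [c' nU /(@inj _ _ _ f)]; rewrite !in_setT => /(_ isT isT) e; apply: nU; rewrite e.
  by rewrite -VU.
have [n nV] := tree_cylinder oV Ofc.
exists n => c' cc'; apply: contrapT => nU.
have : (set_val @^-1` V) (f' c') by exact: nV.
by rewrite VU; apply; exists c'.
Qed.

End CantorCoding.

Section Subshift.
Variables (R : realType) (G : groupType) (A : finType) (a0 : A) (Y : set (G -> A)).
Hypotheses (Gc : countable [set: G]) (Ginf : infinite_set [set: G]) (Y0 : Y !=set0).
Hypothesis Yrec : forall p (F : {fset G}), Y p -> exists K : {fset G}, forall y t, Y y ->
  exists2 g, (g * t^-1)%g \in K & forall s, s \in F -> y (s * g)%g = p s.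

(** The closure of the orbits in the product topology, described through finite windows. *)
Definition subshift : set (G -> A) :=
  [set z | forall F : {fset G}, exists2 w, orbits Y w & eqon F z w].

Lemma shiftM g h (z : G -> A) : shift g (shift h z) = shift (g * h)%g z.
Proof. by apply/funext => t; rewrite /shift mulgA. Qed.

Lemma shift1 (z : G -> A) : shift 1%g z = z.
Proof. by apply/funext => t; rewrite /shift mulg1. Qed.

Lemma orbits_subshift : orbits Y `<=` subshift.
Proof. by move=> w Yw F; exists w. Qed.

Lemma sub_subshift : Y `<=` subshift.
Proof. by move=> y Yy; apply: orbits_subshift; exists y => //; exists 1%g; rewrite shift1. Qed.

Lemma subshift_shift g z : subshift z -> subshift (shift g z).
Proof.
move=> Xz F; have [w Yw zw] := Xz (rtranslate F g).
exists (shift g w); first exact: orbits_shift.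
by move=> t tF; apply: zw; rewrite rtranslateP mulgK.
Qed.

(** Bounded recurrence passes from [Y] to the closure because a finite window already shows all the
    places where the pattern may return. *)
Lemma subshift_recur z' (F : {fset G}) : subshift z' -> exists K : {fset G},
  forall z t, subshift z -> exists2 g, (g * t^-1)%g \in K & eqon F (shift g z) z'.
Proof.
move=> Xz'; have [_ [y0 Yy0 [g0 ->]] z'w] := Xz' F.
have [K KP] := Yrec (rtranslate F g0) Yy0.
exists [fset (g0 * k)%g | k in K]%fset => z t Xz.
have [_ [y Yy [g1 ->]] zw] := Xz [fset (f * g0 * k * t)%g | f in F, k in K]%fset.
have [gam gK gP] := KP y (t * g1)%g Yy.
pose k := (gam * (t * g1)^-1)%g.
exists (g0 * k * t)%g; first by rewrite mulgK; apply/imfsetP; exists k.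
move=> f fF; rewrite z'w // /shift.
have -> : (f * (g0 * k * t) = f * g0 * k * t)%g by rewrite !mulgA.
rewrite zw; last by apply/imfset2P; exists f => //; exists k.
have <- := gP (f * g0)%g; last by rewrite rtranslateP mulgK.
by rewrite /shift /k invMg !mulgA mulgKV mulgKV.
Qed.

Lemma subshift_minimal z z' (F : {fset G}) : subshift z -> subshift z' ->
  exists g, eqon F (shift g z) z'.
Proof.
move=> Xz Xz'; have [K KP] := subshift_recur F Xz'.
by have [g _ gz] := KP z 1%g Xz; exists g.
Qed.

Definition aperiodic (x : G -> A) := forall g, shift g x = x -> g = 1%g.

Lemma aperiodic_shift g x : aperiodic x -> aperiodic (shift g x).
Proof.
move=> ap h; rewrite shiftM => /(congr1 (shift g^-1)); rewrite !shiftM mulVg shift1 => /ap e.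
by apply: (@mulgI _ g^-1%g); apply: (@mulIg _ g); rewrite mulg1 mulVg -mulgA.
Qed.

Variable x : G -> A.
Hypotheses (Xx : subshift x) (xap : aperiodic x).

(** The point [x] has a translate close to [z]. Should it equal [z], then [z] is aperiodic, and a
    return time [h] with [h t^-1] in [K] gives a different nearby point: taking [t] outside [K^-1]
    excludes [h = 1]. *)
Lemma subshift_perfect_ex z (F : {fset G}) : subshift z ->
  exists w, [/\ subshift w, w <> z & eqon F w z].
Proof.
move=> Xz; have [g gz] := subshift_minimal F Xx Xz.
have [e|ne] := pselect (shift g x = z); last first.
  by exists (shift g x); split => //; exact: subshift_shift.
have apz : aperiodic z by rewrite -e; exact: aperiodic_shift.
have [K KP] := subshift_recur F Xz.
have [t tK] : exists t : G, t \notin invfs K.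
  apply: contrapT => no; apply: Ginf; apply: (@sub_finite_set _ _ [set` invfs K]); last exact: finite_fset.
  by move=> h _; apply: contrapT => /negP hU; apply: no; exists h.
have [h hK hz] := KP z t Xz; exists (shift h z); split => //; first exact: subshift_shift.
by move=> /apz h1; move: hK tK; rewrite h1 mul1g invfsP => ->.
Qed.

Lemma subshift_coding : exists pi : cantor_space -> G -> A,
  [/\ injective pi, forall c, subshift (pi c), forall z, subshift z -> exists c, pi c = z,
    forall t v, clopen [set c | pi c t = v] &
    forall U c, open U -> U c ->
      exists F : {fset G}, forall c', eqon F (pi c') (pi c) -> U c'].
Proof.
have [f fi] := elimT (countable_injP _) Gc.
pose s k := xget 1%g [set g | f g = k].
have s_surj g : s (f g) = g.
  rewrite /s; case: xgetP => [g' _ /= e|/(_ g) no]; last by case: no.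
  by apply: fi => //; rewrite inE.
pose Ap : pointedType := HB.pack (A : Type) (Finite.class A) (isPointed.Build A a0).
pose X' : set (nat -> Ap) := [set u | exists2 z, subshift z & u = z \o s].
have win (F : {fset G}) : exists n, forall t, t \in F -> (f t < n)%N.
  exists (\max_(t <- F) f t).+1 => t tF; rewrite ltnS; exact: leq_bigmax_seq.
have Afin : finite_set [set: Ap] by exact: (@finite_finset A).
have Xcl (u : nat -> Ap) : (forall n, exists2 w, X' w & forall i, (i < n)%N -> w i = u i) -> X' u.
  move=> uP; exists (u \o f); last first.
    (* Indices outside the range of [f] repeat the coordinate of the identity, so the window has to
       reach [f (s i)] as well as [i]. *)
    apply/funext => i; have [_ [z _ ->] zu] := uP (maxn i (f (s i))).+1.
    by rewrite /= -!zu ?ltnS ?leq_maxl ?leq_maxr //= s_surj.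
  move=> F; have [n nP] := win F; have [_ [z Xz ->] zu] := uP n.
  have [w Yw zw] := Xz F; exists w => // t tF.
  rewrite -zw // /=; have := zu (f t) (nP t tF).
  by rewrite /= s_surj => ->.
have Xpf (u : nat -> Ap) n : X' u -> exists w, [/\ X' w, w <> u & forall i, (i < n)%N -> w i = u i].
  move=> [z Xz ->]; have [w [Xw wz ew]] := subshift_perfect_ex [fset s i | i in iota 0 n]%fset Xz.
  exists (w \o s); split; first by exists w.
    by move=> e; apply: wz; apply/funext => t; rewrite -(s_surj t); exact: (congr1 (@^~ (f t)) e).
  by move=> i lt; apply: ew; apply/imfsetP; exists i; rewrite //= mem_iota.
have [pi [pinj piX pisurj picl picyl]] :=
  cantor_coding R Afin (ex_intro2 _ _ x Xx erefl : X' (x \o s)) Xcl Xpf.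
exists (fun c => pi c \o f); split.
- move=> c c' e; apply: pinj; have [z _ ez] := piX c; have [z' _ ez'] := piX c'.
  rewrite ez ez'; congr (_ \o _); apply/funext => t.
  by have := congr1 (@^~ t) e; rewrite /= ez ez' /= s_surj.
- move=> c; have [z Xz ->] := piX c; suff -> : (z \o s) \o f = z by [].
  by apply/funext => t; rewrite /= s_surj.
- move=> z Xz; have [c ec] := pisurj (z \o s) (ex_intro2 _ _ z Xz erefl).
  by exists c; rewrite ec; apply/funext => t; rewrite /= s_surj.
- by move=> t v; exact: picl.
move=> U c oU Uc; have [n nP] := picyl U c oU Uc.
exists [fset s i | i in iota 0 n]%fset => c' e; apply: nP => i lt.
have [z _ ez] := piX c; have [z' _ ez'] := piX c'.
have : s i \in [fset s i | i in iota 0 n]%fset by apply/imfsetP; exists i; rewrite //= mem_iota.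
by move=> /e; rewrite /= ez ez' /= s_surj.
Qed.

End Subshift.

Section CodedAction.
Variables (G : groupType) (A : finType) (X : set (G -> A)) (pi : cantor_space -> G -> A).
Hypotheses (Xshift : forall g z, X z -> X (shift g z))
  (Xmin : forall z z' (F : {fset G}), X z -> X z' -> exists g, eqon F (shift g z) z').
Hypotheses (pi_inj : injective pi) (piX : forall c, X (pi c))
  (pi_surj : forall z, X z -> exists c, pi c = z)
  (pi_clopen : forall t v, clopen [set c | pi c t = v])
  (pi_cyl : forall U c, open U -> U c ->
      exists F : {fset G}, forall c', eqon F (pi c') (pi c) -> U c').

Lemma coded_action : exists alpha : G -> cantor_space -> cantor_space,
  forall g c, pi (alpha g c) = shift g (pi c).
Proof.
have /choice[alpha aP] (p : G * cantor_space) : exists c, pi c = shift p.1 (pi p.2).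
  exact/pi_surj/Xshift/piX.
by exists (fun g c => alpha (g, c)) => g c; rewrite aP.
Qed.

Variable alpha : G -> cantor_space -> cantor_space.
Hypothesis pi_alpha : forall g c, pi (alpha g c) = shift g (pi c).

Lemma nbhs_cylinder (F : {fset G}) (c : cantor_space) : nbhs c [set c' | eqon F (pi c') (pi c)].
Proof.
suff H (s : seq G) : nbhs c [set c' | forall t, t \in s -> pi c' t = pi c t] by exact: H.
elim: s => [|t s IH]; first by apply: filterS filterT => c' _ t.
have [ot _] := pi_clopen t (pi c t).
apply: filterS (filterI (open_nbhs_nbhs (conj ot erefl)) IH) => c' [/= e1 e2] u.
by rewrite inE => /predU1P[->|/e2].
Qed.

Lemma open_of_cylinders (U : set cantor_space) :
  (forall c, U c -> exists F : {fset G}, forall c', eqon F (pi c') (pi c) -> U c') -> open U.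
Proof.
move=> cyl; rewrite openE => c /cyl[F FU]; apply: filterS (nbhs_cylinder F c) => c'.
exact: FU.
Qed.

Lemma clopen_cylinder (F : {fset G}) (w : G -> A) : clopen [set c | eqon F (pi c) w].
Proof.
split; first by apply: open_of_cylinders => c cw; exists F => c' e t tF; rewrite e ?cw.
rewrite -openC; apply: open_of_cylinders => c nc; exists F => c' e; apply: contra_not nc.
by move=> c'w t tF; rewrite -e ?c'w.
Qed.

Lemma alpha1 c : alpha 1%g c = c.
Proof. by apply: pi_inj; rewrite pi_alpha shift1. Qed.

Lemma alphaM g h c : alpha (g * h)%g c = alpha g (alpha h c).
Proof. by apply: pi_inj; rewrite !pi_alpha shiftM. Qed.

Lemma alpha_continuous g : continuous (alpha g).
Proof.
apply/continuousP => U oU; apply: open_of_cylinders => c /(pi_cyl oU)[F FU].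
exists (rtranslate F g) => c' e; apply: FU => t tF; rewrite !pi_alpha /shift e //.
by rewrite rtranslateP mulgK.
Qed.

Lemma alpha_action : continuous_action alpha.
Proof.
split; [exact: alpha1 | exact: alphaM | exact: alpha_continuous].
Qed.

Lemma alpha_minimal : minimal alpha.
Proof.
move=> c U [c' Uc'] oU; have [F FU] := pi_cyl oU Uc'.
have [g gF] := Xmin F (piX c) (piX c').
by exists (alpha g c); split; [apply: FU; rewrite pi_alpha | exists g].
Qed.

(** Aperiodicity is inherited along an orbit, and the orbit of the given aperiodic point is
    dense. *)
Lemma alpha_free x : X x -> aperiodic x -> topologically_free alpha.
Proof.
move=> Xx ap U U0 oU; have [c ec] := pi_surj Xx.
have [y [Uy [g _ gy]]] := alpha_minimal c U0 oU.
exists y; split => // s; rewrite -gy => /(congr1 pi); rewrite !pi_alpha ec.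
exact: (aperiodic_shift ap).
Qed.

End CodedAction.

(** * Metric entropy *)

Section LimSup.
Variable R : realType.

Lemma limn_esup_ub (u : nat -> \bar R) (l : \bar R) N :
  (forall n, (N <= n)%N -> (u n <= l)%E) -> (limn_esup u <= l)%E.
Proof.
move=> ul; apply: (@le_trans _ _ (ereal_sup (u @` [set n | (N <= n)%N]))).
  by apply: ereal_inf_lbound; exists [set n | (N <= n)%N] => //; exists N.
by apply: ge_ereal_sup => _ [n Nn <-]; exact: ul.
Qed.

Lemma limn_esup_lb (u : nat -> \bar R) (l : \bar R) N :
  (forall n, (N <= n)%N -> (l <= u n)%E) -> (l <= limn_esup u)%E.
Proof.
move=> lu; apply: le_ereal_inf_tmp => _ [B [M _ MB] <-].
apply: (@le_trans _ _ (u (maxn N M))); first by apply: lu; exact: leq_maxl.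
by apply: ereal_sup_ubound; exists (maxn N M) => //; apply: MB; exact: leq_maxr.
Qed.

End LimSup.

Section MetricEntropy.
Variables (R : realType) (G : groupType) (A : finType) (a0 : A).
Variables (Y : set (G -> A)) (pi : cantor_space -> G -> A) (alpha : G -> cantor_space -> cantor_space).
Hypotheses (Y0 : Y !=set0).
Hypotheses (pi_inj : injective pi) (piX : forall c, subshift Y (pi c))
  (pi_surj : forall z, subshift Y z -> exists c, pi c = z)
  (pi_clopen : forall t v, clopen [set c | pi c t = v])
  (pi_cyl : forall U c, open U -> U c ->
      exists F : {fset G}, forall c', eqon F (pi c') (pi c) -> U c')
  (pi_alpha : forall g c, pi (alpha g c) = shift g (pi c)).

Lemma finite_subcover (B : cantor_space -> set cantor_space) :
  (forall c, open (B c)) -> (forall c, B c c) ->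
  exists s : {fset cantor_space}, forall c, exists2 i, i \in s & B i c.
Proof.
move=> oB Bc; have := cantor_space_compact; rewrite compact_cover.
move=> /(_ _ setT B (fun i _ => oB i)) [c _|s _ sP]; first by exists c.
by exists s => c; have [i si Bi] := sP c I; exists i.
Qed.

Variable d : cantor_space -> cantor_space -> R.
Hypothesis dP : compatible_metric setT d.

Lemma d_refl c : d c c = 0.
Proof. by case: dP => dE _ _ _; have [_ [_ ->]] := dE c c I I. Qed.

Lemma d_sym c c' : d c c' = d c' c.
Proof. by case: dP => _ ds _ _; exact: ds. Qed.

Lemma d_tri c c' c'' : d c c'' <= d c c' + d c' c''.
Proof. by case: dP => _ _ dt _; exact: dt. Qed.

Lemma nbhs_d c (B : set cantor_space) :
  nbhs c B <-> exists2 e : R, 0 < e & forall y, d c y < e -> B y.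
Proof.
case: dP => _ _ _ dn; have eB : [set y | [set: cantor_space] y -> B y] = B.
  by rewrite eqEsubset; split => y /=; [exact|].
have := dn c I B; rewrite (_ : within _ _ _ = nbhs c B); last by rewrite -[in RHS]eB.
by move=> ->; split => -[e e0 ey]; exists e => // y; [exact: ey | move=> _; exact: ey].
Qed.

Lemma open_ball c (e : R) : open [set y | d c y < e].
Proof.
rewrite openE => y /= ye; apply/nbhs_d; exists (e - d c y); first by rewrite subr_gt0.
by move=> z; rewrite ltrBrDl; apply: le_lt_trans; exact: d_tri.
Qed.

(** Around each point some cylinder lies in a ball of radius [e / 2]; finitely many of these
    cylinders cover, and [B] is the union of their windows. *)
Lemma metric_cylinder (e : R) : 0 < e -> exists B : {fset G},
  forall c c', eqon B (pi c) (pi c') -> d c c' <= e.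
Proof.
move=> e0; have e2 : 0 < e / 2 by rewrite divr_gt0.
have /choice[F FP] c : exists F : {fset G}, forall c', eqon F (pi c') (pi c) -> d c c' < e / 2.
  by apply: (pi_cyl (open_ball c (e / 2))); rewrite /= d_refl.
have [s sP] := finite_subcover (fun c => (clopen_cylinder pi_clopen (F c) (pi c)).1) (fun c _ _ => erefl).
exists (\bigcup_(i <- s) F i)%fset => c c' cc'; have [i si ic] := sP c.
have ic' : eqon (F i) (pi c') (pi i).
  by move=> t tF; rewrite -ic // cc' //; apply/bigfcupP; exists i; rewrite ?si.
apply: le_trans (d_tri c i c') _; rewrite d_sym.
by have := FP i c ic; have := FP i c' ic'; lra.
Qed.

(** The coordinate at the identity is locally constant, so a Lebesgue number argument bounds from
    below the distance of points where it differs. *)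
Lemma metric_separates : exists2 e : R, 0 < e & forall c c', pi c 1%g <> pi c' 1%g -> e <= d c c'.
Proof.
have /choice[e eP] c : exists e : R, 0 < e /\ forall c', d c c' < e -> pi c' 1%g = pi c 1%g.
  have [oc _] := pi_clopen 1%g (pi c 1%g).
  by have [e e0 eP] := (nbhs_d c _).1 (open_nbhs_nbhs (conj oc erefl)); exists e.
have [s sP] := finite_subcover (fun c => open_ball c (e c / 2))
  (ltac:(by move=> c /=; rewrite d_refl divr_gt0 //; have [] := eP c)).
have [m m0 mP] : exists2 m : R, 0 < m & forall i, i \in s -> m <= e i / 2.
  have H (l : seq cantor_space) : exists2 m : R, 0 < m & forall i, i \in l -> m <= e i / 2.
    elim: l => [|i l [m m0 mP]]; first by exists 1.
    exists (Num.min m (e i / 2)).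
      by rewrite lt_min m0 divr_gt0 //; have [] := eP i.
    by move=> j; rewrite inE ge_min => /predU1P[->|/mP ->] //; rewrite lexx orbT.
  exact: H.
exists m => // c c' ne; rewrite leNgt; apply/negP => lt; apply: ne.
have [i si /= ic] := sP c; have [e0 ei] := eP i.
have mi := mP i si.
have ec : pi c 1%g = pi i 1%g by apply: ei; lra.
have ec' : pi c' 1%g = pi i 1%g by apply: ei; have := d_tri i c c'; lra.
by rewrite ec ec'.
Qed.

Lemma coded_expansive : exists2 e : R, 0 < e & forall c c', c <> c' ->
  exists s, e <= d (alpha s c) (alpha s c').
Proof.
have [e e0 eP] := metric_separates; exists e => // c c' ne.
have [t nt] : exists t, pi c t <> pi c' t.
  apply: contrapT => no; apply: ne; apply: pi_inj; apply/funext => t.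
  by apply: contrapT => nt; apply: no; exists t.
by exists t; apply: eP; rewrite !pi_alpha /shift mul1g.
Qed.

Lemma npatU (F F' : {fset G}) : (npat Y (F `|` F')%fset <= npat Y F * #|A| ^ #|` F'|)%N.
Proof.
pose Q : {set {ffun F -> A} * {ffun F' -> A}} := finset.setX (pats F (orbits Y)) [set: {ffun F' -> A}]%SET.
have -> : (npat Y F * #|A| ^ #|` F'|)%N = #|Q|.
  by rewrite cardsX cardsT card_ffun -cardfE.
apply: (@leq_card_rel _ _ _ _ (fun (v : {ffun (F `|` F')%fset -> A}) (q : {ffun F -> A} * {ffun F' -> A}) =>
  exists w, [/\ forall t : (F `|` F')%fset, v t = w (val t), forall t : F, q.1 t = w (val t) &
    forall t : F', q.2 t = w (val t)])).
  move=> v /patsP[w Yw vw].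
  exists ([ffun t : F => w (val t)], [ffun t : F' => w (val t)]).
    by rewrite inE /= mem_pats // inE.
  by exists w; split => // t; rewrite ffunE.
move=> v v' q _ _ [w [vw q1 q2]] [w' [vw' q1' q2']]; apply/ffunP => t; rewrite vw vw'.
have := valP t; rewrite in_fsetU => /orP[tF|tF].
  by have := q1 [` tF]%fset; rewrite q1' /= => ->.
by have := q2 [` tF]%fset; rewrite q2' /= => ->.
Qed.

(** Points with the same pattern on [B F] have translates by each [s] in [F] that agree on [B],
    hence are not separated. *)
Lemma sep_le (e : R) (B F : {fset G}) : (forall c c', eqon B (pi c) (pi c') -> d c c' <= e) ->
  (sep alpha setT d F e <= (npat Y (mulfs B F))%:R%:E)%E.
Proof.
move=> BP; apply: ge_ereal_sup => _ [S [_ sepS] <-]; rewrite lee_fin ler_nat.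
have -> : #|` S| = #|[set: S]%SET| by rewrite cardsT cardfE.
apply: (@leq_card_rel S _ _ _ (fun (c : S) (v : {ffun mulfs B F -> A}) => forall t : mulfs B F, v t = pi (val c) (val t))).
  move=> c _; exists [ffun t : mulfs B F => pi (val c) (val t)]; last by move=> t; rewrite ffunE.
  apply/patsP; have [w Yw cw] := piX (val c) (mulfs B F).
  by exists w => // t; rewrite ffunE cw // fsvalP.
move=> c c' v _ _ vc vc'; apply: val_inj; apply: contrapT => ne.
have [s sF] := sepS _ _ (fsvalP c) (fsvalP c') ne; apply/negP; rewrite -leNgt.
apply: BP => b bB; rewrite !pi_alpha /shift.
have bs : (b * s)%g \in mulfs B F by apply/mulfsP; exists b, s.
by have := vc [` bs]%fset; rewrite vc' /= => ->.
Qed.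

(** One point is chosen for each pattern on [F]; a position in [F] where two patterns differ is
    moved to the identity by the action. *)
Lemma sep_ge (e : R) (F : {fset G}) : (forall c c', pi c 1%g <> pi c' 1%g -> e < d c c') ->
  ((npat Y F)%:R%:E <= sep alpha setT d F e)%E.
Proof.
move=> eP.
have [c0 _] : exists c, pi c = pi c by exists point.
have /choice[f fP] (v : {ffun F -> A}) : exists c, v \in pats F (orbits Y) ->
    forall t : F, v t = pi c (val t).
  have [/patsP[w Yw vw]|_] := boolP (v \in pats F (orbits Y)); last by exists c0.
  by have [c ec] := pi_surj (orbits_subshift Yw); exists c => _ t; rewrite ec.
pose S := [fset f v | v in pats F (orbits Y)]%fset.
apply: ereal_sup_ubound; exists S; last first.
  congr (_%:R%:E); rewrite /npat cardE; symmetry.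
  rewrite -(size_map f); apply/eqP; rewrite eqn_leq; apply/andP; split.
    apply: uniq_leq_size.
      rewrite map_inj_in_uniq ?enum_uniq // => v v'; rewrite !mem_enum => vP v'P e'.
      by apply/ffunP => t; rewrite (fP v vP) (fP v' v'P) e'.
    by move=> c /mapP[v]; rewrite mem_enum => vP ->; apply/imfsetP; exists v.
  apply: uniq_leq_size; first exact: fset_uniq.
  by move=> c /imfsetP[v /= vP ->]; apply/mapP; exists v; rewrite ?mem_enum.
split=> // c c' /imfsetP[v /= vP ->] /imfsetP[v' /= v'P ->] ne.
have [t nt] : exists t : F, v t <> v' t.
  apply: contrapT => no; apply: ne; congr f; apply/ffunP => t.
  by apply: contrapT => nt; apply: no; exists t.
exists (val t); first exact: fsvalP.
by apply: eP; rewrite !pi_alpha /shift mul1g -(fP v vP) -(fP v' v'P).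
Qed.

Lemma card_mulfs_Finv (delta : R) (B F : {fset G}) : Finv B delta F ->
  #|` (mulfs B F `\` F)%fset|%:R <= #|` B|%:R * delta * #|` F|%:R.
Proof.
move=> inv; pose U b := ([fset (b * s)%g | s in F] `\` F)%fset.
have sub : (mulfs B F `\` F `<=` \bigcup_(b <- B) U b)%fset.
  apply/fsubsetP => y; rewrite in_fsetD => /andP[yF /mulfsP[b [s [bB sF e]]]].
  apply/bigfcupP; exists b; rewrite ?bB // in_fsetD yF /=; apply/imfsetP.
  by exists s.
apply: (@le_trans _ _ (\sum_(b <- B) #|` U b|)%:R).
  by rewrite ler_nat; apply: leq_trans (fsubset_leq_card sub) _; exact: card_bigfcup_le.
rewrite natr_sum -mulrA; apply: le_trans (_ : \sum_(b <- B) delta * #|` F|%:R <= _); last first.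
  by rewrite big_const_seq count_predT iter_addr_0 mulr_natl.
rewrite big_seq [leRHS]big_seq; apply: ler_sum => b bB; apply: le_trans (inv b bB).
rewrite ler_nat; apply: (leq_cardfs_inj (f := fun y => (b^-1 * y)%g)) => [y|y y' _ _ /mulgI //].
rewrite in_fsetD => /andP[yF /imfsetP[s /= sF e]].
by rewrite !inE /= e mulKg sF -e yF.
Qed.

Lemma left_Folner_Finv (F : nat -> {fset G}) (K : {fset G}) (delta : R) :
  left_Folner R F -> 0 < delta -> exists N, forall n, (N <= n)%N -> Finv K delta (F n).
Proof.
move=> [F0 Flim] d0.
have one t : exists N, forall n, (N <= n)%N ->
    #|` [fset s in F n | (t * s)%g \notin F n]%fset|%:R <= delta * #|` F n|%:R :> R.
  have /cvgrPdist_le /(_ delta d0)[N _ NP] := Flim t; exists N => n Nn.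
  have := NP n Nn; rewrite /= sub0r normrN ger0_norm ?divr_ge0 //.
  rewrite ler_pdivrMr ?ltr0n ?cardfs_gt0 //; apply: le_trans; rewrite ler_nat.
  apply: (leq_cardfs_inj (f := fun y => (t * y)%g)) => [y|y y' _ _ /mulgI //].
  rewrite !inE /= => /andP[yF tyF]; rewrite tyF /=; apply/orP; left.
  by apply/imfsetP; exists y.
have all (s : seq G) : exists N, forall n, (N <= n)%N -> forall t, t \in s ->
    #|` [fset s in F n | (t * s)%g \notin F n]%fset|%:R <= delta * #|` F n|%:R :> R.
  elim: s => [|t s [N NP]]; first by exists 0%N.
  have [M MP] := one t; exists (maxn N M) => n; rewrite geq_max => /andP[Nn Mn] u.
  by rewrite inE => /predU1P[->|us]; [exact: MP | exact: NP].
by have [N NP] := all K; exists N => n Nn t tK; exact: NP.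
Qed.

Lemma coded_entropy (F : nat -> {fset G}) : left_Folner R F ->
  entropy_along alpha setT d F = (entropy R Y)%:E.
Proof.
move=> FF; have F0 n : F n != fset0 by case: FF.
have n0 n : 0 < #|` F n|%:R :> R by rewrite ltr0n cardfs_gt0.
have A1 : 0 < #|A|%:R :> R by rewrite ltr0n; apply/card_gt0P; exists a0.
have lnA : 0 <= ln #|A|%:R :> R by apply: ln_ge0; rewrite ler1n -(ltr0n R).
have NY B : 0 < (npat Y B)%:R :> R by rewrite ltr0n; exact: npat_gt0.
apply/eqP; rewrite eq_le; apply/andP; split.
  apply: ge_ereal_sup => _ [e e0 <-]; apply/lee_addgt0Pr => eta eta0.
  have [B BP] := metric_cylinder e0.
  have eta2 : 0 < eta / 2 by rewrite divr_gt0.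
  have [K [delta [dl0 KP]]] := entropy_inv a0 Y0 eta2.
  (* Each point of [B F] outside [F] multiplies the number of patterns by at most [#|A|]; this
     invariance keeps the resulting cost below [eta / 2] per point of [F]. *)
  pose dl' := eta / 2 / (#|` B|%:R * ln #|A|%:R + 1).
  have den0 : 0 < #|` B|%:R * ln #|A|%:R + 1 :> R by rewrite ltr_wpDl // mulr_ge0.
  have [N1 N1P] := left_Folner_Finv K FF dl0.
  have [N2 N2P] := left_Folner_Finv B FF (divr_gt0 eta2 den0 : 0 < dl').
  apply: (@limn_esup_ub _ _ _ (maxn N1 N2)) => n; rewrite geq_max => /andP[nN1 nN2].
  have lnsep : (lne (sep alpha setT d (F n) e) <= (ln (npat Y (mulfs B (F n)))%:R)%:E)%E.
    rewrite -lne_EFin //; have := sep_le (F n) BP.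
    move: (sep _ _ _ _ _) => [r| |]; [| by rewrite leye_eq | by move=> _; exact: leNye].
    rewrite lee_fin /= => le; case: ifPn => [_|]; first by rewrite leNye.
    rewrite -ltNge => r0; by rewrite (lt_geF (NY _)) lee_fin ler_ln ?posrE.
  apply: (@le_trans _ _ ((#|` F n|%:R^-1)%:E * (ln (npat Y (mulfs B (F n)))%:R)%:E)%E).
    by apply: lee_wpmul2l => //; rewrite lee_fin invr_ge0 ltW.
  rewrite -EFinM -EFinD lee_fin mulrC ler_pdivrMr //.
  apply: (@le_trans _ _ (ln ((npat Y (F n))%:R * #|A|%:R ^+ #|` (mulfs B (F n) `\` F n)%fset|))).
    rewrite ler_ln ?posrE ?mulr_gt0 ?exprn_gt0 // -natrX -natrM ler_nat.
    apply: leq_trans (npatU _ _); apply: leq_npat_sub; apply/fsubsetP => y yB.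
    by rewrite in_fsetU in_fsetD yB andbT orbN.
  rewrite lnM ?posrE ?exprn_gt0 // lnXn //.
  have := KP (F n) (N1P n nN1); have := card_mulfs_Finv (N2P n nN2).
  set m := #|` (_ `\` _)%fset| => hm hN.
  apply: le_trans (lerD hN (_ : ln #|A|%:R *+ m <= eta / 2 * #|` F n|%:R)) _; last first.
    by rewrite -mulrDl ler_pM2r //; lra.
  rewrite -[leLHS]mulr_natl; apply: le_trans (ler_wpM2r lnA hm) _.
  rewrite mulrAC ler_pM2r // mulrAC /dl' mulrCA ger_pMr // ler_pdivrMr // mul1r lerDl //.
have [e e0 eP] := metric_separates.
(* Separation is defined by a strict inequality and [metric_separates] gives a weak one, hence the
   half. *)
have e2 : 0 < e / 2 by rewrite divr_gt0.
apply: (@le_trans _ _ (limn_esup (fun n =>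
    ((#|` F n|%:R^-1)%:E * lne (sep alpha setT d (F n) (e / 2)))%E))); last first.
  by apply: ereal_sup_ubound; exists (e / 2).
apply: (@limn_esup_lb _ _ _ 0%N) => n _.
have sg : ((npat Y (F n))%:R%:E <= sep alpha setT d (F n) (e / 2))%E.
  by apply: sep_ge => c c' /eP; lra.
apply: (@le_trans _ _ ((#|` F n|%:R^-1)%:E * (ln (npat Y (F n))%:R)%:E)%E).
  by rewrite -EFinM lee_fin mulrC ler_pdivlMr //; exact: entropy_le.
apply: lee_wpmul2l; first by rewrite lee_fin invr_ge0 ltW.
rewrite -lne_EFin //; move: sg; move: (sep _ _ _ _ _) => [r| |]; [| by move=> _; exact: leey | by rewrite leeNy_eq].
rewrite lee_fin /= => le; have r0 := lt_le_trans (NY _) le; rewrite (lt_geF (NY _)) (lt_geF r0) lee_fin.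
by rewrite ler_ln ?posrE.
Qed.

End MetricEntropy.

(** * Alternating groups and the free product *)

Lemma sub_generated (G : groupType) (S : set G) : S `<=` Defs.generated S.
Proof. by move=> x Sx H [_ SH]; exact: SH. Qed.

Lemma generated1 (G : groupType) (S : set G) : Defs.generated S 1%g.
Proof. by move=> H [HG _]; exact: subgroup1. Qed.

Lemma generatedM (G : groupType) (S : set G) x y :
  Defs.generated S x -> Defs.generated S y -> Defs.generated S (x * y)%g.
Proof. by move=> Sx Sy H HP; have [HG _] := HP; apply: subgroupM => //; [exact: Sx|exact: Sy]. Qed.

Lemma ord3P (i : 'I_3) : [\/ i = 0, i = 1 | i = 2].
Proof.
case: i => -[|[|[|//]]] lt; [apply: Or31|apply: Or32|apply: Or33]; exact: val_inj.
Qed.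

Section Towers.
Variables (G : groupType) (X : topologicalType) (alpha : G -> X -> X).
Hypothesis alphaA : continuous_action alpha.

Let alpha1 x : alpha 1%g x = x. Proof. by case: alphaA. Qed.
Let alphaM g h x : alpha (g * h)%g x = alpha g (alpha h x). Proof. by case: alphaA. Qed.
Let alpha_cont g : continuous (alpha g). Proof. by case: alphaA. Qed.
Let alphaK g x : alpha (g^-1)%g (alpha g x) = x.
Proof. by rewrite -alphaM mulVg alpha1. Qed.
Let alphaVK g x : alpha g (alpha (g^-1)%g x) = x.
Proof. by rewrite -alphaM mulgV alpha1. Qed.

Definition translate g (B : set X) : set X := [set x | B (alpha (g^-1)%g x)].

Lemma translateE g B : alpha g @` B = translate g B.
Proof.
rewrite eqEsubset; split=> [_ [x Bx <-]|x Bx]; first by rewrite /translate /= alphaK.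
by exists (alpha (g^-1)%g x).
Qed.

Lemma clopen_translate g B : clopen B -> clopen (translate g B).
Proof. by move=> cB; exact: (preimage_clopen cB (@alpha_cont (g^-1)%g)). Qed.

Section Tower.
Variables (h : 'I_3 -> G) (B : set X).
Hypotheses (cB : clopen B).
Hypothesis disj : forall i j x, translate (h i) B x -> translate (h j) B x -> i = j.

Definition tower_fun (s : 'S_3) x :=
  if [pick i | `[< translate (h i) B x >]] is Some i then alpha (h (s i) * (h i)^-1)%g x else x.

Lemma tower_in s i x : translate (h i) B x -> tower_fun s x = alpha (h (s i) * (h i)^-1)%g x.
Proof.
move=> Bx; rewrite /tower_fun; case: pickP => [j /asboolP Bj|/(_ i)]; last by move/asboolP.
by rewrite (disj Bx Bj).
Qed.

Lemma tower_out s x : (forall i, ~ translate (h i) B x) -> tower_fun s x = x.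
Proof.
by move=> nB; rewrite /tower_fun; case: pickP => // j /asboolP /nB.
Qed.

Lemma tower_move (s : 'S_3) i x : translate (h i) B x ->
  translate (h (s i)) B (alpha (h (s i) * (h i)^-1)%g x).
Proof. by move=> Bx; rewrite /translate /= -alphaM mulKg. Qed.

Lemma tower_funM s t x : tower_fun (t * s)%g x = tower_fun s (tower_fun t x).
Proof.
have [[i Bi]|no] := pselect (exists i, translate (h i) B x).
  rewrite !(tower_in _ Bi) (tower_in _ (tower_move t Bi)) -alphaM permM.
  by rewrite !mulgA mulgKV.
by rewrite !tower_out // => i Bi; apply: no; exists i.
Qed.

Lemma tower_fun1 x : tower_fun 1%g x = x.
Proof.
have [[i Bi]|no] := pselect (exists i, translate (h i) B x).
  by rewrite (tower_in _ Bi) perm1 mulgV alpha1.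
by rewrite tower_out // => i Bi; apply: no; exists i.
Qed.

Lemma clopen_out : clopen [set x | forall i, ~ translate (h i) B x].
Proof.
have -> : [set x | forall i, ~ translate (h i) B x] =
    ~` translate (h 0) B `&` ~` translate (h 1) B `&` ~` translate (h 2) B.
  rewrite eqEsubset; split=> x /=; first by move=> nB; do !split; exact: nB.
  by move=> [[n0 n1] n2] i; case: (ord3P i) => ->.
by apply: clopenI; [apply: clopenI|]; apply: (clopenC setT); exact: clopen_translate.
Qed.

Lemma tower_continuous s : continuous (tower_fun s).
Proof.
apply/continuousP => U oU; rewrite openE => x /= Ux.
have loc (C : set X) g : clopen C -> C x -> (forall y, C y -> tower_fun s y = alpha g y) ->
    nbhs x (tower_fun s @^-1` U).
  move=> [oC _] Cx e; have oU' : open (alpha g @^-1` U) by move/continuousP: (@alpha_cont g); apply.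
  have Ux' : (alpha g @^-1` U) x by rewrite /= -e.
  apply: filterS (filterI (open_nbhs_nbhs (conj oC Cx)) (open_nbhs_nbhs (conj oU' Ux'))).
  by move=> y [/= Cy Uy]; rewrite e.
have [[i Bi]|no] := pselect (exists i, translate (h i) B x).
  apply: (loc (translate (h i) B) (h (s i) * (h i)^-1)%g) => //; first exact: clopen_translate.
  by move=> y Bi'; exact: tower_in.
apply: (loc _ 1%g clopen_out) => [i Bi|y nB]; first by apply: no; exists i.
by rewrite tower_out ?alpha1.
Qed.

Lemma tower_funK s : cancel (tower_fun s) (tower_fun s^-1%g).
Proof. by move=> x; rewrite -tower_funM mulgV tower_fun1. Qed.

Lemma tower_funVK s : cancel (tower_fun s^-1%g) (tower_fun s).
Proof. by move=> x; rewrite -tower_funM mulVg tower_fun1. Qed.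

Definition tower_homeo s : homeo X := Homeo (tower_funK s) (tower_funVK s)
  (@tower_continuous s) (@tower_continuous s^-1%g).

Lemma tower_full s : full_group alpha (tower_homeo s).
Proof.
(* The fourth piece of the partition is the complement of the three levels, where the identity
   acts. *)
pose P (i : 'I_(3 + 1)) := match fintype.split i with
  | inl j => translate (h j) B | inr _ => [set x | forall i, ~ translate (h i) B x] end.
pose g (i : 'I_(3 + 1)) := match fintype.split i with
  | inl j => (h (s j) * (h j)^-1)%g | inr _ => 1%g end.
exists (3 + 1)%N, P, g; split.
- move=> i; rewrite /P; case: (fintype.split i) => [j|_]; first exact: clopen_translate.
  exact: clopen_out.
- move=> i j _ _ [x []]; rewrite /P.
  case: (splitP i) => [i' ei|i' ei]; case: (splitP j) => [j' ej|j' ej].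
  + by move=> Bi Bj; apply: val_inj; rewrite /= ei ej (disj Bi Bj).
  + by move=> Bi /(_ i').
  + by move=> nB /nB.
  + by move=> _ _; apply: val_inj; rewrite /= ei ej !ord1.
- rewrite eqEsubset; split=> // x _.
  have [[i Bi]|no] := pselect (exists i, translate (h i) B x).
    by exists (lshift 1 i) => //; rewrite /P (unsplitK (inl i)).
  exists (rshift 3 0) => //; rewrite /P (unsplitK (inr 0)) => i Bi.
  by apply: no; exists i.
move=> i x; rewrite /P /g; case: (fintype.split i) => [j|_]; first exact: tower_in.
by move=> nB; rewrite /= tower_out ?alpha1.
Qed.

Definition three_cycle : 'S_3 := (tperm 0%R 1%R * tperm 0%R 2%R)%g.

Lemma three_cycleE : [/\ three_cycle 0 = 1, three_cycle 1 = 2 & three_cycle 2 = 0].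
Proof.
by split; apply/eqP; rewrite /three_cycle permM !permE.
Qed.

Lemma tower_alternating : alternating_group alpha (tower_homeo three_cycle).
Proof.
apply: sub_generated; exists tower_homeo; split.
- split; first exact: tower_full.
  by move=> s t; apply: homeo_ext => x; exact: tower_funM.
- exists (fun i => translate (h i) B); split.
  + by move=> i; exact: clopen_translate.
  + by move=> i j _ _ [x [Bi Bj]]; exact: disj Bi Bj.
  + by move=> s x nB; rewrite /= tower_out // => i Bi; apply: nB; exists i.
  + move=> s i; exists (h (s i) * (h i)^-1)%g; split; first by move=> x; exact: tower_in.
    rewrite translateE eqEsubset; split=> x; rewrite /translate /= -alphaM.
      by rewrite invMg invgK mulgA mulVg mul1g.
    by rewrite invMg invgK mulgA mulVg mul1g.
exists three_cycle => //.
by rewrite Alt_even odd_permM !odd_tperm.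
Qed.

End Tower.

Definition tri (a b c : G) (i : 'I_3) := if i == 0 then a else if i == 1 then b else c.

Lemma alternating_cycle (B : set X) (a b : G) : clopen B ->
  (forall x, B x -> ~ translate a B x) -> (forall x, B x -> ~ translate b B x) ->
  (forall x, translate a B x -> ~ translate b B x) ->
  exists f : homeo X, alternating_group alpha f /\ [/\ forall x, B x -> f x = alpha a x,
    forall x, translate a B x -> f x = alpha (b * a^-1)%g x,
    forall x, translate b B x -> f x = alpha (b^-1)%g x &
    forall x, ~ B x -> ~ translate a B x -> ~ translate b B x -> f x = x].
Proof.
move=> cB Ba Bb ab; pose h := tri 1%g a b.
have B1 x : translate 1%g B x <-> B x by rewrite /translate /= invg1 alpha1.
have disj i j x : translate (h i) B x -> translate (h j) B x -> i = j.
  case: (ord3P i) => ->; case: (ord3P j) => ->; rewrite /h /tri /= => // /[swap].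
  - by move=> Ta /B1 /Ba.
  - by move=> Tb /B1 /Bb.
  - by move=> /B1 /Ba.
  - by move=> Tb Ta; have := ab _ Ta Tb.
  - by move=> /B1 /Bb.
  - by move=> Ta Tb; have := ab _ Ta Tb.
have [c0 c1 c2] := three_cycleE.
exists (tower_homeo cB disj three_cycle); split; first exact: tower_alternating.
split=> x /=.
- move=> /B1 Bx; have Tx : translate (h 0) B x by [].
  by rewrite (tower_in disj _ Tx) c0 /h /tri /= invg1 mulg1.
- move=> Bx; have Tx : translate (h 1) B x by [].
  by rewrite (tower_in disj _ Tx) c1.
- move=> Bx; have Tx : translate (h 2) B x by [].
  by rewrite (tower_in disj _ Tx) c2 /h /tri /= mul1g.
move=> nB na nb; apply: tower_out => i; case: (ord3P i) => -> //=.
by move=> /B1.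
Qed.

(* The double transposition exchanging [B] with [r B] and [g B] with [g r B] is
   a product of two 3-cycles of the four sets. *)
Lemma alternating_swap (B : set X) (r g : G) : clopen B ->
  (forall x, B x -> ~ translate r B x) ->
  (forall x y, B x \/ translate r B x -> B y \/ translate r B y -> alpha g x <> y) ->
  exists f : homeo X, alternating_group alpha f /\ [/\ (f * f = 1)%g,
    forall x, B x -> f x = alpha r x &
    forall x, ~ B x -> ~ translate r B x -> ~ translate g B x -> ~ translate (g * r)%g B x -> f x = x].
Proof.
move=> cB Br sep.
have sub h x : translate h B x -> exists2 y, B y & x = alpha h y.
  by move=> hx; exists (alpha (h^-1)%g x) => //; rewrite alphaVK.
have sepg x y : translate g B x -> B y \/ translate r B y -> x <> y.
  by move=> /sub[z Bz ->]; apply: sep; left.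
have sepgr x y : translate (g * r)%g B x -> B y \/ translate r B y -> x <> y.
  move=> /sub[z Bz ->]; rewrite alphaM; apply: sep; right.
  by rewrite /translate /= alphaK.
have Bg x : B x -> ~ translate g B x by move=> Bx gx; apply: (sepg _ _ gx (or_introl Bx)).
have Bgr x : B x -> ~ translate (g * r)%g B x by move=> Bx gx; apply: (sepgr _ _ gx (or_introl Bx)).
have rg x : translate r B x -> ~ translate g B x by move=> Bx gx; apply: (sepg _ _ gx (or_intror Bx)).
have rgr x : translate r B x -> ~ translate (g * r)%g B x by move=> Bx gx; apply: (sepgr _ _ gx (or_intror Bx)).
have gNgr x : translate g B x -> ~ translate (g * r)%g B x.
  by rewrite /translate /= invMg alphaM; exact: Br.
have [f1 [alt1 [f1a f1b f1c f1d]]] := alternating_cycle cB Br Bg rg.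
have [f2 [alt2 [f2a f2b f2c f2d]]] := alternating_cycle cB Bgr Bg (fun x h1 h2 => gNgr x h2 h1).
have in_r x : B x -> translate r B (alpha r x) by rewrite /translate /= alphaK.
have in_g x : B x -> translate g B (alpha g x) by rewrite /translate /= alphaK.
have in_gr x : B x -> translate (g * r)%g B (alpha (g * r)%g x) by rewrite /translate /= alphaK.
have F1 x : B x -> f2 (f1 x) = alpha r x.
  move=> Bx; rewrite f1a // f2d //; [|exact: rgr (in_r _ Bx)|exact: rg (in_r _ Bx)].
  by move=> /Br; apply; exact: in_r.
have F2 x : B x -> f2 (f1 (alpha r x)) = x.
  move=> Bx; rewrite f1b; last exact: in_r.
  by rewrite -alphaM mulgKV f2c ?alphaK //; exact: in_g.
have F3 x : B x -> f2 (f1 (alpha g x)) = alpha (g * r)%g x.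
  by move=> Bx; rewrite f1c; [rewrite alphaK f2a | exact: in_g].
have F4 x : B x -> f2 (f1 (alpha (g * r)%g x)) = alpha g x.
  move=> Bx; rewrite f1d.
  - by rewrite f2b; [rewrite -alphaM mulgKV | exact: in_gr].
  - by move=> /Bgr; apply; exact: in_gr.
  - by move=> /rgr; apply; exact: in_gr.
  - by move=> /gNgr; apply; exact: in_gr.
have F5 x : ~ B x -> ~ translate r B x -> ~ translate g B x -> ~ translate (g * r)%g B x ->
    f2 (f1 x) = x by move=> n1 n2 n3 n4; rewrite f1d // f2d.
exists (f2 * f1)%g; split; first exact: generatedM.
split=> [|x Bx|x n1 n2 n3 n4]; [|exact: F1|exact: F5].
apply: homeo_ext => x; rewrite !homeoME /=.
have [Bx|n1] := pselect (B x); first by rewrite (F1 _ Bx) (F2 _ Bx).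
have [/sub[y By ->]|n2] := pselect (translate r B x); first by rewrite (F2 _ By) (F1 _ By).
have [/sub[y By ->]|n3] := pselect (translate g B x); first by rewrite (F3 _ By) (F4 _ By).
have [/sub[y By ->]|n4] := pselect (translate (g * r)%g B x); first by rewrite (F4 _ By) (F3 _ By).
by rewrite !F5.
Qed.

End Towers.

Lemma third_color (a b : 'I_3) : exists c : 'I_3, c != a /\ c != b.
Proof.
by case: (ord3P a) => ->; case: (ord3P b) => ->;
  first [by exists 0 | by exists 1 | by exists 2].
Qed.

(** * Faithful involutions supported in a given open set *)

Section Embedding.
Variables (G : groupType) (A : finType) (Y : set (G -> A)) (x : G -> A).
Variables (pi : cantor_space -> G -> A) (alpha : G -> cantor_space -> cantor_space).
Hypotheses (Ginf : infinite_set [set: G]) (Xx : subshift Y x) (xap : aperiodic x).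
Hypothesis Yrec : forall p (F : {fset G}), Y p -> exists K : {fset G}, forall y t, Y y ->
  exists2 g, (g * t^-1)%g \in K & forall s, s \in F -> y (s * g)%g = p s.
Hypotheses (pi_inj : injective pi) (piX : forall c, subshift Y (pi c))
  (pi_surj : forall z, subshift Y z -> exists c, pi c = z)
  (pi_clopen : forall t v, clopen [set c | pi c t = v])
  (pi_cyl : forall U c, open U -> U c ->
      exists F : {fset G}, forall c', eqon F (pi c') (pi c) -> U c')
  (pi_alpha : forall g c, pi (alpha g c) = shift g (pi c)).
Hypothesis (A9 : (9 <= #|A|)%N).
Hypothesis Yline : forall p (F : {fset G}), Y p -> exists (B : {fset G}) g r q,
  [/\ 1%g \in B, r <> 1%g,
    forall a : nat -> A, exists2 y, Y y & forall j s, s \in B ->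
      y (s * r ^+ j)%g = if s == 1%g then a j else q s &
    forall s, s \in F -> (s * g)%g \in B /\
      forall a : A, (if (s * g)%g == 1%g then a else q (s * g)%g) = p s].

Let alphaA : continuous_action alpha.
Proof. exact: (alpha_action pi_inj pi_clopen pi_cyl pi_alpha). Qed.

Let alphaM g h c : alpha (g * h)%g c = alpha g (alpha h c).
Proof. by case: alphaA. Qed.

Lemma clopen_window (S : set cantor_space) (F : {fset G}) :
  (forall c c', eqon F (pi c') (pi c) -> S c -> S c') -> clopen S.
Proof.
move=> SF; split.
  by apply: (open_of_cylinders pi_clopen) => c Sc; exists F => c' e; exact: SF Sc.
rewrite -openC; apply: (open_of_cylinders pi_clopen) => c nS; exists F => c' e.
by apply: contra_not nS; apply: SF => t tF; rewrite e.
Qed.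

(** Some translate of [x] in [U] returns close to itself at a time [g] other than 1, return times
    being available far from the identity. By aperiodicity it differs from its [g]-translate at some
    [s]; putting [s] and [s * g] into the window makes the cylinder disjoint from its image. This
    [g] conjugates the involutions in [alternating_swap]. *)
Lemma disjoint_cylinder (U : set cantor_space) : open U -> U !=set0 ->
  exists p (F : {fset G}) g, [/\ subshift Y p,
    forall c, eqon F (pi c) p -> U c,
    forall c, eqon F (pi c) p -> U (alpha g c) &
    forall c c', eqon F (pi c) p -> eqon F (pi c') p -> alpha g c <> c'].
Proof.
move=> oU [u Uu]; have [Fu FuU] := pi_cyl oU Uu.
have [g0 g0x] := subshift_minimal Yrec Fu Xx (piX u).
have Xz : subshift Y (shift g0 x) by exact: subshift_shift.
have [c ec] := pi_surj Xz.
have apc : aperiodic (pi c) by rewrite ec; exact: aperiodic_shift.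
have Uc : U c by apply: FuU; rewrite ec.
have [F1 F1U] := pi_cyl oU Uc.
have [K KP] := subshift_recur Yrec F1 (piX c).
have [t tK] : exists t : G, t \notin invfs K.
  apply: contrapT => no; apply: Ginf; apply: (@sub_finite_set _ _ [set` invfs K]); last exact: finite_fset.
  by move=> h _; apply: contrapT => /negP hU; apply: no; exists h.
have [g gK gc] := KP (pi c) t (piX c).
have g1 : g <> 1%g by move=> g1; move: gK tK; rewrite g1 mul1g invfsP => ->.
have [s ns] : exists s, shift g (pi c) s <> pi c s.
  apply: contrapT => no; apply: g1; apply: apc; apply/funext => s.
  by apply: contrapT => ns; apply: no; exists s.
pose F := (F1 `|` rtranslate F1 g `|` [fset s; (s * g)%g])%fset.
have FE u' : u' \in F1 -> u' \in F by move=> uF; rewrite !in_fsetU uF.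
have FgE u' : u' \in F1 -> (u' * g)%g \in F.
  by move=> uF; rewrite !in_fsetU rtranslateP mulgK uF orbT.
have sF : s \in F by rewrite !in_fsetU !inE eqxx !orbT.
have sgF : (s * g)%g \in F by rewrite !in_fsetU !inE eqxx !orbT.
exists (pi c), F, g; split; first exact: piX.
- by move=> c' e; apply: F1U => t' tF; rewrite e ?FE.
- move=> c' e; apply: F1U => t' tF; rewrite pi_alpha /shift e ?FgE //.
  exact: gc.
move=> c1 c2 e1 e2 e; apply: ns; rewrite -e2 // -e pi_alpha /shift e1 //.
Qed.

(** To see that a nontrivial word acts nontrivially, its letters are written as edge colors along a
    line of the subshift, and each involution in turn moves the starting point one step forward. *)
Lemma free_product_embedding (U : set cantor_space) : open U -> U !=set0 ->
  embeds_into Z2Z2Z2 (rigid_stabilizer (alternating_group alpha) U).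
Proof.
move=> oU Un; have [p [F [g [Xp VU gVU VgV]]]] := disjoint_cylinder oU Un.
have [_ [y Yy [h ->]] pw] := Xp F.
have [B [gl [r [q [B1 r1 line pat]]]]] := Yline (rtranslate F h) Yy.
pose k := (h * gl)%g.
have cardI : (#|{: 'I_3 * 'I_3}| <= #|A|)%N by rewrite card_prod !card_ord.
pose code (ij : 'I_3 * 'I_3) : A := enum_val (widen_ord cardI (enum_rank ij)).
have code_inj : injective code.
  by move=> ij ij' /enum_val_inj /(congr1 val) /= /val_inj /enum_rank_inj.
pose qa (a : A) s := if s == 1%g then a else q s.
(* The points whose translate by [k^-1] shows the block of the line with letter [a]. The block
   contains the pattern [p], so [Q a] lies in the chosen cylinder and hence in [U]. *)
pose Q a : set cantor_space := [set c | eqon B (shift k^-1 (pi c)) (qa a)].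
have QV a c : Q a c -> eqon F (pi c) p.
  move=> Qc f fF; have fhB : (f * h)%g \in rtranslate F h by rewrite rtranslateP mulgK.
  have [inB e] := pat _ fhB; rewrite pw // -[RHS](e a) -[RHS]/(qa a (f * h * gl)%g) -Qc //.
  by rewrite /shift -[(f * h * gl)%g]mulgA -/k mulgK.
have Qinj a a' c : Q a c -> Q a' c -> a = a'.
  by move=> /(_ 1%g B1) + /(_ 1%g B1); rewrite /qa eqxx => -> .
pose rho := (k * r * k^-1)%g.
(* The points followed by an edge of color [i] and preceded by one of another color. At [rho c] the
   letter begins with [i], whereas at [c] it does not, so [E i] is disjoint from its translate. *)
pose E i : set cantor_space := [set c | (exists2 l, l != i & Q (code (l, i)) c) /\
  (exists2 m, m != i & Q (code (i, m)) (alpha rho c))].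
have EV i c : E i c -> eqon F (pi c) p by move=> [[l _ /QV]].
have ErV i c : E i c -> eqon F (pi (alpha rho c)) p by move=> [_ [m _ /QV]].
have cE i : clopen (E i).
  pose W := (rtranslate B k^-1 `|` rtranslate B (k^-1 * rho))%fset.
  have W1 s : s \in B -> (s * k^-1)%g \in W by move=> sB; rewrite in_fsetU rtranslateP mulgK sB.
  have W2 s : s \in B -> (s * k^-1 * rho)%g \in W.
    by move=> sB; rewrite in_fsetU orbC rtranslateP -[(s * k^-1 * rho)%g]mulgA mulgK sB.
  apply: (@clopen_window _ W) => c c' e [[l li Ql] [m mi Qm]]; split.
    by exists l => // s sB; rewrite -(Ql s sB) /shift e // W1.
  exists m => // s sB; rewrite -(Qm s sB) /shift !pi_alpha /shift e // W2 //.
have rK (gg : G) c : alpha gg^-1 (alpha gg c) = c.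
  by case: alphaA => a1 aM _; rewrite -aM mulVg a1.
have rVK (gg : G) c : alpha gg (alpha gg^-1 c) = c.
  by case: alphaA => a1 aM _; rewrite -aM mulgV a1.
have Er i c : E i c -> ~ translate alpha rho (E i) c.
  move=> [[l li Ql] _] [_ [m mi]]; rewrite rVK => Qm.
  by have /code_inj [e _] := Qinj _ _ _ Ql Qm; rewrite e eqxx in li.
have inV i c : E i c \/ translate alpha rho (E i) c -> eqon F (pi c) p.
  by move=> [/EV //|/ErV]; rewrite rVK.
have sep i c c' : E i c \/ translate alpha rho (E i) c -> E i c' \/ translate alpha rho (E i) c' ->
    alpha g c <> c'.
  by move=> /inV cV /inV cV'; exact: VgV.
have /choice[tau tauP] i : exists f : homeo cantor_space, alternating_group alpha f /\
    [/\ (f * f = 1)%g, forall c, E i c -> f c = alpha rho c & forall c, ~ U c -> f c = c].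
  have [f [fA [ff fE fo]]] := alternating_swap alphaA (cE i) (@Er i) (@sep i).
  exists f; split => //; split => // c nU; apply: fo => [Ec|Ec|Ec|Ec]; apply: nU.
  - exact: VU (EV _ _ Ec).
  - by apply: VU; apply: (inV i); right.
  - by rewrite -(rVK g c); apply: gVU; exact: EV Ec.
  rewrite -(rVK g c); apply: gVU; apply: (inV i); right.
  by move: Ec; rewrite /translate /= invMg alphaM.
have tau2 i : (tau i * tau i = 1)%g by have [_ []] := tauP i.
have [phi [[phiM phiL] _]] := Z2Z2Z2_universal tau2.
have phi1 : phi 1%g = 1%g.
  by apply: (@mulgI _ (phi 1%g)); rewrite -phiM !mulg1.
exists phi; split => //; last first.
  elim/Z2Z2Z2_ind => [|i w [IHa IHo]].
    by rewrite phi1; split => //; exact: generated1.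
  rewrite phiM phiL; have [ta [_ _ to]] := tauP i; split; first exact: generatedM.
  by move=> c nU; rewrite homeoME IHo // to.
have ker w : w <> 1%g -> phi w <> 1%g.
  move=> w1 pw1.
  (* The last letter of the word acts first, hence the reversal. *)
  pose s := rev (word w); pose c0 := head 0 s; pose c1 := last 0 s.
  have s0 : s != [::].
    apply: contra_notN w1 => /eqP s0; apply: val_inj; rewrite /=.
    by rewrite -[word w]revK -/s s0.
  (* This color is put before the first edge and, as the default of [nth], after the last one, so
     that consecutive colors differ at both ends as well. *)
  have [l0 [l0a l0b]] := third_color c0 c1.
  pose col j := nth l0 s j.
  pose let_ j := code (if j is j'.+1 then col j' else l0, col j).
  have col_ne j : (j < size s)%N -> col j.+1 != col j.
    move=> js; rewrite /col; have [lt|ge] := ltnP j.+1 (size s).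
      have := rev_reduced (valP w); rewrite -/s => /(sortedP l0) /(_ j lt).
      by rewrite eq_sym.
    rewrite (nth_default _ ge); have -> : j = (size s).-1 by lia.
    by rewrite nth_last; move: s0 l0b; rewrite /c1; case: (s).
  have [z Yz zP] := line let_.
  have [cz ecz] := pi_surj (sub_subshift Yz).
  pose P j := alpha (k * r ^+ j)%g cz.
  have PQ j : Q (let_ j) (P j).
    move=> u uB; rewrite /shift pi_alpha /shift ecz.
    by rewrite mulgA mulgKV zP.
  have PS j : P j.+1 = alpha rho (P j).
    rewrite /P.
    have -> : (k * r ^+ j.+1 = rho * (k * r ^+ j))%g.
      by rewrite /rho expgS mulgA [RHS]mulgA mulgKV.
    exact: alphaM.
  have PE j : (j < size s)%N -> E (col j) (P j).
    move=> js; split.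
      have := PQ j; rewrite /let_; case: j js => [|j] js Qj.
        by exists l0 => //; rewrite /col nth0; move: s0 l0a; rewrite /c0; case: (s).
      by exists (col j) => //; rewrite eq_sym col_ne // ltnW.
    exists (col j.+1); first exact: col_ne.
    by rewrite -PS; exact: PQ.
  (* By induction on suffixes of the word: each further letter is the color of the edge ahead and
     moves the point across it. *)
  have ev (v : seq 'I_3) (rv : reduced v) : (forall j, (j < size v)%N -> nth l0 (rev v) j = col j) ->
      (size v <= size s)%N -> phi (FreeWord rv) (P 0%N) = P (size v).
    elim: v rv => [|i v IH] rv vc vs.
      by rewrite (_ : FreeWord rv = 1%g) ?phi1 //; apply: val_inj.
    have rv' : reduced v := path_sorted rv.
    have -> : FreeWord rv = (letter i * FreeWord rv')%g.
      apply: val_inj; change (i :: v = push i v).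
      by case: v rv {IH rv' vc vs} => [//|j v] /= /andP[/negPf ->].
    rewrite phiM phiL homeoME IH; last exact: ltnW.
      have ei : i = col (size v).
        by rewrite -vc //= rev_cons nth_rcons size_rev ltnn eqxx.
      have [_ [_ tE _]] := tauP i.
      by rewrite tE /= ?PS // ei; exact: PE.
    move=> j jv; rewrite -vc /=; last exact: ltnW.
    by rewrite rev_cons nth_rcons size_rev jv.
  have := ev (word w) (valP w) (fun _ _ => erefl); rewrite size_rev leqnn => /(_ isT).
  have -> : FreeWord (valP w) = w by apply: val_inj.
  rewrite pw1 => e; have sw : size (word w) = size s by rewrite size_rev.
  (* If the word fixed the starting point, the letters at both ends of the path would coincide; but
     one begins with [l0] and the other with the last color, from which [l0] was chosen
     different. *)
  have := PQ (size (word w)); rewrite -e => Qn; have := Qinj _ _ _ (PQ 0%N) Qn.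
  rewrite sw /let_; case es : (size s) => [|n]; first by move: s0; rewrite -size_eq0 es.
  move=> /code_inj [l0n _]; have en : n = (size s).-1 by rewrite es.
  move: l0b; rewrite {1}l0n /col en nth_last /c1.
  by case: (s) s0 => // i v _ /=; rewrite eqxx.
move=> w w' e; apply/eqP; rewrite -divg_eq1; apply/eqP; apply: contrapT => /ker; apply.
have pV : (phi w'^-1 = (phi w')^-1)%g.
  by apply: (@mulgI _ (phi w')); rewrite -phiM !mulgV.
by rewrite phiM e pV mulgV.
Qed.

End Embedding.

Theorem theorem8p7 (R : realType) (Gamma : groupType) (lambda : R) :
  torsion_free Gamma -> countable [set: Gamma] -> amenable R Gamma ->
  property_ID R Gamma -> 0 < lambda ->
  exists alpha : Gamma -> cantor_space -> cantor_space,
    [/\ continuous_action alpha,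
        expansive R alpha,
        topologically_free alpha &
        minimal alpha] /\
    topological_entropy alpha setT lambda%:E /\
    forall U : set cantor_space, open U -> U !=set0 ->
      embeds_into Z2Z2Z2 (rigid_stabilizer (alternating_group alpha) U).
Proof.
move=> tf Gc _ /tower_of_property_ID[H [tl [H0 tow]]] lambda0.
(* Large enough for [ln #|A|] to exceed [lambda] and for the nine ordered pairs of colors. *)
pose m := (Num.bound (expR lambda) + 8)%N.
pose A : finType := 'I_m.+1; pose a0 : A := ord0.
have A9 : (9 <= #|A|)%N by rewrite card_ord /m addnC.
have lambdaA : lambda < ln #|A|%:R.
  rewrite -[lambda]expRK ltr_ln ?posrE ?expR_gt0 ?ltr0n ?card_ord //.
  apply: lt_le_trans (archi_boundP (ltW (expR_gt0 lambda))) _.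
  by rewrite ler_nat /m -addnS leq_addr.
have [Y [Y0 entY Yrec Ymod Yline]] := minimal_configs tf tow a0 lambda0 lambdaA.
have Ginf := infinite_group tow.
have [_ Hinf] := line_cyclic tow.
have [x Yx xap] := aperiodic_point Gc Hinf (leq_trans (isT : (1 < 9)%N) A9) Ymod Y0.
have Xx : subshift Y x by exact: sub_subshift.
have apx : aperiodic x.
  move=> g e; apply: contrapT => /xap[t]; apply.
  exact: (congr1 (@^~ t) e).
have [pi [pi_inj piX pi_surj pi_clopen pi_cyl]] := subshift_coding R a0 Gc Ginf Yrec Xx apx.
have Xmin z z' F := subshift_minimal Yrec (z := z) (z' := z') F.
have [alpha pi_alpha] := coded_action (@subshift_shift _ _ Y) piX pi_surj.
exists alpha; split; first split.
- exact: (alpha_action pi_inj pi_clopen pi_cyl pi_alpha).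
- by move=> d dP; exact: (coded_expansive pi_inj pi_clopen pi_alpha dP).
- exact: (alpha_free Xmin piX pi_surj pi_cyl pi_alpha Xx apx).
- exact: (alpha_minimal Xmin piX pi_cyl pi_alpha).
split.
  move=> d F dP FF; rewrite -entY.
  exact: (coded_entropy a0 Y0 piX pi_surj pi_clopen pi_cyl pi_alpha dP FF).
exact: (free_product_embedding Ginf Xx apx Yrec pi_inj piX pi_surj pi_clopen pi_cyl pi_alpha A9 Yline).
Qed.
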